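(* Let $(X(t),t\ge0)$ be the trajectory of the second class particle defined in the context (initially at the origin, in the totally asymmetric simple exclusion process started from $\eta^1(x)=\mathbf 1\{x\le0\}$). Then $$\lim_{t\to\infty}\frac{X(t)}{t}=U\qquad\mathbb{Q}\text{-a.s.},$$ where $U=U(\mathcal N)$ is a random variable uniformly distributed on $[-1,1]$.
   Context: Let $\mathcal N=(N_x(\cdot),x\in\mathbb{Z})$ be independent rate-1 Poisson processes on $[0,\infty)$ with joint law $\mathbb{Q}$. Given an initial configuration $\eta\in\{0,1\}^{\mathbb{Z}}$, the one-dimensional nearest-neighbor totally asymmetric simple exclusion process $(\eta_t)_{t\ge0}$ is constructed from $\mathcal N$ as follows: if $s$ is an epoch of $N_x$ and in $\eta_{s-}$ there is a particle at $x$ and none at $x+1$, then at time $s$ the particle jumps from $x$ to $x+1$; otherwise nothing happens. Let $\eta^0(x)=\mathbf 1\{x\le-1\}$ and $\eta^1(x)=\mathbf 1\{x\le0\}$, and let $(\eta^0_t)$, $(\eta^1_t)$ be the processes started from $\eta^0,\eta^1$ and built with the same Poisson processes $\mathcal N$ (basic coupling). Then for every $t$ the configurations $\eta^0_t,\eta^1_t$ differ at exactly one site, denoted $X(t)$, i.e. $X(t)=\sum_x x\,\mathbf 1\{\eta^0_t(x)\ne\eta^1_t(x)\}$; $X(0)=0$. *)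

(* Defs.v *)
From HB Require Import structures.
From mathcomp Require Import all_boot all_order all_algebra.
From mathcomp Require Import finmap.
From mathcomp Require Import all_classical all_reals all_analysis.
From mathcomp Require Import exponential_distribution uniform_distribution.
Set Implicit Arguments. Unset Strict Implicit. Unset Printing Implicit Defensive.
Import Order.TTheory GRing.Theory Num.Theory.
Import numFieldNormedType.Exports.
Local Open Scope classical_set_scope.
Local Open Scope ring_scope.

Definition mutually_independent {d} {I : choiceType} (Ω : measurableType d)
    {R : realType} (P : probability Ω R) (X : I -> Ω -> R) : Prop :=
  forall (J : {fset I}) (B : I -> set R),
    (forall i, measurable (B i)) ->
    P (\bigcap_(i in [set` J]) (X i @^-1` B i)) =
    (\prod_(i <- J) P (X i @^-1` B i))%E.

(** The Poisson clocks.  [tau x k] is the k-th inter-arrival time of the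
    Poisson process N_x; its epochs are the partial sums
    tau x 0 + ... + tau x n, n >= 0.  The family N = (N_x, x in Z) is a
    family of independent rate-1 Poisson processes iff the tau x k are
    i.i.d. Exp(1). *)
Definition poisson_clocks {d} (Ω : measurableType d) {R : realType}
    (P : probability Ω R) (tau : int * nat -> Ω -> R) : Prop :=
  (forall i, measurable_fun setT (tau i)) /\
  (forall i (B : set R), measurable B ->
     P (tau i @^-1` B) = exponential_prob (1 : R) B) /\
  mutually_independent P tau.

Definition is_epoch {R : realType} (tau : int * nat -> R) (x : int) (s : R) :
  Prop := exists n : nat, s = \sum_(k < n.+1) tau (x, (k : nat)).

Definition left_lim {R : realType} (eta : R -> int -> bool) (y : int) (s : R)
    (b : bool) : Prop :=
  exists2 e : R, 0 < e & forall r, 0 < r -> s - e < r < s -> eta r y = b.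

(** One-site update rule at an epoch, computed from the configuration at s-:
    [a], [b], [c] are eta_{s-}(y-1), eta_{s-}(y), eta_{s-}(y+1);
    [ein] : s is an epoch of N_{y-1};  [eout] : s is an epoch of N_y.
    A particle leaves y if s is an epoch of N_y, y is occupied and y+1 empty;
    a particle enters y if s is an epoch of N_{y-1}, y-1 is occupied and
    y empty; otherwise nothing happens. *)
Definition tasep_update (ein eout a b c : bool) : bool :=
  if b then ~~ (eout && ~~ c) else ein && a.

(** [eta] : [0,oo) -> {0,1}^Z is the TASEP started from [eta0] constructed
    (graphical / Harris construction) from the Poisson clocks [tau] (one sample
    point): paths are right-continuous with left limits at every site, and at
    every time s > 0 each site is updated from eta_{s-} by the jump rule
    (in particular nothing changes at times that are not epochs). *)
Definition tasep_from {R : realType} (tau : int * nat -> R)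
    (eta0 : int -> bool) (eta : R -> int -> bool) : Prop :=
  eta 0 = eta0 /\
  (forall (y : int) (t : R), 0 <= t ->
     exists2 e : R, 0 < e & forall r, t <= r < t + e -> eta r y = eta t y) /\
  (forall (y : int) (s : R), 0 < s -> exists b, left_lim eta y s b) /\
  (forall (y : int) (s : R), 0 < s -> forall a b c : bool,
     left_lim eta (y - 1) s a -> left_lim eta y s b ->
     left_lim eta (y + 1) s c ->
     eta s y = tasep_update (`[< is_epoch tau (y - 1) s >])
                            (`[< is_epoch tau y s >]) a b c).

Definition eta0_init (x : int) : bool := (x <= -1)%R.
Definition eta1_init (x : int) : bool := (x <= 0)%R.

(* Main.v *)
(** A configuration whose particles fill a half-line is the gradient of an interface started from a
    wedge, and the time at which a cell of the plane is swallowed by the interface is a last passage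
    time with exponential weights.  Burke's property makes the passage times with suitable boundary
    weights sums of independent exponentials; comparing with them gives exponential tail bounds
    around the parabola [t / 2 + x ^ 2 / (2 * t)], uniformly over all starting points.

    The second class particle is the place where the interfaces started from the wedges at [-1] and
    at [0] exchange their order.  Heights compose in the (min, +) sense, so that from the particle at
    time [t] one follows backwards, on its left and on its right, minimisers at all earlier times;
    the strict convexity of the parabola forces these paths to be almost straight.  Along a
    polynomial sequence of scales the deviations are summable, whence [X t / t] is almost surely
    Cauchy.

    For the law of the limit, the two interfaces differ by a translation and at each bond by exactly
    one unit up or down, so the expected increment of the height at [x] is a linear function of
    [Q (X t <= x)]; since the expected height is close to the parabola, this probability tends to
    [(1 + v) / 2] for [x] close to [v * t]. *)
Require Import Defs.
From HB Require Import structures.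
From mathcomp Require Import all_boot all_order all_algebra.
From mathcomp Require Import finmap.
From mathcomp Require Import all_classical all_reals all_analysis.
From mathcomp Require Import exponential_distribution uniform_distribution.
From mathcomp Require Import measurable_realfun.
From mathcomp Require Import ring lra zify.
Set Implicit Arguments. Unset Strict Implicit. Unset Printing Implicit Defensive.
Import Order.TTheory GRing.Theory Num.Theory.
Import numFieldNormedType.Exports.
Local Open Scope classical_set_scope.
Local Open Scope ring_scope.

(** * Independent exponential variables *)

(** The clocks are attached to sites, while last passage percolation wants one fresh exponential
    weight per cell. The weight of a cell is the residual time of a clock at a moment determined by
    other clocks, so a strong Markov property is needed; it is obtained by restarting one clock at a
    time and checking that the whole family keeps its law. Independence is recorded through joint
    survival functions only, the form in which both this step and Burke's map can be computed.

    Each scale has one good event over integer times and integer points of a polynomial window,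
    failing with probability below any power of the time. Lower bounds use tangent lines of the
    parabola instead of the parabola: one tangent is one choice of boundary rates and holds at all
    sites at once. These bounds degenerate near slopes [-1] and [1]; hence the family of margins
    [c], and the need to learn from the law that the limit avoids the endpoints.

    The limit is defined as an upper limit of quantities read off the two interfaces, so that it is
    measurable and does not refer to a given version of the particle. *)

Section exponential_law.
Import HBNNSimple.
Context {R : realType}.
Implicit Types (r a : R).

Let mE r : measurable_fun setT (EFin \o exponential_pdf r).
Proof. by apply/measurable_EFinP; exact: measurable_exponential_pdf. Qed.

Definition exp_law r (r0 : 0 < r) : probability (measurableTypeR R) R :=
  exponential_distribution_exponential_prob__canonical__probability_measure_Probability r0.
Arguments exp_law : simpl never.

Lemma exp_law_tail r a (r0 : 0 < r) :
  exp_law r0 `]a, +oo[%classic = (expR (- r * Num.max 0 a))%:E.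
Proof.
have neg : exp_law r0 `]-oo, 0%R[%classic = 0%E.
  rewrite /exp_law /= /exponential_prob integral0_eq// => x/=.
  by rewrite in_itv/= => xb; rewrite lt0_exponential_pdf.
have eqC b : [set` `]b, +oo[] = ~` [set` `]-oo, b]] :> set R.
  by rewrite setCitvl.
have [a0|a0] := ltP a 0.
  rewrite mulr0 expR0 eqC probability_setC//.
  rewrite (_ : exp_law r0 _ = 0%E) ?sube0//.
  apply: (@subset_measure0 _ _ _ (exp_law r0) _ _ _ _ _ neg) => //.
  by apply: subset_itvl; rewrite bnd_simp.
rewrite eqC probability_setC//.
have -> : [set` `]-oo, a]] = [set` `]-oo, 0[] `|` [set` `[0, a]] :> set R.
  by rewrite -itv_bndbnd_setU.
rewrite measureU//; last first.
  rewrite -subset0 => x []/=; rewrite !in_itv/= => x0 /andP[x0' _].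
  by move: (lt_le_trans x0 x0'); rewrite ltxx.
transitivity (1 - exp_law r0 `[0%R, a]%classic)%E.
  by congr (_ - _)%E; rewrite [X in (X + _)%E]neg add0e.
have [->|an0] := eqVneq a 0.
  rewrite mulr0 expR0 set_itv1 /exp_law /= /exponential_prob integral_set1 ?sube0//.
rewrite {1}/exp_law/= exponential_prob_itv0c; last by rewrite lt_neqAle eq_sym an0.
by rewrite -[1%E]/(1%:E) -!EFinB; congr EFin; lra.
Qed.

(** The exponential law is given by its density, so the formula is proved for simple functions and
    extended by monotone convergence. *)
Lemma ge0_integral_exp_law r (r0 : 0 < r) (f : measurableTypeR R -> \bar R) :
  measurable_fun setT f -> (forall x, 0 <= f x)%E ->
  (\int[exp_law r0]_x f x = \int[lebesgue_measure]_x (f x * (exponential_pdf r x)%:E))%E.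
Proof.
move=> mf f0.
have pE x : (0 <= (exponential_pdf r x)%:E)%E.
  by rewrite lee_fin exponential_pdf_ge0// ltW.
pose f_ := nnsfun_approx measurableT mf.
have indE (E : set R) : measurable E ->
    (\int[exp_law r0]_x (\1_E x)%:E =
     \int[lebesgue_measure]_x ((\1_E x)%:E * (exponential_pdf r x)%:E))%E.
  move=> mA; rewrite integral_indic// setIT /exp_law/= /exponential_prob.
  rewrite integral_mkcond; apply: eq_integral => x _.
  by rewrite epatch_indic muleC.
have sE (g : {nnsfun (measurableTypeR R) >-> R}) :
    (\int[exp_law r0]_x (g x)%:E =
     \int[lebesgue_measure]_x ((g x)%:E * (exponential_pdf r x)%:E))%E.
  under [LHS]eq_integral do rewrite fimfunE -fsumEFin//.
  rewrite [LHS]ge0_integral_fsum//; last 2 first.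
    - by move=> t; exact/measurable_EFinP/measurableT_comp.
    - by move=> n x _; rewrite EFinM nnfun_muleindic_ge0.
  under [RHS]eq_integral.
    move=> x xD; rewrite fimfunE -fsumEFin// ge0_mule_fsuml; last first.
      by move=> t; rewrite EFinM nnfun_muleindic_ge0.
    over.
  rewrite [RHS]ge0_integral_fsum//; last 2 first.
    - move=> t; apply: emeasurable_funM; last exact: mE.
      by apply/measurable_EFinP; do 2 apply/measurableT_comp => //.
    - by move=> n x _; rewrite mule_ge0// EFinM nnfun_muleindic_ge0.
  apply: eq_fsbigr => t; rewrite inE => -[x0 _ <-{t}].
  under eq_integral do rewrite EFinM.
  rewrite ge0_integralZl//; last 2 first.
    exact/measurable_EFinP.
    by rewrite lee_fin.
  under [RHS]eq_integral do rewrite EFinM -muleA.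
  rewrite [RHS]ge0_integralZl//; last 3 first.
    by apply: emeasurable_funM; [exact/measurable_EFinP|exact: mE].
    by move=> x _; rewrite mule_ge0// lee_fin.
    by rewrite lee_fin.
  congr (_ * _)%E; apply: indE.
  exact: (measurable_funPTI g (measurable_set1 _)).
transitivity (lim (\int[exp_law r0]_x (f_ n x)%:E @[n --> \oo])%E).
  rewrite -monotone_convergence//.
  - apply: eq_integral => ? /[!inE] xD; apply/esym/cvg_lim => //=.
    exact: cvg_nnsfun_approx.
  - by move=> n; apply/measurable_EFinP; exact: measurable_funP.
  - by move=> n ? _; rewrite lee_fin.
  - by move=> ? _ ? ? mn; rewrite lee_fin; exact/lefP/nd_nnsfun_approx.
transitivity (lim (\int[lebesgue_measure]_x ((f_ n x)%:E * (exponential_pdf r x)%:E) @[n --> \oo])%E).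
  by apply: congr_lim; apply/funext => n /=; exact: sE.
rewrite -monotone_convergence//.
- apply: eq_integral => x _; apply/cvg_lim => //=.
  apply: cvgeZr => //; exact: cvg_nnsfun_approx.
- move=> n; apply: emeasurable_funM; last exact: mE.
  exact/measurable_EFinP/measurable_funTS.
- by move=> n x _; rewrite mule_ge0// lee_fin.
- move=> x _ m n mn; rewrite lee_wpmul2r// lee_fin; exact/lefP/nd_nnsfun_approx.
Qed.

(** Exponential tilting: multiplying the density of rate [r] by [expR (c * x)] gives, up to the
    factor [r / (r - c)], the density of rate [r - c]. The Laplace transforms of the Chernoff bounds
    and the integrals of Burke's property both come from here. *)
Lemma exp_law_expR r c (r0 : 0 < r) (rc0 : 0 < r - c) (B : set R) : measurable B ->
  (\int[exp_law r0]_(x in B) (expR (c * x))%:E = (r / (r - c))%:E * exp_law rc0 B)%E.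
Proof.
move=> mB; rewrite integral_mkcond.
have mf : measurable_fun setT ((fun x : R => (expR (c * x))%:E) \_ B).
  apply/measurable_restrict => //; apply: measurable_funTS.
  apply/measurable_EFinP; apply: measurableT_comp => //; exact: measurable_funM.
rewrite ge0_integral_exp_law//; last first.
  by move=> x; apply: erestrict_ge0 => y _; rewrite lee_fin expR_ge0.
rewrite /exp_law/= /exponential_prob -ge0_integralZl; last 4 first.
  exact: mB.
  by apply: measurable_funTS; exact: mE.
  by move=> x _; rewrite lee_fin exponential_pdf_ge0// ltW.
  by rewrite lee_fin divr_ge0// ltW.
rewrite [RHS]integral_mkcond; apply: eq_integral => x _.
rewrite !patchE; case: ifPn => xB; last by rewrite mul0e.
rewrite -!EFinM; congr EFin.
have [x0|x0] := ltP x 0.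
  by rewrite !lt0_exponential_pdf// !mulr0.
rewrite !exponential_pdfE// mulrCA -expRD mulrA divfK ?gt_eqF//.
by congr (_ * expR _); lra.
Qed.
End exponential_law.

(** Independence and marginals in one formula, the joint survival function. Finite intersections of
    upper rays form a pi-system, so it determines the joint law; [Num.max 0] lets the thresholds be
    negative. *)
Definition indep_exp d (Ω : measurableType d) (R : realType)
    (Q : probability Ω R) (I : choiceType) (r : I -> R) (Y : I -> Ω -> R) :=
  (forall i, measurable_fun setT (Y i)) /\
  forall (s : seq I) (a : I -> R), uniq s ->
    Q [set w | forall i, i \in s -> a i < Y i w] =
    (\prod_(i <- s) expR (- r i * Num.max 0 (a i)))%:E.

Section measurability.
Context d (Ω : measurableType d) (R : realType).

Lemma measurable_gt (a : R) (f : Ω -> R) : measurable_fun setT f ->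
  measurable [set w | a < f w].
Proof.
move=> mf; rewrite (_ : [set _ | _] = f @^-1` `]a, +oo[).
  by rewrite -[X in measurable X]setTI; apply: mf.
by apply/seteqP; split => w /=; rewrite in_itv/= andbT.
Qed.

Lemma measurable_cylinders (I : choiceType) (Y : I -> Ω -> R) (s : seq I) (a : I -> R) :
  (forall i, measurable_fun setT (Y i)) ->
  measurable [set w | forall j, j \in s -> a j < Y j w].
Proof.
move=> mY.
rewrite (_ : [set _ | _] = \big[setI/setT]_(j <- s) [set w | a j < Y j w]).
  by apply: bigsetI_measurable => j _; apply: measurable_gt; exact: mY.
elim: s => [|j s IH]; first by rewrite big_nil; apply/seteqP; split.
rewrite big_cons -IH; apply/seteqP; split => w /=.
  by move=> h; split; [apply: h; rewrite mem_head|move=> k ks; apply: h; rewrite inE ks orbT].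
by move=> [h1 h2] k; rewrite inE => /predU1P[->//|]; exact: h2.
Qed.

End measurability.

Section independence.
Context d (Ω : measurableType d) (R : realType) (Q : probability Ω R).
Context (I : choiceType) (r : I -> R) (Y : I -> Ω -> R).
Hypothesis r0 : forall i, 0 < r i.
Hypothesis hY : indep_exp Q r Y.

(** Generators of the sigma-algebra of all coordinates except [i]; being determined by the other
    clocks means being measurable for it. *)
Definition others (i : I) : set (set Ω) :=
  [set C | exists s a, [/\ uniq s, i \notin s &
     C = [set w | forall j, j \in s -> a j < Y j w]]].

Notation Oth i := (g_sigma_algebraType (others i)).

Lemma measurable_cylinder (s : seq I) (a : I -> R) :
  measurable [set w | forall j, j \in s -> a j < Y j w].
Proof. exact: measurable_cylinders hY.1. Qed.

Lemma others_setI_closed i : setI_closed (others i).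
Proof.
move=> _ _ [s [a [us ins ->]]] [t [b [ut int ->]]].
exists (undup (s ++ t)), (fun j => if j \in s then if j \in t then Num.max (a j) (b j) else a j else b j).
split; [exact: undup_uniq|by rewrite mem_undup mem_cat negb_or ins|].
apply/seteqP; split => w /=.
  move=> [h1 h2] j; rewrite mem_undup mem_cat.
  case: ifPn => [js _|js /=]; last exact: h2.
  by case: ifPn => jt; rewrite ?gt_max ?h1 ?h2.
move=> h; split=> j js; have := h j; rewrite mem_undup mem_cat js ?orbT => /(_ isT)//.
  by case: ifPn => // _; rewrite gt_max => /andP[].
by case: ifPn => // _; rewrite gt_max => /andP[].
Qed.

Lemma others_measurable i : <<s others i >> `<=` @measurable _ Ω.
Proof.
apply: smallest_sub; first exact: sigma_algebra_measurable.
by move=> _ [s [a [_ _ ->]]]; exact: measurable_cylinder.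
Qed.

Lemma measurable_fun_others i j : j != i ->
  measurable_fun setT (Y j : Oth i -> measurableTypeR R).
Proof.
move=> ji; apply: (measurability _ (RGenOInfty.measurableE R)) => //.
move=> _ [_ [a ->] <-]; apply: sub_sigma_algebra.
exists [:: j], (fun=> a); split; rewrite ?inE 1?eq_sym//.
rewrite setTI; apply/seteqP; split => w /=; rewrite in_itv/= andbT.
  by move=> h k; rewrite inE => /eqP->.
by apply; rewrite mem_head.
Qed.

Lemma indep_tail i b C : <<s others i >> C ->
  Q ([set w | b < Y i w] `&` C) = ((expR (- r i * Num.max 0 b))%:E * Q C)%E.
Proof.
move=> GC.
have mb : measurable [set w | b < Y i w] by apply: measurable_gt; exact: hY.1.
pose k : {nonneg R} := NngNum (expR_ge0 (- r i * Num.max 0 b)).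
have := @g_sigma_algebra_measure_unique d R Ω (others i) _ (fun=> setT) _ _
  (mrestr Q mb) (mscale k Q) (@others_setI_closed i).
rewrite /mrestr /mscale/= setIC; apply => //.
- by move=> _ [s [a [_ _ ->]]]; exact: measurable_cylinder.
- move=> _; exists [::], (fun=> 0); split => //.
  by apply/seteqP; split.
- by apply/seteqP; split => // w _; exists 0.
- move=> _ [s [a [us ins ->]]].
  rewrite /mrestr /mscale/= (hY.2 s)//.
  transitivity (Q [set w | forall j, j \in i :: s -> (if j == i then b else a j) < Y j w]).
    congr (Q _); apply/seteqP; split => w /=.
      move=> [h1 h2] j; rewrite inE; case: eqP => [->//|_ /=]; exact: h1.
    move=> h; split; last by have := h i; rewrite mem_head eqxx; apply.
    move=> j js; have := h j; rewrite inE js orbT => /(_ isT).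
    by case: eqP => // ji; move: ins; rewrite -ji js.
  rewrite hY.2 /= ?ins// big_cons eqxx -EFinM; congr (_ * _)%:E.
  apply: eq_big_seq => j js; case: eqP => // ji.
  by move: ins; rewrite -ji js.
- by move=> _; rewrite /mrestr setTI (le_lt_trans (probability_le1 _ _)) ?ltry.
Qed.

Lemma measurable_with_others i :
  measurable_fun setT (fun w : Ω => (Y i w, w) : measurableTypeR R * Oth i).
Proof.
apply: (@measurable_fun_pair _ _ _ Ω (measurableTypeR R) (Oth i)); first exact: hY.1.
by move=> _ C mC; rewrite setTI; exact: (@others_measurable i C mC).
Qed.

Lemma indep_rect i (B : set R) C : measurable B -> <<s others i >> C ->
  Q ([set w | B (Y i w)] `&` C) = (exp_law (r0 i) B * Q C)%E.
Proof.
move=> mB GC.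
have mC := others_measurable GC.
have mf : measurable_fun setT (Y i : Ω -> measurableTypeR R) := hY.1 i.
have k0 : 0 <= fine (Q C) by rewrite fine_ge0.
pose m1 : measure (measurableTypeR R) R :=
  measure_function_pushforward__canonical__measure_function_Measure (mrestr Q mC) mf.
pose m2 : measure (measurableTypeR R) R := mscale (NngNum k0) (exp_law (r0 i)).
have QC : Q C = (fine (Q C))%:E by rewrite fineK// fin_num_measure.
have m1E A : m1 A = Q ([set w | A (Y i w)] `&` C) by [].
have m2E A : m2 A = (Q C * exp_law (r0 i) A)%E by rewrite QC.
suff : m1 B = m2 B.
  by rewrite m1E m2E muleC.
apply: (@measure_unique _ R (measurableTypeR R) (@RGenOInfty.G R) (fun n => `]- n%:R, +oo[%classic)) => //.
- exact: RGenOInfty.measurableE.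
- move=> _ _ [x ->] [y ->]; exists (Num.max x y).
  apply/seteqP; split => w /=; rewrite !in_itv/= !andbT ?gt_max.
    by move=> [-> ->].
  by move=> /andP[].
- by move=> n; exists (- n%:R).
- apply/seteqP; split => // x _; exists (Num.bound `|x|) => //=.
  rewrite in_itv/= andbT ltrNl; apply: le_lt_trans (ler_norm _) _.
  by rewrite normrN archi_boundP.
- move=> _ [x ->]; rewrite m1E m2E exp_law_tail.
  rewrite muleC -indep_tail//; congr (Q (_ `&` _)).
  by apply/seteqP; split => w /=; rewrite in_itv/= andbT.
- move=> n; rewrite m1E.
  rewrite (le_lt_trans (probability_le1 _ _)) ?ltry//.
  apply: measurableI => //; rewrite -[X in measurable X]setTI; exact: hY.1.
Qed.

(** The pair of [Y i] and the sample point, the latter seen only through the other coordinates, has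
    a product law, so [Y i] can be integrated out with the sample point frozen. Uniqueness of
    product measures reduces this to rectangles. *)
Lemma indep_fubini i (f : measurableTypeR R * Oth i -> \bar R) :
  measurable_fun setT f -> (forall x, 0 <= f x)%E ->
  (\int[Q]_w f (Y i w, w) = \int[Q]_w \int[exp_law (r0 i)]_y f (y, w))%E.
Proof.
move=> mf f0.
have mphi := @measurable_with_others i.
have mid : measurable_fun setT (id : Ω -> Oth i).
  by move=> _ C mC; rewrite setTI; exact: (@others_measurable i C mC).
pose mixin := isMeasurableFun.Build _ _ Ω (Oth i) _ mid.
pose idO : {mfun Ω >-> Oth i} := HB.pack (id : Ω -> Oth i) mixin.
pose QO : probability (Oth i) R := distribution Q idO.
pose m' : measure (measurableTypeR R * Oth i)%type R :=
  measure_function_pushforward__canonical__measure_function_Measure Q mphi.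
have E X : measurable X -> (exp_law (r0 i) \x QO)%E X = m' X.
  apply: product_measure_unique => A B mA mB.
  rewrite /m' /pushforward/=.
  by rewrite -indep_rect.
transitivity (\int[m']_z f z)%E.
  by rewrite ge0_integral_pushforward.
transitivity (\int[exp_law (r0 i) \x QO]_z f z)%E.
  apply: eq_measure_integral => A mA _; exact/esym/E.
rewrite fubini_tonelli2//.
rewrite ge0_integral_pushforward//.
  exact: measurable_fun_fubini_tonelli_G.
by move=> y _; apply: integral_ge0.
Qed.

Definition meas_others i (V : Ω -> R) :=
  measurable_fun setT (V : Oth i -> measurableTypeR R).

Lemma meas_othersW i (V : Ω -> R) : meas_others i V -> measurable_fun setT V.
Proof.
move=> mV _ B mB; rewrite setTI; apply: (@others_measurable i).
by have := mV measurableT B mB; rewrite setTI.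
Qed.

Lemma meas_others_gt i (V W : Ω -> R) : meas_others i V -> meas_others i W ->
  <<s others i >> [set w | V w < W w].
Proof.
move=> mV mW.
have := measurable_funB mW mV measurableT (measurable_itv `]0%R, +oo[).
rewrite setTI (_ : _ @^-1` _ = [set w | V w < W w])//.
by apply/seteqP; split => z /=; rewrite in_itv/= andbT subr_gt0.
Qed.

Lemma indep_tail_fun i (V : Ω -> R) C :
  meas_others i V -> <<s others i >> C ->
  Q ([set w | V w < Y i w] `&` C) =
  (\int[Q]_(w in C) (expR (- r i * Num.max 0 (V w)))%:E)%E.
Proof.
move=> mV GC.
have mC := others_measurable GC.
pose S := [set z : measurableTypeR R * Oth i | V z.2 < z.1] `&` (snd @^-1` C).
have mS : measurable S.
  apply: measurableI.
    rewrite (_ : [set _ | _] = (fun z : measurableTypeR R * Oth i => z.1 - V z.2) @^-1` `]0, +oo[).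
      rewrite -[X in measurable X]setTI; apply: measurable_funB => //.
      exact: (measurableT_comp mV).
    by apply/seteqP; split => z /=; rewrite in_itv/= andbT subr_gt0.
  by rewrite -[X in measurable X]setTI; apply: measurable_snd.
transitivity (\int[Q]_w (\1_S (Y i w, w))%:E)%E.
  transitivity (\int[Q]_w (\1_([set w | V w < Y i w] `&` C) w)%:E)%E.
    rewrite integral_indic ?setIT//.
    have := @measurable_with_others i measurableT _ mS.
    by rewrite setTI.
  by apply: eq_integral => w _; rewrite !indicE.
rewrite (@indep_fubini i (fun z => (\1_S z)%:E)); last 2 first.
- exact/measurable_EFinP/measurable_indic.
- by move=> z; rewrite lee_fin.
rewrite [RHS]integral_mkcond; apply: eq_integral => w _.
rewrite patchE; case: ifPn => wC.
  rewrite -(exp_law_tail (V w) (r0 i)).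
  transitivity (\int[exp_law (r0 i)]_y (\1_(`]V w, +oo[%classic) y)%:E)%E; last first.
    by rewrite integral_indic// setIT.
  apply: eq_integral => y _; rewrite !indicE /S; congr (_%:R%:E); congr nat_of_bool.
  apply/idP/idP; rewrite !inE/= in_itv/= andbT; first by move=> [].
  by move=> ?; split => //; rewrite inE in wC.
rewrite integral0_eq// => y _; rewrite indicE memNset//= => -[_].
by rewrite notin_setE in wC.
Qed.

(** Memorylessness at a random threshold determined by the other coordinates. The threshold is
    nonnegative on [C], the range where the survival function is a genuine exponential. *)
Lemma indep_memoryless i (V : Ω -> R) C (a : R) :
  meas_others i V -> <<s others i >> C -> (forall w, C w -> 0 <= V w) ->
  0 <= a ->
  Q ([set w | V w + a < Y i w] `&` C) =
  ((expR (- r i * a))%:E * Q ([set w | (V w < Y i w)%R] `&` C))%E.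
Proof.
move=> mV GC V0 a0; have mC := others_measurable GC.
rewrite (@indep_tail_fun i V)// (@indep_tail_fun i (fun w => V w + a))//; last first.
  exact: measurable_funD.
have mV' := meas_othersW mV.
rewrite -ge0_integralZl; [|exact: mC| |by move=> w _; rewrite lee_fin expR_ge0
  |by rewrite lee_fin expR_ge0]; last first.
  apply/measurable_EFinP/measurable_funTS; apply: measurableT_comp => //.
  by apply: measurable_funM => //; apply: measurable_maxr.
apply: eq_integral => w; rewrite inE => Cw; rewrite -EFinM -expRD; congr (expR _)%:E.
have := V0 _ Cw; move: (V w) => v v0.
by rewrite !max_r ?addr_ge0//; ring.
Qed.

Lemma indep_atomless i (V : Ω -> R) : meas_others i V ->
  Q [set w | Y i w = V w] = 0%E.
Proof.
move=> mV.
pose S := [set z : measurableTypeR R * Oth i | z.1 = V z.2].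
have mS : measurable S.
  rewrite (_ : S = (fun z : measurableTypeR R * Oth i => z.1 - V z.2) @^-1` [set 0]).
    rewrite -[X in measurable X]setTI; apply: measurable_funB => //.
    exact: (measurableT_comp mV).
  by apply/seteqP; split => z /=; rewrite /S/= => h; apply/eqP; move/eqP: h; rewrite subr_eq0.
transitivity (\int[Q]_w (\1_S (Y i w, w))%:E)%E.
  transitivity (\int[Q]_w (\1_([set w | Y i w = V w]) w)%:E)%E.
    rewrite integral_indic ?setIT//.
    have := @measurable_with_others i measurableT _ mS.
    by rewrite setTI.
  by apply: eq_integral => w _; rewrite !indicE.
rewrite (@indep_fubini i (fun z => (\1_S z)%:E)); last 2 first.
- exact/measurable_EFinP/measurable_indic.
- by move=> z; rewrite lee_fin.
rewrite integral0_eq// => w _.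
transitivity (\int[exp_law (r0 i)]_y (\1_([set V w]) y)%:E)%E.
  by apply: eq_integral => y _; rewrite !indicE.
rewrite integral_indic// setIT.
by rewrite /exp_law /= /exponential_prob integral_set1.
Qed.

Lemma indep_expectationM i (g : measurableTypeR R -> \bar R) (Z : Oth i -> \bar R) :
  measurable_fun setT g -> (forall x, 0 <= g x)%E ->
  measurable_fun setT Z -> (forall x, 0 <= Z x)%E ->
  (\int[Q]_w (g (Y i w) * Z w) =
   \int[exp_law (r0 i)]_y g y * \int[Q]_w Z w)%E.
Proof.
move=> mg g0 mZ Z0.
rewrite (@indep_fubini i (fun z => g z.1 * Z z.2)%E); last 2 first.
- apply: emeasurable_funM; first exact: measurableT_comp.
  exact: (measurableT_comp mZ).
- by move=> z; rewrite mule_ge0.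
rewrite -ge0_integralZl//; last 2 first.
- move=> _ B mB; rewrite setTI; apply: (@others_measurable i).
  by have := mZ measurableT B mB; rewrite setTI.
- exact: integral_ge0.
apply: eq_integral => w _; rewrite muleC -ge0_integralZl//.
by apply: eq_integral => y _; rewrite muleC.
Qed.

End independence.

Arguments others {d Ω R I} Y i.
Arguments meas_others {d Ω R I} Y i V.

(** * Restarting a Poisson clock at a later time *)

Section clock_update.
Context {R : realType}.
Implicit Types (y : int * nat -> R) (x : int) (m : nat) (D : R).

Definition psum y x m n : R := \sum_(l < n) y (x, (m + l)%N).

(** Index, counted from [m], of the interval of the clock that contains age [D]. The default [0] is
    taken only when the partial sums never exceed [D]. *)
Definition hit y x m D : nat :=
  if pselect (exists n, D < psum y x m n.+1) is left h then ex_minn h else 0%N.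

(* The clock at [x] read from its [m]-th interval on, restarted [D] time units
   later: the interval straddling [D] is cut, the following ones are kept. *)
Definition restart y x m D (i : int * nat) : R :=
  if (i.1 == x) && (m <= i.2)%N then
    if i.2 == m then psum y x m (hit y x m D).+1 - D
    else y (x, (i.2 + hit y x m D)%N)
  else y i.

Lemma psumS y x m n : psum y x m n.+1 = psum y x m n + y (x, (m + n)%N).
Proof. by rewrite /psum big_ord_recr. Qed.

Lemma psum0 y x m : psum y x m 0 = 0.
Proof. by rewrite /psum big_ord0. Qed.

Variables (y : int * nat -> R) (x : int) (m : nat) (D : R).
Hypothesis y0 : forall i, 0 < y i.
Hypothesis D0 : 0 <= D.
Hypothesis yD : exists n, D < psum y x m n.+1.

Lemma psum_mono : {homo psum y x m : k n / (k <= n)%N >-> k <= n}.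
Proof.
move=> k n /subnK <-; elim: (n - k)%N => [|j IH]; first by rewrite add0n.
by rewrite addSn psumS (le_trans IH)// lerDl ltW.
Qed.

Lemma hitP : psum y x m (hit y x m D) <= D < psum y x m (hit y x m D).+1.
Proof.
rewrite /hit; case: pselect => // h; case: ex_minnP => n Dn nmin.
rewrite Dn andbT; case: n Dn nmin => [|n] Dn nmin; first by rewrite psum0.
by rewrite leNgt; apply/negP => /nmin; rewrite ltnn.
Qed.

Lemma hit_eq n : (hit y x m D == n) = (psum y x m n <= D < psum y x m n.+1).
Proof.
have /andP[h1 h2] := hitP.
apply/eqP/idP => [<-|/andP[n1 n2]]; first by rewrite h1.
apply/eqP; rewrite eqn_leq; apply/andP; split; rewrite leqNgt; apply/negP => hn.
  by have := psum_mono hn; rewrite leNgt (le_lt_trans h1 n2).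
by have := psum_mono hn; rewrite leNgt (le_lt_trans n1 h2).
Qed.

Lemma restart_gt0 i : 0 < restart y x m D i.
Proof.
rewrite /restart; case: ifP => // _; case: ifP => // _.
by have /andP[_ ?] := hitP; rewrite subr_gt0.
Qed.

End clock_update.

Section restart_law.
Context d (Ω : measurableType d) (R : realType) (Q : probability Ω R).
Context (Y : int * nat -> Ω -> R) (x : int) (m : nat) (D : Ω -> R).
Hypothesis hY : indep_exp Q (fun=> 1) Y.
Hypothesis Y0 : forall i w, 0 < Y i w.
Hypothesis D0 : forall w, 0 <= D w.
Hypothesis YD : forall w, exists n, D w < psum (Y ^~ w) x m n.+1.
Hypothesis mD : forall k, (m <= k)%N -> meas_others Y (x, k) D.

Let N w := hit (Y ^~ w) x m (D w).
Let S n w := psum (Y ^~ w) x m n.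

Let NE n : [set w | N w = n] = [set w | S n w <= D w] `&` [set w | D w - S n w < Y (x, (m + n)%N) w].
Proof.
apply/seteqP; split => w /=.
  move/eqP; rewrite /N hit_eq// => /andP[? ?]; split => //.
  by rewrite ltrBlDr addrC -psumS.
move=> [h1]; rewrite ltrBlDr addrC -psumS => h2.
by apply/eqP; rewrite hit_eq// h1.
Qed.

Let mS n k : (m + n <= k)%N -> meas_others Y (x, k) (S n).
Proof.
move=> nk; rewrite /meas_others /S /psum; apply: measurable_sum => l.
apply: (measurable_fun_others (Y := Y)).
by rewrite xpair_eqE eqxx/=; have := ltn_ord l; lia.
Qed.

Let mN n : measurable [set w | N w = n].
Proof.
rewrite NE; apply: measurableI.
  rewrite (_ : [set _ | _] = ~` [set w | D w < S n w]).
    apply: measurableC; apply: (others_measurable hY (i := (x, (m + n)%N))).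
    by apply: meas_others_gt; [exact: mD (leq_addr _ _)|exact: mS].
  by apply/seteqP; split => w /=; [rewrite leNgt => /negP|move/negP; rewrite -leNgt].
have := measurable_funB (hY.1 (x, (m + n)%N)) (measurable_funB (meas_othersW hY (mD (leq_addr n m))) (meas_othersW hY (mS (leqnn (m + n)%N)))) measurableT (measurable_itv `]0%R, +oo[).
rewrite setTI (_ : _ @^-1` _ = [set w | D w - S n w < Y (x, (m + n)%N) w])//.
by apply/seteqP; split => z /=; rewrite in_itv/= andbT subr_gt0.
Qed.

Let measurable_N (F : nat -> Ω -> R) : (forall n, measurable_fun setT (F n)) ->
  measurable_fun setT (fun w => F (N w) w).
Proof.
move=> mF _ B mB; rewrite setTI.
rewrite (_ : _ @^-1` _ = \bigcup_n ([set w | N w = n] `&` F n @^-1` B)).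
  apply: bigcupT_measurable => n; apply: measurableI => //.
  by rewrite -[X in measurable X]setTI; exact: mF.
apply/seteqP; split => w /=; first by move=> h; exists (N w).
by move=> [n _ [/= <-]].
Qed.

(** Strong Markov property of one clock: by [mD] the delay is determined without looking at interval
    [(x, k)], for each [k] from [m] on. When the restart falls in interval [m + n], memorylessness
    handles the cut interval and independence the later ones. The resulting factor does not depend
    on [n], so summing over [n] restores the product. *)
Lemma indep_exp_restart :
  indep_exp Q (fun=> 1) (fun i w => restart (Y ^~ w) x m (D w) i).
Proof.
split.
  move=> i; rewrite /restart; case: ((i.1 == x) && (m <= i.2)%N); last exact: hY.1.
  case: (i.2 == m); last exact: (measurable_N (F := fun n => Y (x, (i.2 + n)%N)) (fun n => hY.1 _)).
  apply: measurable_funB; last exact: (meas_othersW hY (mD (leqnn m))).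
  apply: (measurable_N (F := fun n w => psum (Y ^~ w) x m n.+1)) => n.
  by apply: measurable_sum => l; exact: hY.1.
move=> s a us.
pose tl (i : int * nat) := (i.1 == x) && (m <= i.2)%N.
pose st := [seq i <- s | tl i && (i != (x, m))].
pose s0 := [seq i <- s | ~~ tl i].
(* The cut interval is positive, so when [(x, m)] is not tested the threshold [0] adds no
   condition. *)
pose a0 : R := if (x, m) \in s then Num.max 0 (a (x, m)) else 0.
have a00 : 0 <= a0 by rewrite /a0; case: ifP => // _; rewrite le_max lexx.
pose A := [set w | forall i, i \in s0 -> a i < Y i w].
pose H n := [set w | (D w - S n w) + a0 < Y (x, (m + n)%N) w] `&` (A `&` [set w | S n w <= D w]).
pose E n (t : seq (int * nat)) := [set w | forall i, i \in t -> a i < Y (x, (i.2 + n)%N) w] `&` H n.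
have GA k : (m <= k)%N -> <<s others Y (x, k) >> A.
  move=> mk; apply: sub_sigma_algebra; exists s0, a; split => //.
    by rewrite filter_uniq.
  by rewrite mem_filter /tl/= eqxx mk.
have GS n k : (m + n <= k)%N -> <<s others Y (x, k) >> [set w | S n w <= D w].
  move=> mk; rewrite (_ : [set _ | _] = ~` [set w | D w < S n w]); last first.
    by apply/seteqP; split => w /=; [rewrite leNgt => /negP|move/negP; rewrite -leNgt].
  apply: sigma_algebraC; apply: meas_others_gt; last exact: mS.
  by apply: mD; rewrite (leq_trans _ mk)// leq_addr.
have GH n k : (m + n < k)%N -> <<s others Y (x, k) >> (H n).
  move=> mk; apply: (@measurableI _ (g_sigma_algebraType (others Y (x, k)))); last first.
    by apply: (@measurableI _ (g_sigma_algebraType (others Y (x, k)))); [apply: GA; lia|exact: GS (ltnW mk)].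
  apply: meas_others_gt.
    rewrite /meas_others; apply: measurable_funD => //; apply: measurable_funB.
      by apply: mD; lia.
    by apply: mS; lia.
  by apply: measurable_fun_others; rewrite xpair_eqE eqxx/=; lia.
have EE n t : uniq t -> (forall i, i \in t -> (i.1 == x) && (m < i.2)%N) ->
    Q (E n t) = ((\prod_(i <- t) expR (- 1 * Num.max 0 (a i)))%:E * Q (H n))%E.
  elim: t => [_ _|i t IH /= /andP[it ut] ht].
    by rewrite big_nil mul1e /E; congr (Q _); apply/seteqP; split => w //= [].
  have /andP[/eqP ix mi] := ht i (mem_head _ _).
  rewrite big_cons EFinM -muleA -IH//; last by move=> j jt; apply: ht; rewrite inE jt orbT.
  have hx j : j \in t -> j.1 = x.
    by move=> jt; have := ht j; rewrite inE jt orbT => /(_ isT) /andP[/eqP].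
  rewrite -(@indep_tail _ _ _ _ _ _ _ hY (x, (i.2 + n)%N)).
    congr (Q _); apply/seteqP; split => w /=.
      move=> [h1 h2]; split; first exact: h1 (mem_head _ _).
      by split => // j jt; apply: h1; rewrite inE jt orbT.
    move=> [h1 [h2 h3]]; split => // j; rewrite inE => /predU1P[->//|]; exact: h2.
  apply: (@measurableI _ (g_sigma_algebraType (others Y (x, (i.2 + n)%N)))); last by apply: GH; rewrite ltn_add2r.
  apply: sub_sigma_algebra.
  exists [seq (x, (j.2 + n)%N) | j <- t], (fun j => a (x, (j.2 - n)%N)); split.
  - rewrite map_inj_in_uniq// => -[j1 j2] [k1 k2] /hx/= -> /hx/= -> [].
    by move=> /addIn ->.
  - apply/mapP => -[[j1 j2] jt [] /addIn/= ij]; have /= jx := hx _ jt.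
    by move: it jt; rewrite jx -ix -ij -surjective_pairing => /negbTE ->.
  - apply/seteqP; split => w /= h.
      move=> _ /mapP[[j1 j2] jt ->]; rewrite addnK.
      by have /= := h _ jt; rewrite -{2}(hx _ jt).
    move=> [j1 j2] jt; have /= := h (x, (j2 + n)%N); rewrite addnK => hh.
    rewrite [j1](hx _ jt); apply: hh; apply/mapP.
    by exists (j1, j2).
have ust : uniq st by rewrite filter_uniq.
have hst i : i \in st -> (i.1 == x) && (m < i.2)%N.
  case: i => i1 i2; rewrite mem_filter /tl/= => /andP[/andP[/andP[/eqP-> h]]].
  by rewrite eqxx xpair_eqE eqxx/= ltn_neqAle eq_sym h => ->.
have HN n w : H n w -> N w = n.
  move=> [h1 [_ h2]]; have : [set w | N w = n] w by rewrite NE; split => //=; apply: le_lt_trans h1; rewrite lerDl.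
  by [].
have mA : measurable A by exact: (others_measurable hY (GA m (leqnn m))).
have mE n : measurable (E n st).
  apply: measurableI; last first.
    by apply: (others_measurable hY (i := (x, (m + n).+1))); apply: GH.
  rewrite (_ : [set _ | _] = \big[setI/setT]_(i <- st) [set w | a i < Y (x, (i.2 + n)%N) w]).
    by apply: bigsetI_measurable => j _; apply: measurable_gt; exact: hY.1.
  elim: (st) => [|j t IH]; first by rewrite big_nil; apply/seteqP; split.
  rewrite big_cons -IH; apply/seteqP; split => w /=.
    by move=> h; split; [apply: h; rewrite mem_head|move=> k ks; apply: h; rewrite inE ks orbT].
  by move=> [h1 h2] k; rewrite inE => /predU1P[->//|]; exact: h2.
(* Split according to the number [n] of intervals consumed; on [E n st] the later restarted
   coordinates are those of [Y] shifted by [n]. *)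
transitivity (Q (\bigcup_n E n st)).
  congr (Q _); apply/seteqP; split => w /=.
    move=> h; exists (N w) => //; split => /=.
      move=> i; rewrite mem_filter => /andP[/andP[ti ixm] si]; have := h _ si.
      rewrite /restart; move: (ti); rewrite /tl => ->; case: eqP => // i2.
      by move: ixm ti; rewrite /tl -i2; case: (i) => i1 i2' /=; rewrite xpair_eqE eqxx andbT => /negbTE ->.
    have hw : [set w | N w = N w] w by [].
    have /andP[h1 h2] := @hitP _ (Y ^~ w) x m (D w) (D0 w) (YD w).
    split => /=.
      suff : a0 < psum (Y ^~ w) x m (N w).+1 - D w by rewrite psumS /S; lra.
      rewrite /a0; case: ifPn => xms; last by rewrite subr_gt0.
      have := h _ xms; rewrite /restart eqxx leqnn/= eqxx => hh.
      by rewrite gt_max hh subr_gt0 h2.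
    split => //= i; rewrite mem_filter => /andP[ti si]; have := h _ si.
    by rewrite /restart; move: ti; rewrite /tl => /negbTE ->.
  move=> [n _ [hst' Hn]] i si; have Nn := HN _ _ Hn; move: Hn => [h1 [h2 h3]].
  rewrite /restart; case: ifPn => ti; last by apply: h2; rewrite mem_filter ti.
  rewrite -/(N w) Nn; case: ifPn => [/eqP i2|i2]; last first.
    apply: hst'; rewrite mem_filter si andbT; rewrite /tl ti/=.
    by apply: contra i2 => /eqP ->.
  have ixm : i = (x, m).
    by move: ti i2; case: (i) => i1 i2' /= /andP[/eqP-> _] ->.
  have : a0 < psum (Y ^~ w) x m n.+1 - D w.
    move: h1; rewrite /= psumS /S => h1; lra.
  by rewrite /a0 -{1}ixm si gt_max -ixm => /andP[].
rewrite measure_semi_bigcup; [|exact: mE| |exact: bigcupT_measurable]; last first.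
  by move=> n k _ _ [w [[_ /HN <-] [_ /HN <-]]].
transitivity (\sum_(n <oo) ((\prod_(i <- st) expR (- 1 * Num.max 0 (a i)) * expR (- 1 * a0))%:E
    * Q (A `&` [set w | N w = n])))%E.
  apply: eq_eseriesr => n _; etransitivity; first exact: EE.
  rewrite EFinM -muleA; congr (_ * _)%E.
  rewrite /H (@indep_memoryless _ _ _ _ _ _ _ _ hY (x, (m + n)%N) (fun w => D w - S n w))//.
  - congr (_ * Q _)%E; rewrite NE; apply/seteqP; split => w /=; by move=> [h1 [h2 h3]].
  - by apply: measurable_funB; [apply: mD; exact: leq_addr|exact: mS].
  - apply: (@measurableI _ (g_sigma_algebraType (others Y (x, (m + n)%N)))); [by apply: GA; exact: leq_addr|exact: GS].
  - by move=> w [_ /=]; rewrite subr_ge0.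
rewrite nneseriesZl//.
rewrite -measure_semi_bigcup; [|by move=> n; apply: measurableI| |
  by apply: bigcupT_measurable => n; apply: measurableI]; last first.
  by move=> n k _ _ [w [[_ /= <-] [_ /= <-]]].
rewrite (_ : \bigcup_n _ = A); last first.
  apply/seteqP; split => w; first by move=> [n _ []].
  by move=> Aw; exists (N w).
transitivity ((\prod_(i <- st) expR (-1 * Num.max 0 (a i)) * expR (-1 * a0))%:E
    * (\prod_(i <- s0) expR (-1 * Num.max 0 (a i)))%:E)%E.
  by congr (_ * _)%E; apply: hY.2; rewrite filter_uniq.
rewrite -EFinM; congr EFin.
rewrite [RHS](bigID tl)/= !big_filter; congr (_ * _).
rewrite [RHS](bigID (fun i => i != (x, m)))/=; congr (_ * _).
rewrite /a0; case: ifPn => xms.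
  rewrite (eq_bigl (pred1 (x, m))); first by rewrite -big_filter filter_pred1_uniq// big_seq1.
  move=> i /=.
  rewrite negbK; case: eqP => [->|_]; last by rewrite andbF.
  by rewrite /tl/= eqxx leqnn.
rewrite mulr0 expR0 big_seq_cond big1// => i /andP[si /andP[_]].
by rewrite negbK => /eqP ixm; move: xms; rewrite -ixm si.
Qed.

End restart_law.

(** * Last passage times read off the clocks *)

Section growth.
Context {R : realType}.
Implicit Types (f : nat -> nat -> R -> R) (s : R).

(** A growth recursion over the quadrant: a cell starts when its left and lower neighbours are
    finished, and [f] tells when it finishes. Missing neighbours count as finished at time [s].
    Adding a weight gives last passage times; jumping to the next epoch of a clock gives filling
    times of the interface. The inner [fix] over [i] makes the double recursion structural. *)
Fixpoint grow f s (j : nat) : nat -> R :=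
  fix row (i : nat) : R :=
    f i j (Num.max (if i is i'.+1 then row i' else s)
                   (if j is j'.+1 then grow f s j' i else s)).

Definition gleft f s i j := if i is i'.+1 then grow f s j i' else s.
Definition gdown f s i j := if j is j'.+1 then grow f s j' i else s.

Lemma growE f s i j :
  grow f s j i = f i j (Num.max (gleft f s i j) (gdown f s i j)).
Proof. by case: j => [|j]; case: i. Qed.

#[local] Arguments grow : simpl never.

Lemma grow_ext f g s i j :
  (forall i' j', (i' <= i)%N -> (j' <= j)%N -> f i' j' =1 g i' j') ->
  grow f s j i = grow g s j i.
Proof.
elim: j i => [|j IHj]; elim=> [|i IHi] fg; rewrite !growE /= fg//.
- by rewrite IHi// => i' j' ii jj; apply: fg => //; exact: leqW.
- by rewrite IHj// => i' j' ii jj; apply: fg => //; exact: leqW.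
- rewrite IHi//; last by move=> i' j' ii jj; apply: fg => //; exact: leqW.
  by rewrite IHj// => i' j' ii jj; apply: fg => //; exact: leqW.
Qed.

End growth.
Arguments grow : simpl never.

Section clocks.
Context {R : realType}.
Implicit Types (y : int * nat -> R) (x z : int) (s t : R).

(** The first epoch of the clock at [x] strictly after [s]; strictness reflects that the jump rule
    looks at the configuration just before the epoch. *)
Definition next y x s : R := psum y x 0 (hit y x 0 s).+1.

(** Time at which the cell [(i, j)] above the wedge at [z] is filled when growth starts at time [s].
    The cells of one diagonal share the clock of one site. *)
Definition Gt y z s (i j : nat) : R :=
  grow (fun i j => next y (z + i%:Z - j%:Z)) s j i.

(** Site and rank along the diagonal: a bijection from cells to clock intervals, so that weights can
    be stored in a family with the index set of the clocks. *)
Definition cell z (i j : nat) : int * nat := (z + i%:Z - j%:Z, minn i j).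

Definition lpp (w : nat -> nat -> R) s (i j : nat) : R :=
  grow (fun i j u => u + w i j) s j i.

Definition divg y := forall x (B : R), exists n, B < psum y x 0 n.

Lemma psum_cat y x k n : psum y x 0 (k + n) = psum y x 0 k + psum y x k n.
Proof.
elim: n => [|n IH]; first by rewrite addn0 psum0 addr0.
by rewrite addnS !psumS IH addrA.
Qed.

Lemma psum_catm y x m k n : psum y x m (k + n) = psum y x m k + psum y x (m + k) n.
Proof.
elim: n => [|n IH]; first by rewrite addn0 psum0 addr0.
by rewrite addnS !psumS IH addrA addnA.
Qed.

Lemma eq_psum y y' x m m' n :
  (forall l, (l < n)%N -> y (x, (m + l)%N) = y' (x, (m' + l)%N)) ->
  psum y x m n = psum y' x m' n.
Proof. by move=> h; apply: eq_bigr => l _; exact: h. Qed.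

Lemma divg_hit y x m (D : R) : (forall i, 0 < y i) -> divg y ->
  exists n, D < psum y x m n.+1.
Proof.
move=> y0 /(_ x (psum y x 0 m + D))[n hn]; exists n.
have := @psum_mono _ y x 0 y0 n (m + n.+1)%N; rewrite psum_cat => h.
by have : psum y x 0 m + D < psum y x 0 m + psum y x m n.+1; [rewrite (lt_le_trans hn)// h//; lia|rewrite ltrD2l].
Qed.

Section positive.
Variables (y : int * nat -> R).
Hypothesis y0 : forall i, 0 < y i.
Hypothesis yd : divg y.

Lemma next_gt x s : 0 <= s -> s < next y x s.
Proof.
by move=> s0; have /andP[] := @hitP _ y x 0 s s0 (divg_hit _ _ _ y0 yd).
Qed.

Lemma next_le x s n : 0 <= s -> s < psum y x 0 n.+1 -> next y x s <= psum y x 0 n.+1.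
Proof.
move=> s0 sn; apply: psum_mono => //; rewrite ltnS leqNgt; apply/negP => nh.
have /andP[h _] := @hitP _ y x 0 s s0 (divg_hit _ _ _ y0 yd).
by have := le_trans (psum_mono x 0 y0 nh) h; rewrite leNgt sn.
Qed.

Lemma next_mono x s t : 0 <= s -> s <= t -> next y x s <= next y x t.
Proof.
by move=> s0 st; apply: next_le => //; exact: le_lt_trans st (next_gt _ (le_trans s0 st)).
Qed.

Lemma restart_psum x m (D : R) k :
  psum (restart y x m D) x m.+1 k = psum y x m ((hit y x m D).+1 + k) - psum y x m (hit y x m D).+1.
Proof.
rewrite psum_catm addrC addKr; apply: eq_psum => l lk.
rewrite /restart/= eqxx leqW ?leq_addr//= addSn ifF; last by apply/eqP; lia.
by congr (y (_, _)); lia.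
Qed.

Lemma restart_prefix x m (D : R) x' m' k : x' != x \/ (m' + k <= m)%N ->
  psum (restart y x m D) x' m' k = psum y x' m' k.
Proof.
move=> h; apply: eq_psum => l lk; rewrite /restart/= ifF//.
by case: h => [/negbTE->//|h]; apply/negP => /andP[_]; lia.
Qed.

Lemma divg_restart x m (D : R) : divg (restart y x m D).
Proof.
move=> x' B; have [->|nx] := eqVneq x' x; last first.
  by have [n hn] := yd x' B; exists n; rewrite restart_prefix//; left.
set N := hit y x m D.
have [n hn] := yd x (B + D).
exists (m + (1 + n))%N; rewrite psum_cat psum_catm restart_prefix; last by right; rewrite add0n.
rewrite addn1 restart_psum -/N.
have -> : psum (restart y x m D) x m 1 = psum y x m N.+1 - D.
  by rewrite psumS psum0 add0r addn0 /restart/= eqxx leqnn eqxx.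
have E : psum y x 0 m + psum y x m (N.+1 + n) = psum y x 0 (m + (N.+1 + n)) by rewrite psum_cat.
have : psum y x 0 n <= psum y x 0 (m + (N.+1 + n)) by apply: psum_mono => //; lia.
lra.
Qed.

(** A clock is used once for each cell of its diagonal, and each use consumes the cut interval:
    after the restart, the next use reads the same clock from interval [m + 1] on. *)
Lemma restart_next x m (T S S' : R) (x' : int) (y' : int * nat -> R) :
  (forall S, T <= S -> next y' x' S = T + psum y x m (hit y x m (S - T)).+1) ->
  T <= S -> next y' x' S <= S' ->
  next y' x' S' = next y' x' S +
    psum (restart y x m (S - T)) x m.+1 (hit (restart y x m (S - T)) x m.+1 (S' - next y' x' S)).+1.
Proof.
move=> nE TS SS'; set D := S - T; set N := hit y x m D.
have D0 : 0 <= D by rewrite subr_ge0.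
have /andP[h1 h2] := @hitP _ y x m D D0 (divg_hit _ _ _ y0 yd).
have NS : next y' x' S = T + psum y x m N.+1 by rewrite nE.
have TS' : T <= S'.
  by apply: le_trans TS (le_trans _ SS'); rewrite NS; move: h2; rewrite -/N /D; lra.
set D' := S' - next y' x' S.
have D'0 : 0 <= D' by rewrite subr_ge0.
pose y2 := restart y x m D.
have y20 i : 0 < y2 i by apply: restart_gt0 => //; exact: divg_hit.
have /andP[k1 k2] := @hitP _ y2 x m.+1 D' D'0 (divg_hit _ _ _ y20 (divg_restart x m D)).
rewrite nE// restart_psum -/D -/N NS.
set k := hit y2 x m.+1 D' in k1 k2 *.
suff /eqP -> : hit y x m (S' - T) == (N.+1 + k)%N by rewrite -addnS; lra.
rewrite hit_eq//; last 2 first.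
- by rewrite subr_ge0.
- exact: divg_hit.
move: k1 k2; rewrite !restart_psum -/N /D' NS -addnS => k1 k2.
by apply/andP; split; lra.
Qed.

End positive.

Lemma lpp_ge (w : nat -> nat -> R) s i j : (forall i j, 0 < w i j) -> s < lpp w s i j.
Proof.
move=> w0; rewrite /lpp; elim: i j => [|i IHi] j; rewrite growE ltr_pwDr// le_max /=.
  by rewrite lexx.
by rewrite ltW.
Qed.

Lemma lpp_mono (w : nat -> nat -> R) s i j : (forall i j, 0 < w i j) ->
  lpp w s i j <= lpp w s i.+1 j /\ lpp w s i j <= lpp w s i j.+1.
Proof.
move=> w0; split; rewrite /lpp [leRHS]growE /=; apply: ler_wpDr;
  [exact: ltW|by rewrite le_max lexx|exact: ltW|by rewrite le_max lexx orbT].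
Qed.

End clocks.

Section lpp_law.
Context d (Ω : measurableType d) (R : realType) (Q : probability Ω R).
Context (Y : int * nat -> Ω -> R) (z : int) (s : R) (M : nat).
Hypothesis s0 : 0 <= s.

Lemma meas_others_lpp (Z : int * nat -> Ω -> R) k i j :
  (forall i' j', (i' <= i)%N -> (j' <= j)%N -> cell z i' j' != k) ->
  meas_others Z k (fun w => lpp (fun i j => Z (cell z i j) w) s i j).
Proof.
rewrite /lpp; elim: j i => [|j IHj]; elim=> [|i IHi] h.
- rewrite /meas_others /=; apply: measurable_funD => //.
  by apply: (measurable_fun_others (Y := Z)); exact: h.
- rewrite /meas_others /=; apply: measurable_funD; last by apply: (measurable_fun_others (Y := Z)); exact: h.
  apply: measurable_maxr => //; apply: IHi => i' j' ii jj; apply: h => //; exact: leqW.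
- rewrite /meas_others /=; apply: measurable_funD; last by apply: (measurable_fun_others (Y := Z)); exact: h.
  apply: measurable_maxr => //; apply: IHj => i' j' ii jj; apply: h => //; exact: leqW.
- rewrite /meas_others; apply: measurable_funD; last by apply: (measurable_fun_others (Y := Z)); exact: h.
  apply: measurable_maxr; first by apply: IHi => i' j' ii jj; apply: h => //; exact: leqW.
  by apply: IHj => i' j' ii jj; apply: h => //; exact: leqW.
Qed.

(* Cells are processed in lexicographic order of [(j, i)]; at stage [(i, j)] the
   family [Z] carries the passage weights of the processed cells and, for every
   site, the intervals of its clock not yet used. *)
Let done (i j i' j' : nat) := (i' < M)%N && ((j' < j)%N || (j' == j) && (i' < i)%N).
(** Time of the previous use of the clock of the cell, namely the filling time of the cell before it
    on the same diagonal, or [0] for a first use. *)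
Let start w i j := if (i == 0%N) || (j == 0%N) then 0 else Gt (Y ^~ w) z s i.-1 j.-1.
Let stage i j (Z : int * nat -> Ω -> R) :=
  [/\ indep_exp Q (fun=> 1) Z, (forall k w, 0 < Z k w), (forall w, divg (Z ^~ w)),
    (forall w i' j', done i j i' j' ->
      Gt (Y ^~ w) z s i' j' = lpp (fun i j => Z (cell z i j) w) s i' j') &
    (forall w i' j', (i' < M)%N -> ~~ done i j i' j' ->
      [|| i' == 0%N, j' == 0%N | done i j i'.-1 j'.-1] ->
      forall S, start w i' j' <= S -> next (Y ^~ w) (cell z i' j').1 S =
        start w i' j' + psum (Z ^~ w) (cell z i' j').1 (cell z i' j').2
          (hit (Z ^~ w) (cell z i' j').1 (cell z i' j').2 (S - start w i' j')).+1)].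

Let done_le i j i1 j1 i2 j2 : done i j i1 j1 -> (i2 <= i1)%N -> (j2 <= j1)%N ->
  done i j i2 j2.
Proof. by rewrite /done; lia. Qed.

Let stage_step i j Z : (i < M)%N -> stage i j Z -> exists Z', stage i.+1 j Z'.
Proof.
move=> iM [hZ Z0 Zd hG hN].
pose L w := lpp (fun i j => Z (cell z i j) w) s.
pose gl w := if i is i'.+1 then L w i' j else s.
pose gd w := if j is j'.+1 then L w i j' else s.
pose T w := if (i == 0%N) || (j == 0%N) then 0 else L w i.-1 j.-1.
pose S w := Num.max (gl w) (gd w).
pose D w := S w - T w.
have dl : (0 < i)%N -> done i j i.-1 j by rewrite /done; lia.
have dd : (0 < j)%N -> done i j i j.-1 by rewrite /done; lia.
have dT : (0 < i)%N -> (0 < j)%N -> done i j i.-1 j.-1 by rewrite /done; lia.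
have wp w : forall i j, 0 < Z (cell z i j) w by [].
have TS w : T w <= S w.
  rewrite /T /S /gl; case: ifPn => [_|]; first by rewrite le_max; case: (i) => [|i']; rewrite ?s0// (le_trans s0)// ltW// lpp_ge.
  rewrite negb_or; case: (i) => //= i' ; case: (j) => //= j' _.
  by rewrite le_max (lpp_mono s i' j' (wp w)).2.
have D0 w : 0 <= D w by rewrite subr_ge0.
have TE w : T w = start w i j.
  by rewrite /T /start; case: ifPn => //; rewrite negb_or -!lt0n => /andP[i0 j0]; rewrite hG// dT.
have SE w : S w = Num.max (gleft (fun i j => next (Y ^~ w) (z + i%:Z - j%:Z)) s i j)
                     (gdown (fun i j => next (Y ^~ w) (z + i%:Z - j%:Z)) s i j).
  rewrite /S /gl /gd /gleft /gdown /L; congr (Num.max _ _).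
    by move: dl hG; case: (i) => // i' /(_ isT) d0 hG; rewrite -[RHS]/(Gt _ z s i' j) hG.
  by move: dd hG; case: (j) => // j' /(_ isT) d0 hG; rewrite -[RHS]/(Gt _ z s i j') hG.
set x := (cell z i j).1; set m := (cell z i j).2.
(* The delay is built from weights of cells in the rectangle below [(i, j)]; those on the same
   diagonal have smaller rank, so the delay does not see the part of the clock that is about to be
   cut. *)
have mD k : (m <= k)%N -> meas_others Z (x, k) D.
  move=> mk.
  have ne i' j' : (i' <= i)%N -> (j' <= j)%N -> (i', j') <> (i, j) -> cell z i' j' != (x, k).
    move=> ii jj ne; rewrite /cell xpair_eqE; apply/negP => /andP[/eqP h1 /eqP h2].
    by apply: ne; move: h1 h2 mk; rewrite /x /m /cell /= => h1 h2 mk; congr (_, _); lia.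
  have mS : meas_others Z (x, k) S.
    apply: measurable_maxr.
      rewrite /gl; case: (i) ne => [|i'] ne //; apply: meas_others_lpp => i2 j2 h1 h2; apply: ne; rewrite ?leqW//.
      by case; lia.
    rewrite /gd; case: (j) ne => [|j'] ne //; apply: meas_others_lpp => i2 j2 h1 h2; apply: ne; rewrite ?leqW//.
    by case; lia.
  apply: measurable_funB => //.
  rewrite /T; have [ij|ij] := boolP ((i == 0%N) || (j == 0%N)); first exact: measurable_cst.
  apply: meas_others_lpp => i2 j2 h1 h2; apply: ne; try lia.
  by case; lia.
pose Z' k w := restart (Z ^~ w) x m (D w) k.
have Zh w : exists n, D w < psum (Z ^~ w) x m n.+1 by exact: divg_hit.
have same w i' j' : done i j i' j' -> Z' (cell z i' j') w = Z (cell z i' j') w.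
  rewrite /done /Z' /restart /x /m /cell/= => dn; rewrite ifF//.
  by apply/negP => /andP[/eqP]; lia.
have Lsame w i' j' : done i j i' j' -> lpp (fun i j => Z' (cell z i j) w) s i' j' = L w i' j'.
  move=> dn; apply: grow_ext => i2 j2 h1 h2 u; rewrite same//.
  exact: done_le dn h1 h2.
have hNij w : forall S, T w <= S -> next (Y ^~ w) x S = T w + psum (Z ^~ w) x m (hit (Z ^~ w) x m (S - T w)).+1.
  move=> S1; rewrite TE; apply: hN => //.
    by rewrite /done; lia.
  by case: eqP => //= /eqP i0; case: eqP => //= /eqP j0; rewrite dT// lt0n.
have GtE w : Gt (Y ^~ w) z s i j = next (Y ^~ w) x (S w) by rewrite /Gt growE SE.
exists Z'; split.
- by apply: indep_exp_restart.
- by move=> k w; apply: restart_gt0.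
- by move=> w; apply: divg_restart.
- move=> w i' j' dn.
  have [dij|ndij] := boolP (done i j i' j'); first by rewrite hG// Lsame.
  have [-> ->] : i' = i /\ j' = j by move: dn ndij; rewrite /done; lia.
  rewrite GtE hNij// [RHS]growE.
  have -> : Num.max (gleft (fun i j u => u + Z' (cell z i j) w) s i j)
                    (gdown (fun i j u => u + Z' (cell z i j) w) s i j) = S w.
    rewrite /S /gl /gd /gleft /gdown; congr (Num.max _ _).
      by move: dl Lsame; case: (i) => // i2 /(_ isT) d0 Ls; rewrite -Ls.
    by move: dd Lsame; case: (j) => // j2 /(_ isT) d0 Ls; rewrite -Ls.
  rewrite /Z' /restart -/x -/m; have -> : cell z i j = (x, m) by rewrite /x /m; case: (cell z i j).
  rewrite /= !eqxx leqnn /= -[S w - T w]/(D w); move: (psum _ _ _ _) => p.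
  by rewrite /D; lra.
- move=> w i' j' i'M nd hd S1.
  (* The restart touches only the clock of the current diagonal, and the only cell on it whose turn
     comes next is [(i + 1, j + 1)]. *)
  have [[hi hj]|nij] := pselect (i' = i.+1 /\ j' = j.+1).
    have xE : (cell z i' j').1 = x by rewrite hi hj /x /cell/=; lia.
    have mE : (cell z i' j').2 = m.+1 by rewrite hi hj /m /cell/=; lia.
    rewrite xE mE; have -> : start w i' j' = next (Y ^~ w) x (S w).
      by rewrite /start hi hj /= GtE.
    exact: (@restart_next _ (Z ^~ w) (Z0 ^~ w) (Zd w) x m (T w) (S w) S1 x (Y ^~ w) (hNij w) (TS w)).
  have hd' : [|| i' == 0%N, j' == 0%N | done i j i'.-1 j'.-1].
    by move: hd nij; rewrite /done; lia.
  have nx : (cell z i' j').1 != x.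
    by apply/eqP; move: nd hd' iM; rewrite /x /cell /done /=; lia.
  move=> h; rewrite hN//; last by move: nd; rewrite /done; lia.
  have PE k : psum (Z' ^~ w) (cell z i' j').1 (cell z i' j').2 k = psum (Z ^~ w) (cell z i' j').1 (cell z i' j').2 k.
    by rewrite /Z' restart_prefix//; left.
  have hE : hit (Z' ^~ w) (cell z i' j').1 (cell z i' j').2 (S1 - start w i' j') =
     hit (Z ^~ w) (cell z i' j').1 (cell z i' j').2 (S1 - start w i' j').
    apply/eqP; rewrite hit_eq; last 3 first.
    + by move=> k; apply: restart_gt0.
    + by rewrite subr_ge0.
    + by apply: divg_hit; [move=> k; apply: restart_gt0|apply: divg_restart].
    rewrite !PE; apply: hitP; first by rewrite subr_ge0.
    exact: divg_hit.
  by rewrite hE PE.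
Qed.

(** All cells of an [M] by [M] box are processed with one common family of weights, so the identity
    holds between random variables on the whole box and not merely in law cell by cell. *)
Lemma Gt_law : indep_exp Q (fun=> 1) Y -> (forall k w, 0 < Y k w) ->
  (forall w, divg (Y ^~ w)) ->
  exists Z : int * nat -> Ω -> R, [/\ indep_exp Q (fun=> 1) Z, (forall k w, 0 < Z k w) &
    forall w i j, (i < M)%N -> (j < M)%N ->
      Gt (Y ^~ w) z s i j = lpp (fun i j => Z (cell z i j) w) s i j].
Proof.
move=> hY Y0 Yd.
suff [Z [h1 h2 _ h4 _]] : exists Z, stage 0 M Z.
  by exists Z; split => // w i j iM jM; apply: h4; rewrite /done; lia.
elim: (M) => [|j [Z sZ]].
  exists Y; split => //; first by move=> w i' j'; rewrite /done; lia.
  move=> w i' j' i'M _ hd S1.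
  have -> : start w i' j' = 0 by rewrite /start; move: hd; rewrite /done; case: ifP => //; lia.
  have -> : (cell z i' j').2 = 0%N by move: hd; rewrite /cell /done /=; lia.
  by rewrite add0r subr0.
suff [Z' [h1 h2 h3 h4 h5]] : exists Z, stage M j Z.
  have dE i' j' : done 0 j.+1 i' j' = done M j i' j' by rewrite /done; lia.
  exists Z'; split => //; first by move=> w i' j'; rewrite dE; exact: h4.
  by move=> w i' j' i'M; rewrite !dE; exact: h5.
suff : forall i, (i <= M)%N -> exists Z, stage i j Z by apply.
elim=> [_|i IHi iM]; first by exists Z.
have [Z' sZ'] := IHi (ltnW iM).
exact: stage_step sZ'.
Qed.

End lpp_law.

Section indep_exp_transforms.
Context d (Ω : measurableType d) (R : realType) (Q : probability Ω R).

Lemma indep_exp_reindex (I J : choiceType) (r : I -> R) (Y : I -> Ω -> R)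
    (f : J -> I) (g : I -> J) :
  cancel f g -> indep_exp Q r Y -> indep_exp Q (r \o f) (fun j => Y (f j)).
Proof.
move=> fg hY; split => [j|s a us]; first exact: hY.1.
have := hY.2 (map f s) (a \o g); rewrite map_inj_uniq; last exact: can_inj fg.
move=> /(_ us); rewrite big_map => E.
transitivity (Q [set w | forall i, i \in [seq f i | i <- s] -> (a \o g) i < Y i w]).
  congr (Q _); apply/seteqP; split => w /= h.
    by move=> _ /mapP[j js ->]; rewrite fg; exact: h.
  by move=> j js; rewrite -[j in a j]fg; apply: h; exact: map_f.
by rewrite E; congr EFin; apply: eq_bigr => j _ /=; rewrite fg.
Qed.

Lemma indep_exp_scale (I : choiceType) (r c : I -> R) (Y : I -> Ω -> R) :
  (forall i, 0 < c i) -> indep_exp Q r Y ->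
  indep_exp Q (fun i => r i / c i) (fun i w => c i * Y i w).
Proof.
move=> c0 hY; split => [i|s a us].
  by apply: measurable_funM => //; exact: hY.1.
transitivity (Q [set w | forall i, i \in s -> a i / c i < Y i w]).
  congr (Q _); apply/seteqP; split => w /= h i /h; by rewrite ltr_pdivrMr// mulrC.
rewrite hY.2//; congr EFin; apply: eq_bigr => i _; congr expR.
have -> : Num.max 0 (a i / c i) = Num.max 0 (a i) / c i.
  have [ai|ai] := leP 0 (a i).
    by rewrite max_r// divr_ge0// ltW.
  by rewrite mul0r max_l// ltW// pmulr_llt0// invr_gt0.
by ring.
Qed.

End indep_exp_transforms.

(** * Burke's property *)

Section burke.
Context d (Ω : measurableType d) (R : realType) (Q : probability Ω R).
Context (I : choiceType) (r : I -> R).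
Hypothesis r0 : forall i, 0 < r i.

Lemma indep_indic_fun (Y : I -> Ω -> R) (i : I) C :
  <<s others Y i >> C -> measurable_fun setT ((EFin \o \1_C) : g_sigma_algebraType (others Y i) -> \bar R).
Proof. by move=> GC; apply/measurable_EFinP; exact: measurable_indic. Qed.

Section core.
Variables (Y : I -> Ω -> R) (i1 i2 i3 : I) (s : seq I) (t : I -> R).
Hypothesis hY : indep_exp Q r Y.
Hypothesis Y0 : forall i w, 0 < Y i w.
Hypothesis r12 : r i1 + r i2 = 1.
Hypothesis r3 : r i3 = 1.
Hypothesis n12 : i1 != i2.
Hypothesis n13 : i1 != i3.
Hypothesis n23 : i2 != i3.
Hypothesis us : uniq s.
Hypothesis s1 : i1 \notin s.
Hypothesis s2 : i2 \notin s.
Hypothesis s3 : i3 \notin s.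
Let A := [set w | forall i, i \in s -> t i < Y i w].

Let GA k : k \notin s -> <<s others Y k >> A.
Proof. by move=> ks; apply: sub_sigma_algebra; exists s, t. Qed.

Let E2 (a b c : R) : 0 <= b -> b <= a -> 0 <= c ->
  Q ([set w | Y i2 w + a - Y i3 w < Y i1 w] `&`
     (A `&` [set w | b < Y i3 w] `&` [set w | Y i3 w <= a] `&` [set w | c < Y i2 w])) =
  ((expR (- r i1 * a) * expR (- c) * (expR (- r i2 * b) - expR (- r i2 * a)))%:E * Q A)%E.
Proof.
move=> b0 ba c0.
have G3 k : k != i3 -> k \notin s -> <<s others Y k >> (A `&` [set w | b < Y i3 w] `&` [set w | Y i3 w <= a]).
  move=> k3 ks; have m3 : measurable_fun setT (Y i3 : g_sigma_algebraType (others Y k) -> measurableTypeR R).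
    by apply: measurable_fun_others; rewrite eq_sym.
  apply: (@measurableI _ (g_sigma_algebraType (others Y k))).
    apply: (@measurableI _ (g_sigma_algebraType (others Y k))); first exact: GA.
    by apply: meas_others_gt => //; exact: measurable_cst.
  rewrite (_ : [set _ | _] = ~` [set w | a < Y i3 w]).
    by apply: sigma_algebraC; apply: meas_others_gt => //; exact: measurable_cst.
  by apply/seteqP; split => w /=; [rewrite leNgt => /negP|move/negP; rewrite -leNgt].
have m k l : l != k -> measurable_fun setT (Y l : g_sigma_algebraType (others Y k) -> measurableTypeR R).
  by move=> lk; apply: measurable_fun_others.
rewrite (@indep_tail_fun _ _ _ _ _ _ _ r0 hY i1 (fun w => Y i2 w + a - Y i3 w)); last 2 first.
- rewrite /meas_others; apply: measurable_funB; last by apply: m; rewrite eq_sym.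
  by apply: measurable_funD => //; apply: m; rewrite eq_sym.
- apply: (@measurableI _ (g_sigma_algebraType (others Y i1))); first exact: G3.
  by apply: meas_others_gt; [exact: measurable_cst|apply: m; rewrite eq_sym].
pose g2 (y : measurableTypeR R) : \bar R := ((expR (- r i1 * y))%:E * (\1_`]c, +oo[%classic y)%:E)%E.
pose g3 (y : measurableTypeR R) : \bar R := ((expR (r i1 * y))%:E * (\1_`]b, a]%classic y)%:E)%E.
have mexp (k : R) : measurable_fun setT (fun y : measurableTypeR R => (expR (k * y))%:E).
  by apply/measurable_EFinP; apply: measurableT_comp => //; exact: measurable_funM.
have mg2 : measurable_fun setT g2.
  by apply: emeasurable_funM => //; apply/measurable_EFinP; exact: measurable_indic.
have mg3 : measurable_fun setT g3.
  by apply: emeasurable_funM => //; apply/measurable_EFinP; exact: measurable_indic.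
have g20 y : (0 <= g2 y)%E by rewrite mule_ge0// lee_fin ?expR_ge0.
have g30 y : (0 <= g3 y)%E by rewrite mule_ge0// lee_fin ?expR_ge0.
transitivity (\int[Q]_w ((expR (- r i1 * a))%:E * (g2 (Y i2 w) * (g3 (Y i3 w) * (\1_A w)%:E))))%E.
  rewrite integral_mkcond; apply: eq_integral => w _.
  rewrite patchE /g2 /g3 !indicE.
  case: ifPn => [|hn].
    rewrite inE => -[[[Aw /= bw] wa] cw]; rewrite max_r; last by have := Y0 i2 w; lra.
    rewrite !mem_set//= ?in_itv/= ?bw ?wa ?cw//.
    by rewrite !mule1 -!EFinM -!expRD; congr (expR _)%:E; ring.
  move: hn; rewrite notin_setE => h.
  have [wA|wA] := boolP (w \in A); last by rewrite !mule0.
  have [w3|w3] := boolP (Y i3 w \in `]b, a]%classic); last by rewrite mule0 mul0e !mule0.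
  have [w2|w2] := boolP (Y i2 w \in `]c, +oo[%classic); last by rewrite mule0 mul0e !mule0.
  exfalso; apply: h; move: wA w3 w2; rewrite !inE/= !in_itv/= andbT => wA /andP[w3 w3'] w2.
  by do !split.
rewrite ge0_integralZl; [|by []| |by move=> w _; rewrite !mule_ge0// lee_fin|by rewrite lee_fin expR_ge0]; last first.
  apply: emeasurable_funM; first by apply: (measurableT_comp mg2); exact: hY.1.
  apply: emeasurable_funM; first by apply: (measurableT_comp mg3); exact: hY.1.
  by apply/measurable_EFinP; apply: measurable_indic; exact: (others_measurable hY (GA s1)).
rewrite (@indep_expectationM _ _ _ _ _ _ _ r0 hY i2 g2 (fun w => g3 (Y i3 w) * (\1_A w)%:E)%E); [|by []|by []| |
  by move=> w; rewrite mule_ge0// lee_fin]; last first.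
  apply: emeasurable_funM; first by apply: (measurableT_comp mg3); apply: m; rewrite eq_sym.
  by apply: indep_indic_fun; exact: GA.
rewrite (@indep_expectationM _ _ _ _ _ _ _ r0 hY i3 g3 (fun w => (\1_A w)%:E)%E); [|by []|by []| |
  by move=> w; rewrite lee_fin]; last first.
  by apply: indep_indic_fun; exact: GA.
have r1p := r0 i1; have r2p := r0 i2.
have -> : (\int[Q]_w (\1_A w)%:E = Q A)%E.
  by rewrite integral_indic ?setIT//; exact: (others_measurable hY (GA s1)).
have -> : (\int[exp_law (r0 i2)]_y g2 y = (r i2 * expR (- c))%:E)%E.
  have rc : 0 < r i2 - (- r i1) by lra.
  transitivity (\int[exp_law (r0 i2)]_(y in `]c, +oo[%classic) (expR (- r i1 * y))%:E)%E.
    by rewrite [RHS]integral_mkcond; apply: eq_integral => y _; rewrite epatch_indic.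
  rewrite (exp_law_expR _ rc)// exp_law_tail max_r// -EFinM; congr EFin.
  have -> : r i2 - (- r i1) = 1 by rewrite opprK addrC.
  by rewrite divr1 mulN1r.
have -> : (\int[exp_law (r0 i3)]_y g3 y = ((expR (- r i2 * b) - expR (- r i2 * a)) / r i2)%:E)%E.
  have E31 : r i3 - r i1 = r i2 by rewrite r3 -r12 addrC addKr.
  have rc : 0 < r i3 - r i1 by rewrite E31.
  transitivity (\int[exp_law (r0 i3)]_(y in `]b, a]%classic) (expR (r i1 * y))%:E)%E.
    by rewrite [RHS]integral_mkcond; apply: eq_integral => y _; rewrite epatch_indic.
  rewrite (exp_law_expR _ rc)//.
  have -> : exp_law rc `]b, a]%classic = (exp_law rc `]b, +oo[%classic - exp_law rc `]a, +oo[%classic)%E.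
    have -> : [set` `]b, +oo[] = [set` `]b, a]] `|` [set` `]a, +oo[] :> set R.
      by rewrite -itv_bndbnd_setU// bnd_simp.
    rewrite measureU//; last first.
      rewrite -subset0 => x []/=; rewrite !in_itv/= andbT => /andP[_ xa] ax.
      by move: (le_lt_trans xa ax); rewrite ltxx.
    by rewrite addeK// fin_num_measure.
  rewrite !exp_law_tail !max_r//; last exact: le_trans ba.
  rewrite -EFinB -EFinM; congr EFin; rewrite E31.
  by rewrite r3 mul1r mulrC.
rewrite !muleA -!EFinM; congr (_%:E * _)%E.
by field; rewrite gt_eqF.
Qed.

(** If [Y i3] exceeds [a], both sums pass their thresholds. Otherwise the first sum requires
    [Y i1 - Y i2] to exceed [a - Y i3], which is nonnegative, so the second positive part vanishes
    and the second condition becomes [b < Y i3]. The two disjoint events [F1] and [F2] have explicit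
    probabilities, the second by integrating out the three variables in turn with tilted
    exponentials. *)
Lemma burke_core (a b c : R) : 0 <= b -> b <= a -> 0 <= c ->
  Q ([set w | [/\ a < Y i3 w + Num.max 0 (Y i1 w - Y i2 w),
                  b < Y i3 w + Num.max 0 (Y i2 w - Y i1 w) &
                  c < Num.min (Y i1 w) (Y i2 w)]] `&` A) =
  ((expR (- r i1 * a) * expR (- r i2 * b) * expR (- c))%:E * Q A)%E.
Proof.
move=> b0 ba c0.
pose F1 := [set w | forall i, i \in [:: i1, i2, i3 & s] ->
  (if (i == i1) || (i == i2) then c else if i == i3 then a else t i) < Y i w].
pose F2 := [set w | Y i2 w + a - Y i3 w < Y i1 w] `&`
     (A `&` [set w | b < Y i3 w] `&` [set w | Y i3 w <= a] `&` [set w | c < Y i2 w]).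
have F1P w : F1 w <-> [/\ c < Y i1 w, c < Y i2 w, a < Y i3 w & A w].
  split.
    move=> h; split.
    - by have := h i1; rewrite mem_head eqxx => /(_ isT).
    - by have := h i2; rewrite !inE eqxx !orbT => /(_ isT).
    - by have := h i3; rewrite !inE eqxx !orbT ![i3 == _]eq_sym (negbTE n13) (negbTE n23) => /(_ isT).
    move=> i si; have := h i; rewrite !inE si !orbT => /(_ isT).
    have -> : (i == i1) = false by apply/eqP => ii; move: s1; rewrite -ii si.
    have -> : (i == i2) = false by apply/eqP => ii; move: s2; rewrite -ii si.
    by have -> : (i == i3) = false by apply/eqP => ii; move: s3; rewrite -ii si.
  move=> [h1 h2 h3 h4] i; rewrite !inE.
  have [->//|_/=] := eqVneq i i1; have [->//|_/=] := eqVneq i i2.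
  by have [->//|_/=] := eqVneq i i3; exact: h4.
have -> : [set w | [/\ a < Y i3 w + Num.max 0 (Y i1 w - Y i2 w),
                  b < Y i3 w + Num.max 0 (Y i2 w - Y i1 w) &
                  c < Num.min (Y i1 w) (Y i2 w)]] `&` A = F1 `|` F2.
  apply/seteqP; split => w /=.
    move=> [[h1 h2 h3] Aw]; move: h3; rewrite lt_min => /andP[h3 h4].
    have [w3|w3] := ltP a (Y i3 w); first by left; apply/F1P.
    have := lexx (Y i1 w); move: h1 h2.
    have [k|k] := leP 0 (Y i1 w - Y i2 w); have [k'|k'] := leP 0 (Y i2 w - Y i1 w) => h1 h2 _;
      by (right; split; [rewrite /=; lra|split => //=; split => //=; split => //=; lra]) || (exfalso; lra).
  move=> [/F1P[h1 h2 h3 Aw]|[/= h1 [[[Aw /= h2] h3] h4]]]; (split; last by []); split.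
  - by rewrite ltr_wpDr// le_max lexx.
  - by rewrite ltr_wpDr ?le_max ?lexx// (le_lt_trans ba).
  - by rewrite lt_min h1.
  - by rewrite max_r; lra.
  - by rewrite ltr_wpDr ?le_max ?lexx.
  - by rewrite lt_min h4 andbT; lra.
rewrite measureU; last 3 first.
- exact: measurable_cylinder hY _ _.
- apply: measurableI; last first.
    apply: measurableI; last by apply: measurable_gt; exact: hY.1.
    apply: measurableI; last first.
      rewrite (_ : [set _ | _] = ~` [set w | a < Y i3 w]); last first.
        by apply/seteqP; split => w /=; [rewrite leNgt => /negP|move/negP; rewrite -leNgt].
      by apply: measurableC; apply: measurable_gt; exact: hY.1.
    by apply: measurableI; [exact: (others_measurable hY (GA s1))|apply: measurable_gt; exact: hY.1].
  rewrite (_ : [set _ | _] = [set w | 0 < Y i1 w - (Y i2 w + a - Y i3 w)]).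
    apply: measurable_gt; apply: measurable_funB; first exact: hY.1.
    by apply: measurable_funB; [apply: measurable_funD => //|]; exact: hY.1.
  by apply/seteqP; split => w /=; rewrite subr_gt0.
- rewrite -subset0 => w [/F1P[_ _ h _] [_ [[_ /= h'] _]]].
  by move: (lt_le_trans h h'); rewrite ltxx.
have u3 : uniq [:: i1, i2, i3 & s].
  by rewrite /= !inE !negb_or n12 n13 n23 s1 s2 s3.
rewrite [X in (_ + X)%E](E2 b0 ba c0) [X in (X + _)%E](hY.2 _ _ u3).
have QA : Q A = (\prod_(i <- s) expR (- r i * Num.max 0 (t i)))%:E by rewrite /A hY.2.
rewrite !big_cons !eqxx orbT /= ![i3 == _]eq_sym (negbTE n13) (negbTE n23)/=.
rewrite (eq_big_seq (fun i => expR (- r i * Num.max 0 (t i)))); last first.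
  move=> i si.
  have -> : (i == i1) = false by apply/eqP => ii; move: s1; rewrite -ii si.
  have -> : (i == i2) = false by apply/eqP => ii; move: s2; rewrite -ii si.
  by have -> : (i == i3) = false by apply/eqP => ii; move: s3; rewrite -ii si.
rewrite QA -!EFinM -EFinD; congr EFin.
rewrite !max_r//; last exact: le_trans ba.
set P := \prod_(i <- s) _.
have -> : expR (- r i3 * a) = expR (- r i1 * a) * expR (- r i2 * a).
  by rewrite -expRD; congr expR; rewrite r3 -r12; ring.
have -> : expR (- c) = expR (- r i1 * c) * expR (- r i2 * c).
  by rewrite -expRD; congr expR; rewrite -mulrDl -opprD r12 mulN1r.
by ring.
Qed.

End core.
End burke.

Section small.
Context d (Ω : measurableType d) (R : realType) (Q : probability Ω R).
Implicit Types (A B : set Ω) (e : R).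

(** Bounds the outer probability, so that events defined by quantifying over many objects can be
    estimated before their measurability is discussed. *)
Definition small A e := exists B, [/\ measurable B, A `<=` B & (Q B <= e%:E)%E].

Lemma small_sub A B e : A `<=` B -> small B e -> small A e.
Proof. by move=> AB [C [mC BC QC]]; exists C; split => //; exact: subset_trans BC. Qed.

Lemma small_le A e e' : e <= e' -> small A e -> small A e'.
Proof. by move=> ee [C [mC BC QC]]; exists C; split => //; rewrite (le_trans QC)// lee_fin. Qed.

Lemma small_measurable A e : measurable A -> (Q A <= e%:E)%E -> small A e.
Proof. by move=> mA QA; exists A; split. Qed.

Lemma small_ge A e : measurable A -> small A e -> (Q A <= e%:E)%E.
Proof. by move=> mA [B [mB AB]]; apply: le_trans; apply: le_measure; rewrite ?inE. Qed.

Lemma smallU A B e e' : small A e -> small B e' -> small (A `|` B) (e + e').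
Proof.
move=> [C [mC AC QC]] [D [mD BD QD]]; exists (C `|` D); split.
- exact: measurableU.
- by apply: setUSS.
- by rewrite (le_trans (measureU2 _ mC mD))// EFinD leeD.
Qed.

Lemma small_bigU (F : nat -> set Ω) n e :
  (forall k, (k < n)%N -> small (F k) e) ->
  small [set w | exists2 k, (k < n)%N & F k w] (n%:R * e).
Proof.
elim: n => [|n IH] h.
  by rewrite mul0r; exists set0; split => //; [move=> w [k]|rewrite measure0].
have h1 : small [set w | exists2 k, (k < n)%N & F k w] (n%:R * e).
  by apply: IH => k kn; apply: h; exact: leqW.
have h2 : small (F n) e by exact: h.
have -> : n.+1%:R * e = n%:R * e + e by rewrite -natr1 mulrDl mul1r.
apply: small_sub (smallU h1 h2) => w /= [k]; rewrite ltnS leq_eqVlt => /predU1P[->|kn] Fk.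
  by right.
by left; exists k.
Qed.

End small.

Section burke_update.
Context d (Ω : measurableType d) (R : realType) (Q : probability Ω R).
Context (I : choiceType) (r : I -> R).
Hypothesis r0 : forall i, 0 < r i.

(** One corner flip of stationary percolation: [i1] and [i2] carry the horizontal and vertical
    increments entering a cell and [i3] its weight; the first two become the outgoing increments.
    Keeping the minimum in [i3] makes the map preserve the full joint law, so that it can be
    iterated. *)
Definition burke (Y : I -> Ω -> R) (i1 i2 i3 i : I) (w : Ω) : R :=
  if i == i1 then Y i3 w + Num.max 0 (Y i1 w - Y i2 w)
  else if i == i2 then Y i3 w + Num.max 0 (Y i2 w - Y i1 w)
  else if i == i3 then Num.min (Y i1 w) (Y i2 w) else Y i w.

Lemma prod_split1 (s : seq I) (k : I) (P : pred I) (F : I -> R) : uniq s -> P k ->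
  \prod_(i <- s | P i) F i = (if k \in s then F k else 1) * \prod_(i <- s | P i && (i != k)) F i.
Proof.
move=> us Pk; rewrite (bigID (fun i => i != k)) /= mulrC; congr (_ * _).
case: ifPn => ks.
  rewrite (eq_bigl (pred1 k)); first by rewrite -big_filter filter_pred1_uniq// big_seq1.
  by move=> i /=; rewrite negbK; case: eqP => [->|_]; rewrite ?Pk ?andbF.
rewrite big_seq_cond big1// => i /andP[si /andP[_]].
by rewrite negbK => /eqP ik; move: ks; rewrite -ik si.
Qed.

Variables (Y : I -> Ω -> R) (i1 i2 i3 : I).
Hypothesis hY : indep_exp Q r Y.
Hypothesis Y0 : forall i w, 0 < Y i w.
Hypothesis r12 : r i1 + r i2 = 1.
Hypothesis r3 : r i3 = 1.
Hypothesis n12 : i1 != i2.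
Hypothesis n13 : i1 != i3.
Hypothesis n23 : i2 != i3.

Lemma burke_gt0 i w : 0 < burke Y i1 i2 i3 i w.
Proof.
rewrite /burke; case: ifP => _; first by rewrite ltr_wpDr// le_max lexx.
case: ifP => _; first by rewrite ltr_wpDr// le_max lexx.
by case: ifP => _ //; rewrite lt_min !Y0.
Qed.

Lemma indep_exp_burke : indep_exp Q r (burke Y i1 i2 i3).
Proof.
split.
  move=> i; rewrite /burke; case: (i == i1).
    apply: measurable_funD; first exact: hY.1.
    by apply: measurable_maxr => //; apply: measurable_funB; exact: hY.1.
  case: (i == i2).
    apply: measurable_funD; first exact: hY.1.
    by apply: measurable_maxr => //; apply: measurable_funB; exact: hY.1.
  by case: (i == i3); [apply: measurable_minr; exact: hY.1|exact: hY.1].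
move=> s a us.
pose s' := [seq i <- s | [&& i != i1, i != i2 & i != i3]].
pose th k : R := if k \in s then Num.max 0 (a k) else 0.
have th0 k : 0 <= th k by rewrite /th; case: ifP => // _; rewrite le_max lexx.
pose A := [set w | forall i, i \in s' -> a i < Y i w].
pose T := [set w | [/\ th i1 < Y i3 w + Num.max 0 (Y i1 w - Y i2 w),
                  th i2 < Y i3 w + Num.max 0 (Y i2 w - Y i1 w) &
                  th i3 < Num.min (Y i1 w) (Y i2 w)]] `&` A.
have thP k w : k \in s -> (th k < burke Y i1 i2 i3 k w) = (a k < burke Y i1 i2 i3 k w).
  by move=> ks; rewrite /th ks gt_max burke_gt0.
have thN k w : k \notin s -> th k < burke Y i1 i2 i3 k w.
  by move=> ks; rewrite /th (negbTE ks) burke_gt0.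
have b1 w : burke Y i1 i2 i3 i1 w = Y i3 w + Num.max 0 (Y i1 w - Y i2 w) by rewrite /burke eqxx.
have b2 w : burke Y i1 i2 i3 i2 w = Y i3 w + Num.max 0 (Y i2 w - Y i1 w).
  by rewrite /burke eqxx eq_sym (negbTE n12).
have b3 w : burke Y i1 i2 i3 i3 w = Num.min (Y i1 w) (Y i2 w).
  by rewrite /burke eqxx ![i3 == _]eq_sym (negbTE n13) (negbTE n23).
have -> : [set w | forall i, i \in s -> a i < burke Y i1 i2 i3 i w] = T.
  apply/seteqP; split => w /=.
    move=> h; split.
      have hh k : th k < burke Y i1 i2 i3 k w.
        by have [ks|ks] := boolP (k \in s); [rewrite thP// h|exact: thN].
      by rewrite /= -b1 -b2 -b3; split.
    move=> i; rewrite mem_filter => /andP[/and3P[/negbTE h1 /negbTE h2 /negbTE h3] si].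
    by have := h _ si; rewrite /burke h1 h2 h3.
  move=> [/=]; rewrite -b1 -b2 -b3 => -[h1 h2 h3] hA i si.
  have [e1|e1] := eqVneq i i1; first by rewrite -thP// e1.
  have [e2|e2] := eqVneq i i2; first by rewrite -thP// e2.
  have [e3|e3] := eqVneq i i3; first by rewrite -thP// e3.
  rewrite /burke (negbTE e1) (negbTE e2) (negbTE e3); apply: hA.
  by rewrite mem_filter e1 e2 e3.
have us' : uniq s' by rewrite filter_uniq.
have s1 : i1 \notin s' by rewrite mem_filter eqxx.
have s2 : i2 \notin s' by rewrite mem_filter eqxx andbF.
have s3 : i3 \notin s' by rewrite mem_filter eqxx !andbF.
transitivity ((expR (- r i1 * th i1) * expR (- r i2 * th i2) * expR (- th i3))%:E * Q A)%E.
  have [t12|/ltW t12] := leP (th i2) (th i1); first exact: burke_core.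
  transitivity (Q ([set w | [/\ th i2 < Y i3 w + Num.max 0 (Y i2 w - Y i1 w),
                  th i1 < Y i3 w + Num.max 0 (Y i1 w - Y i2 w) &
                  th i3 < Num.min (Y i2 w) (Y i1 w)]] `&` A)).
    by congr (Q _); apply/seteqP; split => w [[h1 h2 h3] Aw]; split => //; split => //; rewrite minC.
  rewrite (@burke_core _ _ _ _ _ _ r0 Y i2 i1 i3 s' a hY Y0 _ r3 _ n23 n13 us' s2 s1 s3)//; last 2 first.
  - by rewrite addrC.
  - by rewrite eq_sym.
  by congr (_ * _)%E; congr EFin; ring.
have QA : Q A = (\prod_(i <- s') expR (- r i * Num.max 0 (a i)))%:E by rewrite /A hY.2.
rewrite QA -EFinM; congr EFin; rewrite big_filter.
rewrite [RHS](@prod_split1 _ i1)// [X in _ = _ * X](@prod_split1 _ i2)//=; last by rewrite eq_sym n12.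
rewrite [X in _ = _ * (_ * X)](@prod_split1 _ i3)//=; last by rewrite ![i3 == _]eq_sym n13 n23.
have E k : expR (- r k * th k) = if k \in s then expR (- r k * Num.max 0 (a k)) else 1.
  by rewrite /th; case: ifP => // _; rewrite mulr0 expR0.
rewrite -!E r3 mulN1r !mulrA; congr (_ * _).
by apply: eq_bigl => i; rewrite andbA.
Qed.

End burke_update.

(** * Tail bounds for last passage times *)

Section chernoff.
Context d (Ω : measurableType d) (R : realType) (Q : probability Ω R).
Context (I : choiceType) (r : I -> R) (Y : I -> Ω -> R).
Hypothesis r0 : forall i, 0 < r i.
Hypothesis hY : indep_exp Q r Y.

Lemma meas_others_sum i (s : seq I) : {in s, forall j, j != i} ->
  meas_others Y i (fun w => \sum_(j <- s) Y j w).
Proof.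
elim: s => [_|j s IH hs].
  rewrite /meas_others (_ : (fun _ => _) = cst 0); first exact: measurable_cst.
  by apply/funext => w; rewrite big_nil.
rewrite /meas_others (_ : (fun _ => _) = (fun w => Y j w + \sum_(j <- s) Y j w)).
  apply: measurable_funD; first by apply: measurable_fun_others; apply: hs; rewrite mem_head.
  by apply: IH => k ks; apply: hs; rewrite inE ks orbT.
by apply/funext => w; rewrite big_cons.
Qed.

Lemma exp_moment (rho th : R) (s : seq I) : uniq s -> {in s, forall i, r i = rho} ->
  0 < rho -> 0 < rho - th ->
  (\int[Q]_w (expR (th * \sum_(i <- s) Y i w))%:E = ((rho / (rho - th)) ^+ size s)%:E)%E.
Proof.
elim: s => [_ _ _ _|i s IH /= /andP[si us] rs rho0 rt].
  transitivity (\int[Q]_w (cst 1%E w))%E.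
    by apply: eq_integral => w _; rewrite big_nil mulr0 expR0.
  by rewrite integral_cst//= probability_setT mule1 expr0.
have ri : r i = rho by apply: rs; rewrite mem_head.
pose g (y : measurableTypeR R) : \bar R := (expR (th * y))%:E.
under eq_integral do rewrite big_cons mulrDr expRD EFinM.
rewrite (@indep_expectationM _ _ _ _ _ _ _ r0 hY i g (fun w => (expR (th * \sum_(j <- s) Y j w))%:E)).
- rewrite IH//; last by move=> j js; apply: rs; rewrite inE js orbT.
  have rt' : 0 < r i - th by rewrite ri.
  rewrite /g (exp_law_expR _ rt' measurableT) probability_setT mule1.
  by rewrite -EFinM exprS ri.
- by apply/measurable_EFinP; apply: measurableT_comp => //; exact: measurable_funM.
- by move=> y; rewrite lee_fin expR_ge0.
- apply/measurable_EFinP; apply: measurableT_comp => //; apply: measurable_funM => //.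
  by apply: meas_others_sum => j js; apply/eqP => ji; move: si; rewrite -ji js.
- by move=> y; rewrite lee_fin expR_ge0.
Qed.

Lemma chernoff_gen (rho th u : R) (s : seq I) : uniq s -> {in s, forall i, r i = rho} ->
  0 < rho -> 0 < rho - th ->
  small Q [set w | u <= th * \sum_(i <- s) Y i w] (expR (- u) * (rho / (rho - th)) ^+ size s).
Proof.
move=> us rs rho0 rt.
have mf : measurable_fun setT (fun w => th * \sum_(i <- s) Y i w).
  by apply: measurable_funM => //; apply: measurable_sum => i; exact: hY.1.
have mE : measurable [set w | u <= th * \sum_(i <- s) Y i w].
  rewrite (_ : [set _ | _] = (fun w => th * \sum_(i <- s) Y i w) @^-1` `[u, +oo[).
    by rewrite -[X in measurable X]setTI; exact: mf.
  by apply/seteqP; split => w /=; rewrite in_itv/= andbT.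
apply: small_measurable => //.
rewrite EFinM -(exp_moment us rs rho0 rt) expRN lee_pdivlMl ?expR_gt0//.
set A := [set w | _] in mE *.
have -> : Q A = (\int[Q]_w (\1_A w)%:E)%E by rewrite integral_indic// setIT.
rewrite -ge0_integralZl; [|by []| |by move=> w _; rewrite lee_fin|by rewrite lee_fin expR_ge0]; last first.
  by apply/measurable_EFinP; exact: measurable_indic.
apply: ge0_le_integral => //.
- by apply: emeasurable_funM => //; apply/measurable_EFinP; exact: measurable_indic.
- by apply/measurable_EFinP; exact: measurableT_comp.
move=> w _; rewrite indicE; have [|_] := boolP (w \in _); last by rewrite mule0 lee_fin expR_ge0.
by rewrite inE/= mule1 lee_fin ler_expR.
Qed.

(** The constant [2] comes from [(1 - x)^-1 <= expR (x + 2 * x ^+ 2)] for [x = th / rho] at most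
    [1 / 2]; the same error term is then used for lower deviations. *)
Lemma chernoff_upper (rho th u : R) (s : seq I) : uniq s -> {in s, forall i, r i = rho} ->
  0 < th -> th <= rho / 2 ->
  small Q [set w | (size s)%:R / rho + u <= \sum_(i <- s) Y i w]
    (expR (- (th * u) + 2 * (size s)%:R * (th / rho) ^+ 2)).
Proof.
move=> us rs th0 thr; have rho0 : 0 < rho by lra.
have rt : 0 < rho - th by lra.
apply: (small_sub _ (small_le _ (@chernoff_gen rho th (th * ((size s)%:R / rho + u)) s us rs rho0 rt))).
  by move=> w /= h; rewrite ler_pM2l.
set n := size s; pose x := th / rho.
have x0 : 0 <= x by rewrite divr_ge0// ltW.
have x2 : x <= 2^-1 by rewrite ler_pdivrMr//; lra.
have -> : rho / (rho - th) = (1 - x)^-1.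
  by rewrite /x; field; rewrite !gt_eqF.
have h : (1 - x)^-1 <= expR (x + 2 * x ^+ 2).
  rewrite -[leLHS]mul1r ler_pdivrMr; last lra.
  apply: le_trans (_ : 1 <= (1 + (x + 2 * x ^+ 2)) * (1 - x)) _; first by nra.
  by rewrite ler_pM2r ?expR_ge1Dx//; lra.
apply: le_trans (_ : _ <= expR (- (th * (n%:R / rho + u))) * (expR (x + 2 * x ^+ 2)) ^+ n) _.
  rewrite ler_pM2l ?expR_gt0// lerXn2r// ?nnegrE ?expR_ge0// invr_ge0; lra.
rewrite -expRM_natl -expRD ler_expR /x -/n -[n%:R / rho]mulrC.
by rewrite le_eqVlt; apply/orP; left; apply/eqP; ring.
Qed.

Lemma chernoff_lower (rho th u : R) (s : seq I) : uniq s -> {in s, forall i, r i = rho} ->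
  0 < rho -> 0 < th ->
  small Q [set w | \sum_(i <- s) Y i w <= (size s)%:R / rho - u]
    (expR (- (th * u) + 2 * (size s)%:R * (th / rho) ^+ 2)).
Proof.
move=> us rs rho0 th0.
have rt : 0 < rho - (- th) by lra.
apply: (small_sub _ (small_le _ (@chernoff_gen rho (- th) (- th * ((size s)%:R / rho - u)) s us rs rho0 rt))).
  by move=> w /= h; rewrite !mulNr lerN2 ler_pM2l.
set n := size s; pose x := th / rho.
have x0 : 0 <= x by rewrite divr_ge0// ltW.
have -> : rho / (rho - (- th)) = (1 + x)^-1.
  by rewrite /x; field; rewrite !gt_eqF//; lra.
have h : (1 + x)^-1 <= expR (- x + x ^+ 2).
  rewrite -[leLHS]mul1r ler_pdivrMr; last lra.
  apply: le_trans (_ : 1 <= (1 + (- x + x ^+ 2)) * (1 + x)) _; first by nra.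
  by rewrite ler_pM2r ?expR_ge1Dx//; lra.
apply: le_trans (_ : _ <= expR (- (- th * (n%:R / rho - u))) * (expR (- x + x ^+ 2)) ^+ n) _.
  rewrite ler_pM2l ?expR_gt0// lerXn2r// ?nnegrE ?expR_ge0// invr_ge0; lra.
rewrite -expRM_natl -expRD ler_expR /x -/n.
have n0 : 0 <= n%:R * (th / rho) ^+ 2 :> R by rewrite mulr_ge0// exprn_ge0.
apply: le_trans (_ : _ <= - (th * u) + n%:R * (th / rho) ^+ 2) _; last by lra.
by rewrite le_eqVlt; apply/orP; left; apply/eqP; ring.
Qed.

End chernoff.

(** * Last passage percolation with boundary weights *)

Section stationary_path.
Context {R : realType}.
Implicit Types (v : nat * nat -> R).

Definition rowI m : seq (nat * nat) := [seq (i.+1, 0%N) | i <- iota 0 m].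
Definition colJ n : seq (nat * nat) := [seq (0%N, j.+1) | j <- iota 0 n].

(** Passage time of the model with boundary: weight [0] at the origin, boundary weights on the axes,
    ordinary weights inside. *)
Definition Gs v := lpp (fun i j => if (i == 0%N) && (j == 0%N) then 0 else v (i, j)) 0.

Lemma rowIS m : rowI m.+1 = rcons (rowI m) (m.+1, 0%N).
Proof. by rewrite /rowI -[in LHS]addn1 iotaD map_cat cats1. Qed.

Lemma colJS m : colJ m.+1 = rcons (colJ m) (0%N, m.+1).
Proof. by rewrite /colJ -[in LHS]addn1 iotaD map_cat cats1. Qed.

Lemma rowI_uniq m : uniq (rowI m).
Proof. by rewrite map_inj_uniq ?iota_uniq// => i j []. Qed.

Lemma colJ_uniq m : uniq (colJ m).
Proof. by rewrite map_inj_uniq ?iota_uniq// => i j []. Qed.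

Lemma size_rowI m : size (rowI m) = m. Proof. by rewrite size_map size_iota. Qed.

Lemma size_colJ m : size (colJ m) = m. Proof. by rewrite size_map size_iota. Qed.

Lemma lpp_ge0 (w : nat -> nat -> R) i j : (forall i j, 0 <= w i j) -> 0 <= lpp w 0 i j.
Proof.
move=> w0; rewrite /lpp; elim: i j => [|i IHi] j; rewrite growE addr_ge0// le_max /=.
  by rewrite lexx.
by rewrite IHi.
Qed.

Variables (v : nat * nat -> R).
Hypothesis v0 : forall k, 0 < v k.

Let bw0 i j : 0 <= (if (i == 0%N) && (j == 0%N) then 0 else v (i, j)).
Proof. by case: ifP => // _; exact: ltW. Qed.

Lemma Gs_ge0 i j : 0 <= Gs v i j.
Proof. exact: lpp_ge0. Qed.

Lemma Gs0S j : Gs v 0 j.+1 = Gs v 0 j + v (0%N, j.+1).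
Proof. by rewrite /Gs {1}/lpp growE /= max_r//; exact: Gs_ge0. Qed.

Lemma GsS0 i : Gs v i.+1 0 = Gs v i 0 + v (i.+1, 0%N).
Proof. by rewrite /Gs {1}/lpp growE /= max_l//; exact: Gs_ge0. Qed.

Lemma GsSS i j : Gs v i.+1 j.+1 = Num.max (Gs v i j.+1) (Gs v i.+1 j) + v (i.+1, j.+1).
Proof. by rewrite /Gs {1}/lpp growE. Qed.

Lemma Gs00 : Gs v 0 0 = 0.
Proof. by rewrite /Gs /lpp growE /= maxxx addr0. Qed.

Lemma Gs_row m : Gs v m 0 = \sum_(k <- rowI m) v k.
Proof.
elim: m => [|m IH]; first by rewrite Gs00 big_nil.
by rewrite GsS0 IH rowIS -cats1 big_cat big_seq1.
Qed.

Lemma Gs_col n : Gs v 0 n = \sum_(k <- colJ n) v k.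
Proof.
elim: n => [|n IH]; first by rewrite Gs00 big_nil.
by rewrite Gs0S IH colJS -cats1 big_cat big_seq1.
Qed.

Lemma Gs_sum m n (V : nat * nat -> R) :
  (forall j, (j < n)%N -> V (0%N, j.+1) = Gs v m j.+1 - Gs v m j) ->
  Gs v m n = \sum_(k <- rowI m) v k + \sum_(k <- colJ n) V k.
Proof.
elim: n => [|n IH] h; first by rewrite Gs_row big_nil addr0.
rewrite colJS -cats1 big_cat big_seq1 addrA -IH; last by move=> j jn; apply: h; exact: leqW.
by rewrite h// addrC subrK.
Qed.

(* [k] is the exit point of a maximal path from the axes. *)
Lemma Gs_exit m n :
  (exists k, [/\ (0 < k)%N, (k <= m.+1)%N & Gs v m.+1 n.+1 <=
     Gs v k 0 + lpp (fun i j => v (i + k, j + 1)%N) 0 (m.+1 - k) n]) \/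
  (exists k, [/\ (0 < k)%N, (k <= n.+1)%N & Gs v m.+1 n.+1 <=
     Gs v 0 k + lpp (fun i j => v (i + 1, j + k)%N) 0 m (n.+1 - k)]).
Proof.
move: {2}(m + n)%N (leqnn (m + n)%N) => N.
elim: N m n => [|N IH] m n.
  rewrite leqn0 addn_eq0 => /andP[/eqP-> /eqP->].
  have E : lpp (fun i j => v (i + 1, j + 1)%N) 0 0 0 = v (1%N, 1%N) by rewrite /lpp growE /= maxxx add0r.
  have [h|h] := leP (Gs v 0 1) (Gs v 1 0).
    by left; exists 1%N; split => //; rewrite GsSS max_r// E.
  by right; exists 1%N; split => //; rewrite GsSS max_l ?E// ltW.
move=> mnN.
have [h|h] := leP (Gs v m n.+1) (Gs v m.+1 n).
  case: n h mnN => [|n] h mnN.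
    left; exists m.+1; split => //; rewrite GsSS max_r// subnn.
    by rewrite /lpp growE /= maxxx add0r add0n lerD2l.
  have [|[k [k0 km hk]]|[k [k0 kn hk]]] := IH m n; first by move: mnN; lia.
  - left; exists k; split => //; rewrite GsSS max_r//.
    rewrite (le_trans (lerD hk (lexx _)))// -addrA lerD2l.
    rewrite [leRHS]growE /= [(n.+1 + 1)%N]addn1 subnK// lerD2r le_max.
    by rewrite lexx orbT.
  - right; exists k; split; [by []|exact: leqW|]; rewrite GsSS max_r//.
    rewrite (le_trans (lerD hk (lexx _)))// -addrA lerD2l [(n.+2 - k)%N]subSn//.
    by rewrite [leRHS]growE /= addn1 addSn subnK// lerD2r le_max lexx orbT.
case: m h mnN => [|m] /ltW h mnN.
  right; exists n.+1; split => //; rewrite GsSS max_l// subnn.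
  by rewrite /lpp growE /= maxxx add0r add0n lerD2l.
have [|[k [k0 km hk]]|[k [k0 kn hk]]] := IH m n; first by move: mnN; lia.
- left; exists k; split; [by []|exact: leqW|]; rewrite GsSS max_l//.
  rewrite (le_trans (lerD hk (lexx _)))// -addrA lerD2l [(m.+2 - k)%N]subSn//.
  by rewrite [leRHS]growE /= addn1 addSn subnK// lerD2r le_max lexx.
- right; exists k; split => //; rewrite GsSS max_l//.
  rewrite (le_trans (lerD hk (lexx _)))// -addrA lerD2l.
  rewrite [leRHS]growE /= [(m.+1 + 1)%N]addn1 subnK// lerD2r le_max.
  by rewrite lexx.
Qed.

End stationary_path.

Section lpp_compare.
Context {R : realType}.

Lemma lpp_shift (w : nat -> nat -> R) a b i j : (forall i j, 0 < w i j) ->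
  lpp (fun i j => w (i + a)%N (j + b)%N) 0 i j <= lpp w 0 (i + a)%N (j + b)%N.
Proof.
move=> w0; have L0 i' j' : 0 <= lpp w 0 i' j' by apply: lpp_ge0 => k l; exact: ltW.
have M0 i' j' : 0 <= Num.max (gleft (fun i j u => u + w i j) 0 i' j') (gdown (fun i j u => u + w i j) 0 i' j').
  by rewrite le_max; case: i' => [|i'] /=; rewrite ?lexx// L0.
rewrite /lpp; elim: j i => [|j IHj]; elim=> [|i IHi]; rewrite [leLHS]growE [leRHS]growE lerD2r ge_max.
- by rewrite /= M0.
- by rewrite M0 andbT le_max IHi.
- by rewrite M0 /= le_max IHj orbT.
- by rewrite !le_max IHi IHj orbT.
Qed.

Lemma lpp_shift_le (w : nat -> nat -> R) a b m n : (forall i j, 0 < w i j) ->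
  (a <= m)%N -> (b <= n)%N ->
  lpp (fun i j => w (i + a)%N (j + b)%N) 0 (m - a) (n - b) <= lpp w 0 m n.
Proof.
move=> w0 am bn; have := @lpp_shift w a b (m - a)%N (n - b)%N w0.
by rewrite !subnK.
Qed.

Lemma lpp_le_Gs (x v : nat * nat -> R) i j : (forall k, 0 < x k) -> (forall k, 0 < v k) ->
  (forall k, k != (0%N, 0%N) -> x k <= v k) ->
  lpp (fun i j => x (i, j)) 0 i j <= x (0%N, 0%N) + Gs v i j.
Proof.
move=> x0 v0 xv; have G0 := Gs_ge0 v0.
rewrite /lpp; elim: j i => [|j IHj]; elim=> [|i IHi]; rewrite growE /=.
- by rewrite maxxx add0r Gs00 addr0.
- rewrite (GsS0 v0) addrA lerD// ?xv// ge_max IHi /=.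
  by rewrite addr_ge0// ltW.
- rewrite (Gs0S v0) addrA lerD// ?xv// ge_max IHj andbT.
  by rewrite addr_ge0// ltW.
- rewrite GsSS addrA lerD// ?xv// ge_max; apply/andP; split.
    by rewrite (le_trans IHi)// lerD2l le_max lexx.
  by rewrite (le_trans (IHj _))// lerD2l le_max lexx orbT.
Qed.

End lpp_compare.

Section stationary_law.
Context d (Ω : measurableType d) (R : realType) (Q : probability Ω R).
Variables (al be : R).
Hypothesis al0 : 0 < al.
Hypothesis be0 : 0 < be.
Hypothesis albe : al + be = 1.

Definition brate (k : nat * nat) : R :=
  if k.1 == 0%N then if k.2 == 0%N then 1 else be
  else if k.2 == 0%N then al else 1.

Lemma brate_gt0 k : 0 < brate k.
Proof. by rewrite /brate; do 2 case: ifP => _. Qed.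

(** Columns are swept from left to right and each one from bottom to top, every cell being one Burke
    map. Slot [(0, j + 1)] holds a vertical increment of the current column, so after [m] columns
    the passage time is the bottom row plus the right column. Each sum has independent terms;
    nothing is claimed about the two sums jointly, and union bounds treat them separately. *)
Lemma stationary_law (W : nat * nat -> Ω -> R) m n :
  indep_exp Q brate W -> (forall k w, 0 < W k w) ->
  exists V, [/\ indep_exp Q brate V, (forall k w, 0 < V k w) &
    forall w, Gs (W ^~ w) m n =
      \sum_(k <- rowI m) W k w + \sum_(k <- colJ n) V k w].
Proof.
move=> hW W0.
suff [V [h1 h2 h3 _]] : exists V, [/\ indep_exp Q brate V, (forall k w, 0 < V k w),
    (forall w j, V (0%N, j.+1) w = Gs (W ^~ w) m j.+1 - Gs (W ^~ w) m j \/ (n <= j)%N) &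
    (forall w i j, (m < i)%N -> V (i, j) w = W (i, j) w)].
  exists V; split => // w; apply: (Gs_sum (W0 ^~ w) (V := V ^~ w)) => j jn.
  by case: (h3 w j) => //; rewrite leqNgt jn.
elim: m => [|m [V [hV V0 Vc Vo]]].
  exists W; split => // w j; left.
  by rewrite (Gs0S (W0 ^~ w)) addrC addKr.
(* While column [m + 1] is swept, slot [(m + 1, 0)] holds the horizontal increment at height [j];
   vertical slots up to height [j] already belong to column [m + 1], those above still to column
   [m]. *)
suff H : forall j, (j <= n)%N -> exists V, [/\ indep_exp Q brate V, (forall k w, 0 < V k w),
    (forall w j', (j' < j)%N -> V (0%N, j'.+1) w = Gs (W ^~ w) m.+1 j'.+1 - Gs (W ^~ w) m.+1 j'),
    (forall w j', (j <= j')%N -> (j' < n)%N -> V (0%N, j'.+1) w = Gs (W ^~ w) m j'.+1 - Gs (W ^~ w) m j') &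
    [/\ (forall w, V (m.+1, 0%N) w = Gs (W ^~ w) m.+1 j - Gs (W ^~ w) m j),
      (forall w j', (j < j')%N -> V (m.+1, j') w = W (m.+1, j') w) &
      (forall w i j', (m.+1 < i)%N -> V (i, j') w = W (i, j') w)]].
  have [V' [h1 h2 h3 h4 [h5 h6 h7]]] := H n (leqnn n).
  exists V'; split => // w j; have [jn|jn] := leqP n j; first by right.
  by left; exact: h3.
elim=> [_|j IH jn].
  exists V; split => //; first by move=> w j' _ jn; case: (Vc w j') => //; rewrite leqNgt jn.
  split.
  - by move=> w; rewrite Vo// (GsS0 (W0 ^~ w)) addrC addKr.
  - by move=> w j' _; rewrite Vo.
  - by move=> w i j' im; rewrite Vo// ltnW.
have [V' [hV' V'0 h3 h4 [h5 h6 h7]]] := IH (ltnW jn).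
pose i1 := (m.+1, 0%N); pose i2 := (0%N, j.+1); pose i3 := (m.+1, j.+1).
have n12 : i1 != i2 by []. have n13 : i1 != i3 by rewrite xpair_eqE andbF. have n23 : i2 != i3 by [].
exists (burke V' i1 i2 i3); split.
- by apply: indep_exp_burke => //; exact: brate_gt0.
- by move=> k w; apply: burke_gt0.
- move=> w j' jj; rewrite /burke !xpair_eqE /= eqSS; case: eqP => [->|/eqP jj'].
    rewrite /i1 /i2 /i3 h6// h4// h5 GsSS.
    move: (Gs _ m j.+1) (Gs _ m j) (Gs _ m.+1 j) => a b c.
    by rewrite /= ![Num.max _ _]maxEle; case: ifP; case: ifP => /=; lra.
  by apply: h3; move: jj jj'; lia.
- move=> w j' jj jn'; rewrite /burke !xpair_eqE /= eqSS; case: eqP => [E|_]; first by move: jj; lia.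
  by apply: h4 => //; exact: ltnW.
- split.
  + move=> w; rewrite /burke !xpair_eqE /= !eqxx.
    rewrite /i1 /i2 /i3 h6// h4// h5 GsSS.
    move: (Gs _ m j.+1) (Gs _ m j) (Gs _ m.+1 j) => a b c.
    by rewrite /= ![Num.max _ _]maxEle; case: ifP; case: ifP => /=; lra.
  + move=> w j' jj; rewrite /burke !xpair_eqE /= !eqxx; case: j' jj => // j' jj.
    rewrite eqSS ifF ?h6 //; last by apply/eqP => E; move: jj; rewrite E ltnn.
    exact: ltnW.
  + move=> w i j' im; rewrite /burke !xpair_eqE /=.
    case: i im => // i im; have E : (i == m) = false by apply/eqP; lia.
    by rewrite /= eqSS E /= h7.
Qed.

End stationary_law.

Section lpp_bounds.
Context d (Ω : measurableType d) (R : realType) (Q : probability Ω R).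
Variables (c th u : R) (N : nat).
Hypothesis c0 : 0 < c.
Hypothesis th0 : 0 < th.
Hypothesis thc : th <= c / 2.
Hypothesis u0 : 0 <= u.
Let err := expR (- (th * u) + 2 * N%:R * (th / c) ^+ 2).

Lemma err_ge (k : nat) (rho : R) : (k <= N)%N -> c <= rho ->
  expR (- (th * u) + 2 * k%:R * (th / rho) ^+ 2) <= err.
Proof.
move=> kN crho; have rho0 : 0 < rho by exact: lt_le_trans crho.
rewrite ler_expR lerD2l -!mulrA ler_pM2l//; apply: ler_pM => //.
- by rewrite exprn_ge0// divr_ge0// ltW.
- by rewrite ler_nat.
- have h : th / rho <= th / c by rewrite ler_pM2l// lef_pV2 ?posrE.
  by rewrite lerXn2r// nnegrE; apply: divr_ge0; exact: ltW.
Qed.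

Definition admissible (al be : R) := [/\ c <= al, c <= be & al + be = 1].

(** Dividing unit exponentials by the rates couples the model with boundary to the ordinary one:
    interior weights are unchanged and, for admissible rates, boundary weights only grow. *)
Definition wsc (al be : R) (X : nat * nat -> Ω -> R) k w := (brate al be k)^-1 * X k w.

Section one.
Variables (al be : R) (X : nat * nat -> Ω -> R).
Hypothesis ab : admissible al be.
Hypothesis hX : indep_exp Q (fun=> 1) X.
Hypothesis X0 : forall k w, 0 < X k w.

Let al0 : 0 < al. Proof. by case: ab => h _ _; exact: lt_le_trans h. Qed.
Let be0 : 0 < be. Proof. by case: ab => _ h _; exact: lt_le_trans h. Qed.
Let W := wsc al be X.

Lemma wsc_gt0 k w : 0 < W k w.
Proof. by rewrite mulr_gt0// invr_gt0 brate_gt0. Qed.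

Lemma wsc_law : indep_exp Q (brate al be) W.
Proof.
have -> : brate al be = (fun k => 1 / (brate al be k)^-1).
  by apply/funext => k; rewrite div1r invrK.
rewrite /W /wsc; apply: (indep_exp_scale _ hX) => k.
by rewrite invr_gt0 brate_gt0.
Qed.

Lemma row_upper (V : nat * nat -> Ω -> R) k : indep_exp Q (brate al be) V -> (k <= N)%N ->
  small Q [set w | k%:R / al + u <= \sum_(i <- rowI k) V i w] err.
Proof.
move=> hV kN; have [ca _ _] := ab; apply: small_le (err_ge kN ca) _.
have := chernoff_upper (brate_gt0 al0 be0) hV u (rowI_uniq k); rewrite size_rowI; apply => //.
- by move=> i /mapP[j _ ->].
- by rewrite (le_trans thc)// ler_pM2r.
Qed.

Lemma col_upper (V : nat * nat -> Ω -> R) k : indep_exp Q (brate al be) V -> (k <= N)%N ->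
  small Q [set w | k%:R / be + u <= \sum_(i <- colJ k) V i w] err.
Proof.
move=> hV kN; have [_ ca _] := ab; apply: small_le (err_ge kN ca) _.
have := chernoff_upper (brate_gt0 al0 be0) hV u (colJ_uniq k); rewrite size_colJ; apply => //.
- by move=> i /mapP[j _ ->].
- by rewrite (le_trans thc)// ler_pM2r.
Qed.

Lemma row_lower (V : nat * nat -> Ω -> R) k : indep_exp Q (brate al be) V -> (k <= N)%N ->
  small Q [set w | \sum_(i <- rowI k) V i w <= k%:R / al - u] err.
Proof.
move=> hV kN; have [ca _ _] := ab; apply: small_le (err_ge kN ca) _.
have := chernoff_lower (brate_gt0 al0 be0) hV u (rowI_uniq k); rewrite size_rowI; apply => //.
by move=> i /mapP[j _ ->].
Qed.

Lemma col_lower (V : nat * nat -> Ω -> R) k : indep_exp Q (brate al be) V -> (k <= N)%N ->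
  small Q [set w | \sum_(i <- colJ k) V i w <= k%:R / be - u] err.
Proof.
move=> hV kN; have [_ ca _] := ab; apply: small_le (err_ge kN ca) _.
have := chernoff_lower (brate_gt0 al0 be0) hV u (colJ_uniq k); rewrite size_colJ; apply => //.
by move=> i /mapP[j _ ->].
Qed.

(** Larger boundary weights can only delay, so the ordinary passage time is at most the stationary
    one plus the weight of the corner. The three errors [u] are for the row, the column and the
    corner. *)
Lemma lpp_upper m n : (m <= N)%N -> (n <= N)%N ->
  small Q [set w | m%:R / al + n%:R / be + 3 * u < lpp (fun i j => X (i, j) w) 0 m n] (3 * err).
Proof.
move=> mN nN; have [ca cb ab1] := ab.
have [V [hV V0 VE]] := @stationary_law _ _ _ Q al be al0 be0 ab1 W m n wsc_law wsc_gt0.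
have s1 := row_upper wsc_law mN; have s2 := col_upper hV nN.
have s3 : small Q [set w | u < X (0%N, 0%N) w] err.
  apply: small_measurable; first by apply: measurable_gt; exact: hX.1.
  have := hX.2 [:: (0%N, 0%N)] (fun=> u) isT; rewrite big_seq1 max_r// => E.
  have -> : [set w | u < X (0%N, 0%N) w] = [set w | forall i, i \in [:: (0%N, 0%N)] -> u < X i w].
    apply/seteqP; split => w /=; first by move=> h i; rewrite inE => /eqP ->.
    by apply; rewrite mem_head.
  rewrite E lee_fin ler_expR.
  have c1 : c <= 2^-1 by lra.
  have t1 : th <= 1 by have := thc; lra.
  have e0 : 0 <= 2 * N%:R * (th / c) ^+ 2 :> R by rewrite mulr_ge0// exprn_ge0// divr_ge0// ltW.
  have : th * u <= 1 * u by rewrite ler_wpM2r.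
  by lra.
have -> : 3 * err = err + err + err by lra.
apply: small_sub (smallU (smallU s1 s2) s3) => w /=; apply: contraPP.
move=> /not_orP[/not_orP[/negP h1 /negP h2] /negP h3]; apply/negP; rewrite -leNgt.
move: h1 h2 h3; rewrite -!ltNge -leNgt => h1 h2 h3.
apply: le_trans (@lpp_le_Gs _ (X ^~ w) (W ^~ w) m n (X0 ^~ w) (wsc_gt0 ^~ w) _) _.
  move=> [i j] ij; rewrite /W /wsc -{1}[X _ w]mul1r ler_pM2r// invr_ge1 ?unitfE ?gt_eqF ?brate_gt0//.
  by have a' := al0; have b' := be0; rewrite /brate; do 2 case: ifP => _; lra.
by rewrite VE; lra.
Qed.

Lemma Gs_lower m n : (m <= N)%N -> (n <= N)%N ->
  small Q [set w | Gs (W ^~ w) m n < m%:R / al + n%:R / be - 2 * u] (2 * err).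
Proof.
move=> mN nN; have [ca cb ab1] := ab.
have [V [hV V0 VE]] := @stationary_law _ _ _ Q al be al0 be0 ab1 W m n wsc_law wsc_gt0.
have -> : 2 * err = err + err by lra.
apply: small_sub (smallU (row_lower wsc_law mN) (col_lower hV nN)) => w /=; apply: contraPP.
move=> /not_orP[/negP h1 /negP h2]; apply/negP; rewrite -leNgt VE.
by move: h1 h2; rewrite -!ltNge; lra.
Qed.

End one.

(** A maximal path of the stationary model leaves the axes at some [k]. The two gap hypotheses say
    that leaving at [K] or later would give too small a total, the rest of the path being bounded by
    [lpp_upper] with tilted parameters. So it leaves before [K], and dropping its boundary part
    costs at most [K / c + u]; the other [2 * u] come from [Gs_lower]. *)
Lemma lpp_lower (X : nat * nat -> Ω -> R) (al be al1 be1 al2 be2 : R) (K m n : nat) :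
  indep_exp Q (fun=> 1) X -> (forall k w, 0 < X k w) ->
  admissible al be -> admissible al1 be1 -> admissible al2 be2 ->
  (m < N)%N -> (n < N)%N -> (K <= N)%N ->
  (forall k, (K <= k <= m.+1)%N -> k%:R / al + (m.+1 - k)%:R / al1 + n%:R / be1 + 4 * u
     < m.+1%:R / al + n.+1%:R / be - 2 * u) ->
  (forall k, (K <= k <= n.+1)%N -> k%:R / be + m%:R / al2 + (n.+1 - k)%:R / be2 + 4 * u
     < m.+1%:R / al + n.+1%:R / be - 2 * u) ->
  small Q [set w | lpp (fun i j => X (i, j) w) 0 m.+1 n.+1 <
     m.+1%:R / al + n.+1%:R / be - 3 * u - K%:R / c] (10 * N.+1%:R * err).
Proof.
move=> hX X0 ab ab1 ab2 mN nN KN H1 H2; have [ca cb _] := ab.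
have al0 : 0 < al by exact: lt_le_trans ca.
have be0 : 0 < be by exact: lt_le_trans cb.
have err0 : 0 <= err by exact: expR_ge0.
have hW := wsc_law ab hX.
pose W := wsc al be X.
have W0 : forall k w, 0 < W k w := wsc_gt0 ab X0.
have s0 := Gs_lower ab hX X0 mN nN.
have s1 : small Q [set w | exists2 k, (k < N.+1)%N & [set w | k%:R / al + u <= \sum_(i <- rowI k) W i w] w] (N.+1%:R * err).
  by apply: small_bigU => k kN; apply: (row_upper ab).
have s2 : small Q [set w | exists2 k, (k < N.+1)%N & [set w | k%:R / be + u <= \sum_(i <- colJ k) W i w] w] (N.+1%:R * err).
  by apply: small_bigU => k kN; apply: (col_upper ab).
have s3 : small Q [set w | exists2 k, (k < N.+1)%N & [set w | (m.+1 - k)%:R / al1 + n%:R / be1 + 3 * u <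
    lpp (fun i j => X (i + k, j + 1)%N w) 0 (m.+1 - k) n] w] (N.+1%:R * (3 * err)).
  apply: small_bigU => k kN.
  have hX' := indep_exp_reindex (f := fun a => (a.1 + k, a.2 + 1)%N) (g := fun a => (a.1 - k, a.2 - 1)%N) _ hX.
  apply: (lpp_upper ab1 (hX' _)) => //; last 2 first.
  - by lia.
  - exact: ltnW.
  by move=> [i j] /=; rewrite !addnK.
have s4 : small Q [set w | exists2 k, (k < N.+1)%N & [set w | m%:R / al2 + (n.+1 - k)%:R / be2 + 3 * u <
    lpp (fun i j => X (i + 1, j + k)%N w) 0 m (n.+1 - k)] w] (N.+1%:R * (3 * err)).
  apply: small_bigU => k kN.
  have hX' := indep_exp_reindex (f := fun a => (a.1 + 1, a.2 + k)%N) (g := fun a => (a.1 - 1, a.2 - k)%N) _ hX.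
  apply: (lpp_upper ab2 (hX' _)) => //; last 2 first.
  - exact: ltnW.
  - by lia.
  by move=> [i j] /=; rewrite !addnK.
have N1 : 1 <= N.+1%:R :> R by rewrite ler1n.
have le : 2 * err + N.+1%:R * err + N.+1%:R * err + N.+1%:R * (3 * err) + N.+1%:R * (3 * err) <= 10 * N.+1%:R * err.
  by nra.
apply: small_le le _.
apply: small_sub (smallU (smallU (smallU (smallU s0 s1) s2) s3) s4) => w /=; apply: contraPP.
move=> /not_orP[/not_orP[/not_orP[/not_orP[h0 h1] h2] h3] h4]; apply/negP; rewrite -leNgt.
move: h0 => /negP; rewrite -leNgt => h0.
have r1 k : (k <= N)%N -> Gs (W ^~ w) k 0 < k%:R / al + u.
  move=> kN; rewrite (Gs_row (W0 ^~ w)) ltNge; apply/negP => h; apply: h1.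
  by exists k.
have r2 k : (k <= N)%N -> Gs (W ^~ w) 0 k < k%:R / be + u.
  move=> kN; rewrite (Gs_col (W0 ^~ w)) ltNge; apply/negP => h; apply: h2.
  by exists k.
have r3 k : (k <= N)%N -> lpp (fun i j => X (i + k, j + 1)%N w) 0 (m.+1 - k) n <= (m.+1 - k)%:R / al1 + n%:R / be1 + 3 * u.
  by move=> kN; rewrite leNgt; apply/negP => h; apply: h3; exists k.
have r4 k : (k <= N)%N -> lpp (fun i j => X (i + 1, j + k)%N w) 0 m (n.+1 - k) <= m%:R / al2 + (n.+1 - k)%:R / be2 + 3 * u.
  by move=> kN; rewrite leNgt; apply/negP => h; apply: h4; exists k.
have Kc rho : c <= rho -> K%:R / rho <= K%:R / c.
  move=> h; have := lt_le_trans c0 h => rho0.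
  by rewrite ler_wpM2l// lef_pV2 ?posrE.
have WX i j k l : (0 < k)%N -> (0 < l)%N -> W (i + k, j + l)%N w = X (i + k, j + l)%N w.
  by move=> k0 l0; rewrite /W /wsc /brate /= !addn_eq0 (gtn_eqF k0) (gtn_eqF l0) !andbF invr1 mul1r.
have Xp i j : 0 < X (i, j) w by [].
case: (Gs_exit (W ^~ w) m n) => -[k [k0 km hk]].
- have kN : (k <= N)%N by exact: leq_trans km mN.
  rewrite (_ : lpp _ _ _ _ = lpp (fun i j => X (i + k, j + 1)%N w) 0 (m.+1 - k) n) in hk; last first.
    by apply: grow_ext => i j _ _ t; rewrite WX.
  have [kK|kK] := leqP K k.
    have hh : (K <= k <= m.+1)%N by rewrite kK.
    by have := H1 _ hh; have := r1 _ kN; have := r3 _ kN; lra.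
  have := @lpp_shift_le _ (fun i j => X (i, j) w) k 1 m.+1 n.+1 Xp km isT.
  rewrite subn1 /= => sh.
  have : Gs (W ^~ w) k 0 <= Gs (W ^~ w) K 0.
    rewrite !(Gs_row (W0 ^~ w)) -(subnK (ltnW kK)) addnC /rowI iotaD map_cat big_cat/= lerDl.
    by apply: sumr_ge0 => i _; exact: ltW.
  by have := r1 _ KN; have := Kc _ ca; lra.
- have kN : (k <= N)%N by exact: leq_trans km nN.
  rewrite (_ : lpp _ _ _ _ = lpp (fun i j => X (i + 1, j + k)%N w) 0 m (n.+1 - k)) in hk; last first.
    by apply: grow_ext => i j _ _ t; rewrite WX.
  have [kK|kK] := leqP K k.
    have hh : (K <= k <= n.+1)%N by rewrite kK.
    by have := H2 _ hh; have := r2 _ kN; have := r4 _ kN; lra.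
  have := @lpp_shift_le _ (fun i j => X (i, j) w) 1 k m.+1 n.+1 Xp isT km.
  rewrite subn1 /= => sh.
  have : Gs (W ^~ w) 0 k <= Gs (W ^~ w) 0 K.
    rewrite !(Gs_col (W0 ^~ w)) -(subnK (ltnW kK)) addnC /colJ iotaD map_cat big_cat/= lerDl.
    by apply: sumr_ge0 => i _; exact: ltW.
  by have := r2 _ KN; have := Kc _ cb; lra.
Qed.

End lpp_bounds.

(** * Height functions *)

Section passage.
Context {R : realType}.
Variables (y : int * nat -> R).
Hypothesis y0 : forall i, 0 < y i.
Hypothesis yd : divg y.
Implicit Types (z x : int) (s t : R).

Lemma Gt_rec z s i j : Gt y z s i j = next y (z + i%:Z - j%:Z)
  (Num.max (if i is i'.+1 then Gt y z s i' j else s) (if j is j'.+1 then Gt y z s i j' else s)).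
Proof. by rewrite /Gt growE; case: i; case: j. Qed.

Lemma Gt_gt z s i j : 0 <= s -> s < Gt y z s i j.
Proof.
move=> s0; elim: i j => [|i IH] j; rewrite Gt_rec.
  apply: le_lt_trans (next_gt y0 yd _ _); first by rewrite le_max lexx.
  by rewrite le_max s0.
apply: le_lt_trans (next_gt y0 yd _ _); first by rewrite le_max (ltW (IH j)).
by rewrite le_max (le_trans s0)// ltW.
Qed.

Lemma Gt_ge0 z s i j : 0 <= s -> 0 <= Gt y z s i j.
Proof. by move=> s0; rewrite (le_trans s0)// ltW// Gt_gt. Qed.

Lemma Gt_ltl z s i j : 0 <= s -> Gt y z s i j < Gt y z s i.+1 j.
Proof.
move=> s0; rewrite [ltRHS]Gt_rec; apply: le_lt_trans (next_gt y0 yd _ _).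
  by rewrite le_max lexx.
by rewrite le_max Gt_ge0.
Qed.

Lemma Gt_ltd z s i j : 0 <= s -> Gt y z s i j < Gt y z s i j.+1.
Proof.
move=> s0; rewrite [ltRHS]Gt_rec; apply: le_lt_trans (next_gt y0 yd _ _).
  by rewrite le_max lexx orbT.
by rewrite le_max Gt_ge0 ?orbT.
Qed.

Lemma Gt_mono z s i j k l : 0 <= s -> (i <= k)%N -> (j <= l)%N ->
  Gt y z s i j <= Gt y z s k l.
Proof.
move=> s0 /subnK <- /subnK <-; elim: (k - i)%N => [|a IH]; last first.
  by rewrite addSn (le_trans IH)// ltW// Gt_ltl.
rewrite add0n; elim: (l - j)%N => [//|b IH].
by rewrite addSn (le_trans IH)// ltW// Gt_ltd.
Qed.

Lemma Gt_epoch z s i j : 0 <= s -> is_epoch y (z + i%:Z - j%:Z) (Gt y z s i j).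
Proof. by move=> s0; rewrite Gt_rec /next; eexists; reflexivity. Qed.

Lemma next_le_epoch x s t : 0 <= s -> s < t -> is_epoch y x t -> next y x s <= t.
Proof. by move=> s0 st [n tE]; move: st; rewrite tE => st; exact: next_le. Qed.

(* The [m]-th cell, from the bottom, on the diagonal of the bond [z + a]. *)
Definition dcell (a : int) (m : nat) : nat * nat :=
  match a with Posz n => ((m + n)%N, m) | Negz n => (m, (m + n.+1)%N) end.

Lemma dcell_diag a m : ((dcell a m).1%:Z - (dcell a m).2%:Z)%R = a.
Proof. by case: a => n /=; lia. Qed.

Lemma dcell_height a m : ((dcell a m).1 + (dcell a m).2 = `|a| + m.*2)%N.
Proof. by case: a => n /=; lia. Qed.

Lemma dcellE (i j : nat) : dcell (i%:Z - j%:Z) (minn i j) = (i, j).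
Proof.
have [ji|ij] := leqP j i.
  have -> : i%:Z - j%:Z = Posz (i - j) by lia.
  by rewrite /= subnKC.
have -> : i%:Z - j%:Z = Negz (j - i).-1 by lia.
by rewrite /= prednK ?subn_gt0// subnKC// ltnW.
Qed.

(** Successive cells of a diagonal are filled at distinct epochs of one clock, hence not before its
    successive epochs; divergence of the clock then makes every height finite. *)
Lemma dcell_ge z s a m : 0 <= s ->
  psum y (z + a) 0 m.+1 <= Gt y z s (dcell a m).1 (dcell a m).2.
Proof.
move=> s0; elim: m => [|m IH].
  have [n tE] := Gt_epoch z (dcell a 0).1 (dcell a 0).2 s0.
  have <- : z + (dcell a 0).1%:Z - (dcell a 0).2%:Z = z + a by rewrite -addrA dcell_diag.
  rewrite tE; exact: psum_mono.
have e1 : (dcell a m.+1).1 = (dcell a m).1.+1 by case: (a).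
have e2 : (dcell a m.+1).2 = (dcell a m).2.+1 by case: (a).
have zE : z + (dcell a m.+1).1%:Z - (dcell a m.+1).2%:Z = z + a by rewrite -addrA dcell_diag.
have lt : Gt y z s (dcell a m).1 (dcell a m).2 < Gt y z s (dcell a m.+1).1 (dcell a m.+1).2.
  by rewrite e1 e2 (lt_trans (Gt_ltl z _ _ s0))// Gt_ltd.
have [n tE] := Gt_epoch z (dcell a m.+1).1 (dcell a m.+1).2 s0.
rewrite zE in tE; rewrite tE -/(psum y (z + a) 0 n.+1); apply: psum_mono => //.
have := le_lt_trans IH lt; rewrite tE -/(psum y (z + a) 0 n.+1) => h.
by rewrite ltnNge; apply/negP => h'; have := psum_mono (z + a) 0 y0 h'; rewrite leNgt h.
Qed.

Lemma fill_ex z s t a : 0 <= s -> exists m, t < Gt y z s (dcell a m).1 (dcell a m).2.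
Proof.
move=> s0; have [n hn] := yd (z + a) t; exists n.
by apply: lt_le_trans hn (le_trans _ (dcell_ge z a n s0)); exact: psum_mono.
Qed.

Lemma fillm_ex z s t a : 0 <= s -> exists m, t <= Gt y z s (dcell a m).1 (dcell a m).2.
Proof. by move=> /(fill_ex z t a)[m hm]; exists m; exact: ltW. Qed.

End passage.

Section heights.
Context {R : realType}.
Implicit Types (y : int * nat -> R) (z x : int) (s t : R).

Definition fill y z s t a : nat :=
  if pselect (exists m, t < Gt y z s (dcell a m).1 (dcell a m).2) is left h then ex_minn h else 0%N.

(** Counts the cells filled strictly before [t], which gives the left limit of the height in
    time. *)
Definition fillm y z s t a : nat :=
  if pselect (exists m, t <= Gt y z s (dcell a m).1 (dcell a m).2) is left h then ex_minn h else 0%N.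

(* [H y z s t x] is the height at time [t] of the bond [(x, x + 1)], for the
   interface started at time [s] from the wedge [x |-> |x - z|]. *)
Definition H y z s t x : nat := (`|x - z| + (fill y z s t (x - z)).*2)%N.

Definition Hm y z s t x : nat := (`|x - z| + (fillm y z s t (x - z)).*2)%N.

Variables (y : int * nat -> R).
Hypothesis y0 : forall i, 0 < y i.
Hypothesis yd : divg y.

Let dG z s a m k : 0 <= s -> (m <= k)%N ->
  Gt y z s (dcell a m).1 (dcell a m).2 <= Gt y z s (dcell a k).1 (dcell a k).2.
Proof.
by move=> s0 mk; apply: Gt_mono => //; case: a => n /=; rewrite ?leq_add2r.
Qed.

Lemma fillE z s t a m : 0 <= s ->
  (Gt y z s (dcell a m).1 (dcell a m).2 <= t) = (m < fill y z s t a)%N.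
Proof.
move=> s0; rewrite /fill; case: pselect => [h|]; last by case; exact: fill_ex.
case: ex_minnP => k hk kmin; apply/idP/idP => hm.
  by rewrite ltnNge; apply/negP => km; have := dG z a s0 km; rewrite leNgt (le_lt_trans hm hk).
by rewrite leNgt; apply/negP => /kmin; rewrite leqNgt hm.
Qed.

Lemma fillmE z s t a m : 0 <= s ->
  (Gt y z s (dcell a m).1 (dcell a m).2 < t) = (m < fillm y z s t a)%N.
Proof.
move=> s0; rewrite /fillm; case: pselect => [h|]; last by case; exact: fillm_ex.
case: ex_minnP => k hk kmin; apply/idP/idP => hm.
  by rewrite ltnNge; apply/negP => km; have := dG z a s0 km; rewrite leNgt (lt_le_trans hm hk).
by rewrite ltNge; apply/negP => /kmin; rewrite leqNgt hm.
Qed.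

(** On one diagonal levels increase by two, so comparing [i + j] with the height is the same as
    comparing ranks. This is the dictionary between passage times and heights. *)
Lemma HE z s t i j : 0 <= s ->
  (Gt y z s i j <= t) = (i + j < H y z s t (z + i%:Z - j%:Z))%N.
Proof.
move=> s0; have E : z + i%:Z - j%:Z - z = i%:Z - j%:Z by ring.
have := fillE z t (i%:Z - j%:Z) (minn i j) s0; rewrite dcellE /= => ->; rewrite /H E.
by apply/idP/idP; lia.
Qed.

Lemma HmE z s t i j : 0 <= s ->
  (Gt y z s i j < t) = (i + j < Hm y z s t (z + i%:Z - j%:Z))%N.
Proof.
move=> s0; have E : z + i%:Z - j%:Z - z = i%:Z - j%:Z by ring.
have := fillmE z t (i%:Z - j%:Z) (minn i j) s0; rewrite dcellE /= => ->; rewrite /Hm E.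
by apply/idP/idP; lia.
Qed.

(* First unfilled cell above a bond. *)
Lemma H_cell z s t x : 0 <= s -> exists i j : nat,
  [/\ x = z + i%:Z - j%:Z, (i + j = H y z s t x)%N & t < Gt y z s i j].
Proof.
move=> s0; exists (dcell (x - z) (fill y z s t (x - z))).1, (dcell (x - z) (fill y z s t (x - z))).2.
split.
- by rewrite -addrA dcell_diag addrCA subrr addr0.
- by rewrite dcell_height.
- by rewrite ltNge fillE// ltnn.
Qed.

Lemma Hm_cell z s t x : 0 <= s -> exists i j : nat,
  [/\ x = z + i%:Z - j%:Z, (i + j = Hm y z s t x)%N & t <= Gt y z s i j].
Proof.
move=> s0; exists (dcell (x - z) (fillm y z s t (x - z))).1, (dcell (x - z) (fillm y z s t (x - z))).2.
split.
- by rewrite -addrA dcell_diag addrCA subrr addr0.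
- by rewrite dcell_height.
- by rewrite leNgt fillmE// ltnn.
Qed.

Lemma H_le z s t i j x : 0 <= s -> x = z + i%:Z - j%:Z -> t < Gt y z s i j ->
  (H y z s t x <= i + j)%N.
Proof. by move=> s0 ->; rewrite ltNge HE// -leqNgt. Qed.

Lemma Hm_le z s t i j x : 0 <= s -> x = z + i%:Z - j%:Z -> t <= Gt y z s i j ->
  (Hm y z s t x <= i + j)%N.
Proof. by move=> s0 ->; rewrite leNgt HmE// -leqNgt. Qed.

Lemma H_step z s t x : 0 <= s ->
  (H y z s t (x + 1) = (H y z s t x).+1 \/ H y z s t x = (H y z s t (x + 1)).+1)%N.
Proof.
move=> s0.
have [i [j [xE hE ht]]] := H_cell z t x s0.
have [i' [j' [xE' hE' ht']]] := H_cell z t (x + 1) s0.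
have h1 : (H y z s t (x + 1) <= i.+1 + j)%N.
  by apply: H_le => //; [rewrite xE; lia|exact: lt_trans ht (Gt_ltl y0 yd z _ _ s0)].
have h2 : (H y z s t x <= i' + j'.+1)%N.
  by apply: H_le => //; [lia|exact: lt_trans ht' (Gt_ltd y0 yd z _ _ s0)].
by lia.
Qed.

Lemma H_mono z s t t' x : 0 <= s -> t <= t' -> (H y z s t x <= H y z s t' x)%N.
Proof.
move=> s0 tt; have [i [j [xE <- ht]]] := H_cell z t' x s0.
by apply: H_le => //; exact: le_lt_trans ht.
Qed.

Lemma H_start z s t x : 0 <= s -> t <= s -> H y z s t x = `|x - z|%N.
Proof.
move=> s0 ts; rewrite /H; case E: (fill _ _ _ _ _) => [|k]; first by rewrite addn0.
have := fillE z t (x - z) 0 s0; rewrite E ltn0Sn leNgt (le_lt_trans ts)// Gt_gt//.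
Qed.

Lemma H_ge z s t x : (`|x - z| <= H y z s t x)%N.
Proof. exact: leq_addr. Qed.

(** The interface has slopes of modulus one, so the wedge placed on it at [z] at time [s] lies above
    it, and growth with the same clocks preserves the order. In terms of cells: with [(p, q)] the
    first unfilled cell above [z], the cell [(p + i', q + j')] of the old interface is filled no
    earlier than the cell [(i', j')] of the new wedge. *)
Lemma H_comp_le z0 s0 s t z x : 0 <= s0 -> s0 <= s ->
  (H y z0 s0 t x <= H y z0 s0 s z + H y z s t x)%N.
Proof.
move=> s00 ss; have s0' := le_trans s00 ss.
have [p [q [zE pq hs]]] := H_cell z0 s z s00.
have [i [j [xE <- ht]]] := H_cell z t x s0'.
suff G i' j' : Gt y z s i' j' <= Gt y z0 s0 (p + i') (q + j').
  rewrite -pq (_ : (_ + (i + j) = (p + i) + (q + j))%N); last by lia.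
  apply: H_le => //; first by lia.
  exact: lt_le_trans ht (G _ _).
have clk i1 j1 : z0 + (p + i1)%:Z - (q + j1)%:Z = z + i1%:Z - j1%:Z by lia.
have gp i1 j1 : s <= Gt y z0 s0 (p + i1) (q + j1).
  by apply: ltW; apply: lt_le_trans hs _; apply: Gt_mono => //; exact: leq_addr.
(* At the tip of the wedge the predecessors in the old interface may be filled before [s]; what
   counts is that the cell itself is still empty at [s], so that its epoch lies after [s]. *)
have key S1 S2 x1 : 0 <= S2 -> s <= S1 -> (S1 <= S2 \/ S1 = s /\ s < next y x1 S2) ->
    next y x1 S1 <= next y x1 S2.
  move=> S20 sS1 [h|[-> h]]; first by apply: next_mono => //; exact: le_trans sS1.
  by apply: next_le_epoch => //; exists (hit y x1 0 S2).
have maxge i1 j1 : s <= Num.max (if i1 is i'.+1 then Gt y z s i' j1 else s) (if j1 is j'.+1 then Gt y z s i1 j' else s).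
  by rewrite le_max; case: i1 => [|i1]; rewrite ?lexx// ltW// Gt_gt.
have maxge0 i1 j1 : 0 <= Num.max (if i1 is i'.+1 then Gt y z0 s0 i' j1 else s0) (if j1 is j'.+1 then Gt y z0 s0 i1 j' else s0).
  by rewrite le_max; case: i1 => [|i1]; rewrite ?s00// Gt_ge0.
have red i1 j1 := key _ _ (z + i1%:Z - j1%:Z) (maxge0 (p + i1)%N (q + j1)%N) (maxge i1 j1).
elim: j' i' => [|j' IHj]; elim=> [|i' IHi]; rewrite Gt_rec [leRHS]Gt_rec clk; apply: red.
- right; rewrite maxxx; split => //; have := gp 0%N 0%N.
  rewrite -clk -Gt_rec le_eqVlt => /predU1P[E|//].
  by move: hs; rewrite E !addn0 ltxx.
- left; rewrite addnS /= ge_max !le_max IHi (le_trans (gp i' 0%N) (lexx _)) //=.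
- left; rewrite [(q + j'.+1)%N]addnS /= ge_max !le_max IHj (le_trans (gp 0%N j') (lexx _)) ?orbT//.
- by left; rewrite !addnS /= ge_max !le_max; have := IHi; rewrite !addnS => ->; have := IHj i'.+1; rewrite !addnS => ->; rewrite orbT.
Qed.

(** The minimum in the composition is attained. From the first unfilled cell above [x] at time [t],
    step back each time to the predecessor filled last, until both predecessors were filled by time
    [s]; the site of that cell is [z]. *)
Lemma H_comp_ge z0 s0 s t x : 0 <= s0 -> s0 <= s -> s <= t ->
  exists z, (H y z0 s0 s z + H y z s t x <= H y z0 s0 t x)%N.
Proof.
move=> s00 ss st; have s0' := le_trans s00 ss.
have [i [j [xE <- ht]]] := H_cell z0 t x s00.
have {ht} hts : s < Gt y z0 s0 i j /\ t < Gt y z0 s0 i j by rewrite ht (le_lt_trans st).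
suff [z [p [q [i' [j' [zE pq iE jE G]]]]]] : exists z (p q i' j' : nat),
    [/\ z = z0 + p%:Z - q%:Z, (p + q = H y z0 s0 s z)%N, i = (p + i')%N, j = (q + j')%N &
      Gt y z0 s0 i j <= Gt y z s i' j'].
  exists z; rewrite -pq (_ : (i + j = (p + q) + (i' + j'))%N) ?leq_add2l; last by lia.
  apply: H_le => //; first by lia.
  by apply: lt_le_trans G; case: hts.
case: hts => his _; clear xE x.
move: {2}(i + j)%N (leqnn (i + j)%N) => n; elim: n i j his => [|n IH] i j his ijn.
(* Both cases of the induction need the stopping step [base], so it is established for them in
   parallel. *)
all: pose S := Num.max (if i is i'.+1 then Gt y z0 s0 i' j else s0) (if j is j'.+1 then Gt y z0 s0 i j' else s0).
all: have S0 : 0 <= S by rewrite /S le_max; case: (i) => [|i1]; rewrite ?s00// Gt_ge0.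
all: have base : S <= s -> exists z (p q i' j' : nat),
    [/\ z = z0 + p%:Z - q%:Z, (p + q = H y z0 s0 s z)%N, i = (p + i')%N, j = (q + j')%N &
      Gt y z0 s0 i j <= Gt y z s i' j'].
1, 3: move=> Ss; exists (z0 + i%:Z - j%:Z), i, j, 0%N, 0%N; split; rewrite ?addn0//; last first.
1, 3: by rewrite Gt_rec [leRHS]Gt_rec -/S maxxx addr0 subr0; apply: next_mono.
(* The cell [(i - 1, j - 1)] is filled by time [s] and [(i, j)] is not, so [i + j] is exactly the
   height at [s]; on the axes the initial wedge gives this. *)
1, 2: have h1 := H_le s00 (erefl _) his; have h2 := H_ge z0 s0 s (z0 + i%:Z - j%:Z).
1, 2: case: (posnP i) => [i0|i0]; first by move: h1 h2; rewrite i0; lia.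
1, 2: case: (posnP j) => [j0|j0]; first by move: h1 h2; rewrite j0; lia.
1, 2: have := HE z0 s i.-1 j.-1 s00; rewrite (_ : Gt y z0 s0 i.-1 j.-1 <= s).
1, 3: move=> /esym; rewrite (_ : z0 + i.-1%:Z - j.-1%:Z = z0 + i%:Z - j%:Z); last by lia.
1, 2: by have := dcell_height (z0 + i%:Z - j%:Z - z0) (fill y z0 s0 s (z0 + i%:Z - j%:Z - z0)); rewrite /H; move: h1; rewrite /H; lia.
1, 2: by apply: le_trans Ss; rewrite /S le_max; move: i0 j0; case: (i) => // i1 _; case: (j) => // j1 _ /=; rewrite ltW// Gt_ltd.
  apply: base; rewrite /S; move: ijn; case: (i) => [|i1]; case: (j) => [|j1] //= _.
  by rewrite maxxx.
have [Ss|Ss] := leP S s; first exact: base.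
have step i1 j1 z1 i' j' : 0 <= Gt y z0 s0 i1 j1 -> z1 + i'%:Z - j'%:Z = z0 + i%:Z - j%:Z ->
    S = Gt y z0 s0 i1 j1 ->
    Gt y z0 s0 i1 j1 <= Num.max (if i' is i''.+1 then Gt y z1 s i'' j' else s) (if j' is j''.+1 then Gt y z1 s i' j'' else s) ->
    Gt y z0 s0 i j <= Gt y z1 s i' j'.
  by move=> G0 zE SE h; rewrite Gt_rec -/S SE [leRHS]Gt_rec zE; apply: next_mono.
have [gl|gl] := leP (if j is j'.+1 then Gt y z0 s0 i j' else s0) (if i is i'.+1 then Gt y z0 s0 i' j else s0).
  have SE : S = if i is i'.+1 then Gt y z0 s0 i' j else s0 by rewrite /S max_l.
  clearbody S; clear gl base; move: Ss; rewrite SE; case: i his ijn SE step => [|i] his ijn SE step Ss.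
    by move: Ss; rewrite ltNge ss.
  have [|z [p [q [i' [j' [zE pq iE jE G]]]]]] := IH i j Ss; first by move: ijn; lia.
  exists z, p, q, i'.+1, j'; split => //; first by rewrite iE addnS.
  apply: (step i j) => //; [exact: Gt_ge0|lia|by rewrite le_max G].
have SE : S = if j is j'.+1 then Gt y z0 s0 i j' else s0 by rewrite /S max_r// ltW.
clearbody S; clear gl base; move: Ss; rewrite SE; case: j his ijn SE step => [|j] his ijn SE step Ss.
  by move: Ss; rewrite ltNge ss.
have [|z [p [q [i' [j' [zE pq iE jE G]]]]]] := IH i j Ss; first by move: ijn; lia.
exists z, p, q, i', j'.+1; split => //; first by rewrite jE addnS.
apply: (step i j) => //; [exact: Gt_ge0|lia|by rewrite le_max G orbT].
Qed.

End heights.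

(** Induction along the time axis, through the supremum of the good initial segments. The epochs of
    infinitely many clocks cannot in general be listed in increasing order, so one cannot proceed
    from epoch to epoch. *)
Lemma real_induction {R : realType} (P : R -> Prop) (T : R) : P 0 ->
  (forall t : R, 0 <= t < T -> P t -> exists2 e : R, 0 < e & forall r, t <= r < t + e -> P r) ->
  (forall s : R, 0 < s < T -> (forall r, 0 <= r < s -> P r) -> P s) ->
  forall t : R, 0 <= t < T -> P t.
Proof.
move=> P0 Pr Pl t /andP[t0 tT].
pose A := [set s : R | 0 <= s <= t /\ forall r, 0 <= r <= s -> P r].
have A0 : A 0.
  split=> [|r]; first by rewrite lexx.
  by move=> /andP[r0 r0']; have -> : r = 0 by apply/eqP; rewrite eq_le r0 r0'.
have supA : has_sup A.
  by split; [exists 0|exists t => s [/andP[]]].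
have s0 : 0 <= sup A by apply: ub_le_sup A0; case: supA.
have st : sup A <= t by apply: ge_sup; [exists 0|move=> s [/andP[]]].
have below r : 0 <= r < sup A -> P r.
  move=> /andP[r0 rs]; have [s [_ hs] rs'] := sup_gt (ex_intro _ 0 A0) rs.
  by apply: hs; rewrite r0 ltW.
have Ps : P (sup A).
  have [s00|s00] := eqVneq (sup A) 0; first by rewrite s00.
  by apply: Pl => //; rewrite lt_neqAle eq_sym s00 s0 (le_lt_trans st).
have [e e0 he] := Pr (sup A) (introT andP (conj s0 (le_lt_trans st tT))) Ps.
have [ts|st'|] := ltgtP t (sup A).
- by apply: below; rewrite t0.
- pose u := Num.min t (sup A + e / 2).
  suff : A u.
    move=> /(ub_le_sup (proj2 supA)); rewrite /u ge_min leNgt st' /= => h.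
    by have := e0; lra.
  split; first by rewrite /u le_min t0 ge_min lexx /= addr_ge0// divr_ge0// ltW.
  move=> r /andP[r0 ru]; have [rs|rs] := ltP r (sup A); first by apply: below; rewrite r0.
  apply: he; rewrite rs; move: ru; rewrite le_min => /andP[_ /le_lt_trans]; apply.
  by have := e0; lra.
by move=> ->.
Qed.

(** * The exclusion process as the gradient of a height function *)

Section left_limits.
Context {R : realType}.
Implicit Types (eta xi : R -> int -> bool) (s t r : R) (x : int).

Lemma left_lim_eq eta x s b b' : 0 < s -> left_lim eta x s b ->
  (forall r, 0 < r < s -> eta r x = b') -> b = b'.
Proof.
move=> s0 [e e0 he] hb; pose r := Num.max (s / 2) (s - e / 2).
have r0 : 0 < r by rewrite lt_max divr_gt0.
have rs : r < s by rewrite gt_max; lra.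
rewrite -(he r)//; first by apply: hb; rewrite r0.
by rewrite rs lt_max andbT; apply/orP; right; lra.
Qed.

Lemma left_lim_ext eta xi x s b : (forall r, 0 < r < s -> eta r x = xi r x) ->
  left_lim eta x s b -> left_lim xi x s b.
Proof.
move=> E [e e0 he]; exists e => // r r0 rs; rewrite -E ?he// r0.
by case/andP: rs.
Qed.

End left_limits.

Definition step (z x : int) : bool := (x <= z)%R.

Section uniqueness.
Context {R : realType}.
Variables (y : int * nat -> R).
Hypothesis y0 : forall i, 0 < y i.
Hypothesis yd : divg y.
Implicit Types (eta xi : R -> int -> bool) (z x : int) (s t r : R).

Let le00 : (0 : R) <= 0. Proof. exact: lexx. Qed.

(** Influence travels at finite speed: the site [z + 1 + n] can be entered only once its left
    neighbour has been reached, and this recursion is that of the cells [(n, 0)]. It holds for every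
    process obeying the rules, before uniqueness is known. *)
Lemma front_right eta z n t : tasep_from y (step z) eta -> 0 <= t < Gt y z 0 n 0 ->
  eta t (z + 1 + n%:Z) = false.
Proof.
case=> e0 [er [el eu]]; elim: n t => [|n IH]; apply: real_induction.
- by rewrite e0 /step; lia.
- by move=> t /andP[t0 _] E; have [e ep he] := er (z + 1 + 0%:Z) t t0; exists e => // r /he ->.
- move=> s /andP[s0 sG] E; have [a ha] := el (z + 1 + 0%:Z - 1) s s0; have [b hb] := el (z + 1 + 0%:Z) s s0.
  have [c hc] := el (z + 1 + 0%:Z + 1) s s0.
  rewrite (eu _ _ s0 _ _ _ ha hb hc).
  rewrite (left_lim_eq s0 hb (b' := false)); last first.
    by move=> r /andP[r0 rs]; apply: E; rewrite (ltW r0).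
  rewrite /tasep_update; case: asboolP => //= ep.
  move: sG; rewrite ltNge Gt_rec maxxx => /negP[]; apply: next_le_epoch => //.
  by move: ep; congr (is_epoch _ _ _); lia.
- by rewrite e0 /step; lia.
- by move=> t /andP[t0 _] E; have [e ep he] := er (z + 1 + n.+1%:Z) t t0; exists e => // r /he ->.
- move=> s /andP[s0 sG] E; have [a ha] := el (z + 1 + n.+1%:Z - 1) s s0; have [b hb] := el (z + 1 + n.+1%:Z) s s0.
  have [c hc] := el (z + 1 + n.+1%:Z + 1) s s0.
  rewrite (eu _ _ s0 _ _ _ ha hb hc).
  rewrite (left_lim_eq s0 hb (b' := false)); last first.
    by move=> r /andP[r0 rs]; apply: E; rewrite (ltW r0).
  rewrite /tasep_update; case: asboolP => //= ep.
  have [Gs|sG'] := ltP (Gt y z 0 n 0) s.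
    move: sG; rewrite ltNge Gt_rec max_l ?Gt_ge0// => /negP[]; apply: next_le_epoch => //; first exact: Gt_ge0.
    by move: ep; congr (is_epoch _ _ _); lia.
  apply: (left_lim_eq s0 ha) => r /andP[r0 rs].
  rewrite (_ : z + 1 + n.+1%:Z - 1 = z + 1 + n%:Z); last by lia.
  by apply: IH; rewrite (ltW r0) (lt_le_trans rs).
Qed.

Lemma front_left eta z n t : tasep_from y (step z) eta -> 0 <= t < Gt y z 0 0 n ->
  eta t (z - n%:Z).
Proof.
case=> e0 [er [el eu]]; elim: n t => [|n IH]; apply: real_induction.
- by rewrite e0 /step; lia.
- by move=> t /andP[t0 _] E; have [e ep he] := er (z - 0%:Z) t t0; exists e => // r /he ->.
- move=> s /andP[s0 sG] E; have [a ha] := el (z - 0%:Z - 1) s s0; have [b hb] := el (z - 0%:Z) s s0.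
  have [c hc] := el (z - 0%:Z + 1) s s0.
  rewrite (eu _ _ s0 _ _ _ ha hb hc).
  rewrite (left_lim_eq s0 hb (b' := true)); last first.
    by move=> r /andP[r0 rs]; apply: E; rewrite (ltW r0).
  rewrite /tasep_update; case: (asboolP (is_epoch y (z - 0%:Z) s)) => //= ep.
  move: sG; rewrite ltNge Gt_rec maxxx => /negP[]; apply: next_le_epoch => //.
  by move: ep; congr (is_epoch _ _ _); lia.
- by rewrite e0 /step; lia.
- by move=> t /andP[t0 _] E; have [e ep he] := er (z - n.+1%:Z) t t0; exists e => // r /he ->.
- move=> s /andP[s0 sG] E; have [a ha] := el (z - n.+1%:Z - 1) s s0; have [b hb] := el (z - n.+1%:Z) s s0.
  have [c hc] := el (z - n.+1%:Z + 1) s s0.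
  rewrite (eu _ _ s0 _ _ _ ha hb hc).
  rewrite (left_lim_eq s0 hb (b' := true)); last first.
    by move=> r /andP[r0 rs]; apply: E; rewrite (ltW r0).
  rewrite /tasep_update; case: (asboolP (is_epoch y (z - n.+1%:Z) s)) => //= ep.
  have [Gs|sG'] := ltP (Gt y z 0 0 n) s.
    move: sG; rewrite ltNge Gt_rec max_r ?Gt_ge0// => /negP[]; apply: next_le_epoch => //; first exact: Gt_ge0.
    by move: ep; congr (is_epoch _ _ _); lia.
  rewrite negbK; apply: (left_lim_eq s0 hc) => r /andP[r0 rs].
  rewrite (_ : z - n.+1%:Z + 1 = z - n%:Z); last by lia.
  by apply: IH; rewrite (ltW r0) (lt_le_trans rs).
Qed.

Definition spreading (y : int * nat -> R) := forall (z : int) (t : R),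
  exists n, t < Gt y z 0 n 0 /\ t < Gt y z 0 0 n.
Hypothesis ysp : spreading y.

(** Up to time [t + 1] both processes are frozen outside a finite window by the two fronts. Inside,
    finitely many sites share an interval of right continuity, so agreement propagates by real
    induction; the extra unit of time puts [t] inside the half-open range. *)
Lemma tasep_unique eta xi z t x : tasep_from y (step z) eta -> tasep_from y (step z) xi ->
  0 <= t -> eta t x = xi t x.
Proof.
move=> te tx t0; have [n [n1 n2]] := ysp z (t + 1).
have far s x' : 0 <= s < t + 1 -> x' <= z - n%:Z \/ z + 1 + n%:Z <= x' -> eta s x' = xi s x'.
  move=> /andP[s0 st] [h|h].
    pose m := `|z - x'|%N; have -> : x' = z - m%:Z by rewrite /m; lia.
    have sm : 0 <= s < Gt y z 0 0 m.
      rewrite s0 (lt_trans st)// (lt_le_trans n2)//; apply: Gt_mono => //.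
      by rewrite /m; lia.
    by rewrite (front_left te sm) (front_left tx sm).
  pose m := `|(x' - z - 1)%R|%N; have -> : x' = z + 1 + m%:Z by rewrite /m; lia.
  have sm : 0 <= s < Gt y z 0 m 0.
    rewrite s0 (lt_trans st)// (lt_le_trans n1)//; apply: Gt_mono => //.
    by rewrite /m; lia.
  by rewrite (front_right te sm) (front_right tx sm).
suff : forall x, eta t x = xi t x by [].
case: te tx => ee0 [er [el eu]] [xe0 [xr [xl xu]]].
have : 0 <= t < t + 1 by rewrite t0 ltrDl ltr01.
move: t t0 n1 n2 far {x} => T T0 n1 n2 far.
apply: (@real_induction _ (fun t => forall x, eta t x = xi t x) (T + 1)).
- by move=> x; rewrite ee0 xe0.
- move=> t /andP[t0 tT] E.
  have [e ep he] : exists2 e : R, 0 < e & forall r (k : nat), t <= r < t + e -> (k < n + n)%N ->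
      eta r (z - n%:Z + 1 + k%:Z) = xi r (z - n%:Z + 1 + k%:Z).
    elim: (n + n)%N => [|k [e ep he]]; first by exists 1.
    have [e1 e1p he1] := er (z - n%:Z + 1 + k%:Z) t t0.
    have [e2 e2p he2] := xr (z - n%:Z + 1 + k%:Z) t t0.
    exists (Num.min e (Num.min e1 e2)); first by rewrite !lt_min ep e1p.
    move=> r l; rewrite -ltrBlDl !lt_min !ltrBlDl => /and4P[tr re re1 re2].
    rewrite ltnS leq_eqVlt => /predU1P[->|lk]; last by apply: he; rewrite ?tr.
    by rewrite he1 ?he2 ?tr.
  exists (Num.min e (T + 1 - t)); first by rewrite lt_min ep subr_gt0.
  move=> r; rewrite -ltrBlDl lt_min => /and3P[tr re rT] x.
  have [h|h] := lerP x (z - n%:Z); first by apply: far; [apply/andP; split; lra|left].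
  have [h'|h'] := lerP (z + 1 + n%:Z) x; first by apply: far; [apply/andP; split; lra|right].
  have := he r `|(x - (z - n%:Z + 1))%R|%N; rewrite (_ : z - n%:Z + 1 + _ = x); last by lia.
  by apply; [rewrite tr; lra|lia].
- move=> s /andP[s0 sT] E x.
  have E' x' r : 0 < r < s -> eta r x' = xi r x' by move=> /andP[r0 rs]; apply: E; rewrite (ltW r0).
  have [a ha] := el (x - 1) s s0; have [b hb] := el x s s0; have [c hc] := el (x + 1) s s0.
  rewrite (eu _ _ s0 _ _ _ ha hb hc); apply/esym; apply: xu => //.
  + exact: left_lim_ext (E' _) ha.
  + exact: left_lim_ext (E' _) hb.
  + exact: left_lim_ext (E' _) hc.
Qed.

Definition particle z t x : bool := (H y z 0 t x < H y z 0 t (x - 1))%N.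

Lemma H_right z t x : 0 <= t -> exists2 e : R, 0 < e &
  forall r, t <= r < t + e -> H y z 0 r x = H y z 0 t x.
Proof.
move=> t0; have [i [j [xE ij tG]]] := H_cell y0 yd z t x le00.
exists (Gt y z 0 i j - t); first by rewrite subr_gt0.
move=> r /andP[tr]; rewrite addrC subrK => rG; apply/eqP; rewrite eqn_leq (H_mono y0 yd z x le00 tr) andbT -ij.
exact: H_le.
Qed.

Lemma H_left z s x : 0 < s -> exists2 e : R, 0 < e &
  forall r, 0 < r -> s - e < r < s -> H y z 0 r x = Hm y z 0 s x.
Proof.
move=> s0; have [i [j [xE ij sG]]] := Hm_cell y0 yd z s x le00.
have up r : r < s -> (H y z 0 r x <= Hm y z 0 s x)%N.
  by move=> rs; rewrite -ij; apply: H_le => //; exact: lt_le_trans sG.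
case: (posnP (minn i j)) => [ij0|ij0].
  exists s => // r r0 /andP[_ rs]; apply/eqP; rewrite eqn_leq up//= -ij.
  by apply: leq_trans (H_ge y z 0 r x); rewrite xE; lia.
have G : Gt y z 0 i.-1 j.-1 < s.
  by rewrite HmE// (_ : z + _ - _ = x); [rewrite -ij|]; lia.
exists (s - Gt y z 0 i.-1 j.-1); first by rewrite subr_gt0.
move=> r r0 /andP[]; rewrite opprB addrC subrK => Gr rs.
apply/eqP; rewrite eqn_leq up//= -ij.
have := HE y0 yd z r i.-1 j.-1 le00; rewrite (ltW Gr) (_ : z + _ - _ = x); last by lia.
move=> /esym h.
have [i' [j' [xE' ij' _]]] := H_cell y0 yd z r x le00.
by rewrite -ij' in h *; lia.
Qed.

(** At an epoch of [x] a local minimum becomes a local maximum. All comparisons use left limits,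
    matching the strict inequality in [next], so the formula also covers simultaneous epochs at
    neighbouring sites. *)
Lemma H_jump z s x : 0 < s -> H y z 0 s x =
  (Hm y z 0 s x + (if `[< is_epoch y x s >] && (Hm y z 0 s x < Hm y z 0 s (x - 1))
      && (Hm y z 0 s x < Hm y z 0 s (x + 1)) then 2 else 0))%N.
Proof.
move=> s0; have [i [j [xE ij sG]]] := Hm_cell y0 yd z s x le00.
(* Being lower than the left neighbour means that the left predecessor is filled before [s]. On the
   axis there is none: the default time [0] is before [s], and the wedge makes the comparison
   true. *)
have l1 : (Hm y z 0 s x < Hm y z 0 s (x - 1))%N = ((if i is i'.+1 then Gt y z 0 i' j else 0) < s).
  case: i xE ij sG => [|i] xE ij sG.
    rewrite s0 -ij; have := leq_addr (fillm y z 0 s (x - 1 - z)).*2 `|(x - 1 - z)%R|%N.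
    by rewrite -/(Hm y z 0 s (x - 1)); lia.
  rewrite HmE// (_ : z + i%:Z - j%:Z = x - 1); last by lia.
  have [i' [j' [xE' ij' _]]] := Hm_cell y0 yd z s (x - 1) le00.
  by apply/idP/idP; lia.
have l2 : (Hm y z 0 s x < Hm y z 0 s (x + 1))%N = ((if j is j'.+1 then Gt y z 0 i j' else 0) < s).
  case: j xE ij sG l1 => [|j] xE ij sG _.
    rewrite s0 -ij; have := leq_addr (fillm y z 0 s (x + 1 - z)).*2 `|(x + 1 - z)%R|%N.
    by rewrite -/(Hm y z 0 s (x + 1)); lia.
  rewrite HmE// (_ : z + i%:Z - j%:Z = x + 1); last by lia.
  have [i' [j' [xE' ij' _]]] := Hm_cell y0 yd z s (x + 1) le00.
  by apply/idP/idP; lia.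
have low : (Hm y z 0 s x <= H y z 0 s x)%N.
  have [i' [j' [xE' ij' sG']]] := H_cell y0 yd z s x le00.
  by rewrite -ij'; apply: Hm_le => //; exact: ltW.
have [i' [j' [xE' ij' sG']]] := H_cell y0 yd z s x le00.
have G2 : s < Gt y z 0 i.+1 j.+1.
  by apply: le_lt_trans sG _; apply: lt_trans (Gt_ltl y0 yd z i j le00) _; exact: Gt_ltd.
have up : (H y z 0 s x <= (i.+1 + j.+1))%N by apply: H_le => //; lia.
rewrite -andbA l1 l2 -gt_max.
have S0 : 0 <= Num.max (if i is i'.+1 then Gt y z 0 i' j else 0) (if j is j'.+1 then Gt y z 0 i j' else 0).
  by rewrite le_max; case: (i) => [|k]; rewrite ?lexx// Gt_ge0.
have GE := Gt_rec y z 0 i j; rewrite -xE in GE.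
have HEx : (Gt y z 0 i j <= s) = (i + j < H y z 0 s x)%N by rewrite HE// -xE.
case: ifPn => [/andP[/asboolP ep Ss]|/nandP hn].
  have Gs : Gt y z 0 i j <= s by rewrite GE; exact: next_le_epoch.
  by move: Gs; rewrite HEx -ij' -ij; move: up; rewrite -ij'; lia.
have sG1 : ~~ (Gt y z 0 i j <= s).
  apply/negP => Gs; have GsE : Gt y z 0 i j = s by apply/eqP; rewrite eq_le Gs sG.
  case: hn => [/asboolP[]|]; first by rewrite -GsE xE; exact: Gt_epoch.
  by rewrite -GsE GE next_gt.
by apply/eqP; rewrite addn0 eqn_leq low andbT -ij leqNgt -HEx.
Qed.

Lemma Hm_step z s x : 0 <= s ->
  (Hm y z 0 s (x + 1) = (Hm y z 0 s x).+1 \/ Hm y z 0 s x = (Hm y z 0 s (x + 1)).+1)%N.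
Proof.
move=> s0; have [i [j [xE hE ht]]] := Hm_cell y0 yd z s x le00.
have [i' [j' [xE' hE' ht']]] := Hm_cell y0 yd z s (x + 1) le00.
have h1 : (Hm y z 0 s (x + 1) <= i.+1 + j)%N.
  by apply: Hm_le => //; [lia|exact: le_trans ht (ltW (Gt_ltl y0 yd z _ _ le00))].
have h2 : (Hm y z 0 s x <= i' + j'.+1)%N.
  by apply: Hm_le => //; [lia|exact: le_trans ht' (ltW (Gt_ltd y0 yd z _ _ le00))].
by lia.
Qed.

Lemma particle_tasep z : tasep_from y (step z) (particle z).
Proof.
have lim x s : 0 < s -> left_lim (particle z) x s (Hm y z 0 s x < Hm y z 0 s (x - 1))%N.
  move=> s0; have [e1 e10 h1] := H_left z x s0; have [e2 e20 h2] := H_left z (x - 1) s0.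
  exists (Num.min e1 e2); first by rewrite lt_min e10.
  move=> r r0; rewrite ltrBlDl -ltrBlDr lt_min !ltrBlDr => /andP[/andP[r1 r2] rs].
  by rewrite /particle h1 ?h2// rs ltrBlDl ?r1 ?r2.
split; [|split; [|split]].
- by apply/funext => x; rewrite /particle !H_start// /step; apply/idP/idP; lia.
- move=> x t t0; have [e1 e10 h1] := H_right z x t0; have [e2 e20 h2] := H_right z (x - 1) t0.
  exists (Num.min e1 e2); first by rewrite lt_min e10.
  move=> r; rewrite -ltrBlDl lt_min !ltrBlDl => /and3P[tr r1 r2].
  by rewrite /particle h1 ?h2 ?tr.
- by move=> x s s0; eexists; exact: lim.
- move=> x s s0 a b c ha hb hc.
  have U x' b' : left_lim (particle z) x' s b' -> b' = (Hm y z 0 s x' < Hm y z 0 s (x' - 1))%N.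
    move=> [e e0 he]; have [e' e0' he'] := lim x' s s0.
    pose r := Num.max (s / 2) (s - (Num.min e e') / 2).
    have r0 : 0 < r by rewrite lt_max divr_gt0.
    have m0 : 0 < Num.min e e' by rewrite lt_min e0.
    have rs : r < s by rewrite gt_max; apply/andP; split; lra.
    have re : s - Num.min e e' < r by rewrite lt_max; apply/orP; right; lra.
    rewrite -(he r)// -?(he' r)// rs andbT; apply: le_lt_trans re; rewrite lerB// ge_min lexx ?orbT//.
  rewrite (U _ _ ha) (U _ _ hb) (U _ _ hc) /particle !H_jump// (_ : x - 1 + 1 = x) ?subrK//.
  rewrite (_ : x + 1 - 1 = x) ?addrK//.
  have S1 := Hm_step z (x - 1) (ltW s0); rewrite subrK in S1.
  have S2 := Hm_step z x (ltW s0).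
  have S3 := Hm_step z (x - 1 - 1) (ltW s0); rewrite subrK in S3.
  move: (Hm y z 0 s x) (Hm y z 0 s (x - 1)) (Hm y z 0 s (x + 1)) (Hm y z 0 s (x - 1 - 1)) S1 S2 S3 => A B C D S1 S2 S3.
  move: `[< is_epoch y x s >] `[< is_epoch y (x - 1) s >] => e1 e2.
  clear lim U ha hb hc; rewrite /tasep_update; case: (ltnP A B); case: (ltnP A C); case: (ltnP B D);
    case: (ltnP B A); case: (ltnP C A); case: e1; case: e2 => /=; lia.
Qed.

Lemma tasep_particle z eta t x : tasep_from y (step z) eta -> 0 <= t -> eta t x = particle z t x.
Proof. by move=> te; apply: tasep_unique te (particle_tasep z). Qed.

Lemma H_far z t : 0 <= t -> exists n : nat, forall x, (n <= `|x|)%N -> H y z 0 t x = `|x - z|%N.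
Proof.
move=> t0; have [n [n1 n2]] := ysp z t; exists (n + `|z|)%N => x nx.
apply/eqP; rewrite eqn_leq H_ge andbT; have [zx|xz] := lerP z x.
  rewrite -[X in (_ <= X)%N]addn0; apply: H_le => //; first by lia.
  by apply: lt_le_trans n1 _; apply: Gt_mono => //; lia.
rewrite -[X in (_ <= X)%N]add0n; apply: H_le => //; first by lia.
by apply: lt_le_trans n2 _; apply: Gt_mono => //; lia.
Qed.

(** Away from [X t] the two configurations agree, so the difference of the heights is constant on
    each side of [X t]. Far away the heights are those of the initial wedges, which fixes the
    constants to [1] on the right and [-1] on the left. *)
Lemma second_class eta0 eta1 (X : R -> int) t x :
  tasep_from y eta0_init eta0 -> tasep_from y eta1_init eta1 ->
  (forall t x, 0 <= t -> (eta0 t x != eta1 t x) <-> x = X t) -> 0 <= t ->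
  if X t <= x then H y (-1) 0 t x = (H y 0 0 t x).+1 else (H y (-1) 0 t x).+1 = H y 0 0 t x.
Proof.
move=> te0 te1 hX t0.
have E0 x' : eta0 t x' = particle (-1) t x' by apply: tasep_particle.
have E1 x' : eta1 t x' = particle 0 t x' by apply: tasep_particle.
have st z x' := H_step y0 yd z t x' le00.
have inc x' : X t != x' + 1 -> (H y (-1) 0 t (x' + 1))%:Z - (H y 0 0 t (x' + 1))%:Z =
    (H y (-1) 0 t x')%:Z - (H y 0 0 t x')%:Z.
  move=> nX; have : eta0 t (x' + 1) = eta1 t (x' + 1).
    by apply/eqP; apply: contraNT nX => /(proj1 (hX _ _ t0)) ->.
  rewrite E0 E1 /particle addrK; have := st (-1) x'; have := st 0 x'.
  by move=> h1 h2 h3; case: h1 => h1; case: h2 => h2; move: h3; rewrite h1 h2 ?ltnSn ?ltnNge ?leqnSn //=; lia.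
have [n1 hn1] := H_far (-1) t0; have [n2 hn2] := H_far 0 t0.
have rt (k : nat) : (H y (-1) 0 t (X t + k%:Z))%:Z - (H y 0 0 t (X t + k%:Z))%:Z =
    (H y (-1) 0 t (X t))%:Z - (H y 0 0 t (X t))%:Z.
  elim: k => [|k IH]; first by rewrite addr0.
  by rewrite -IH (_ : X t + k.+1%:Z = X t + k%:Z + 1) ?inc//; lia.
have lt (k : nat) : (H y (-1) 0 t (X t - 1 - k%:Z))%:Z - (H y 0 0 t (X t - 1 - k%:Z))%:Z =
    (H y (-1) 0 t (X t - 1))%:Z - (H y 0 0 t (X t - 1))%:Z.
  elim: k => [|k IH]; first by rewrite subr0.
  by rewrite -IH -[in RHS](_ : X t - 1 - k.+1%:Z + 1 = X t - 1 - k%:Z) ?inc//; lia.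
pose N := (n1 + n2 + `|X t| + 2)%N.
have R1 := rt N; have L1 := lt N.
rewrite (hn1 (X t + N%:Z)) ?(hn2 (X t + N%:Z)) in R1; try by rewrite /N; lia.
rewrite (hn1 (X t - 1 - N%:Z)) ?(hn2 (X t - 1 - N%:Z)) in L1; try by rewrite /N; lia.
have [Xx|xX] := lerP (X t) x.
  have := rt `|x - X t|%N; rewrite (_ : X t + _ = x); last by lia.
  by move: R1; rewrite /N; lia.
have := lt `|(X t - 1 - x)%R|%N; rewrite (_ : X t - 1 - _ = x); last by lia.
by move: L1; rewrite /N; lia.
Qed.

End uniqueness.

Section transfer.
Context {R : realType}.
Variables (y : int * nat -> R).
Hypothesis y0 : forall i, 0 < y i.
Hypothesis yd : divg y.
Variable X : R -> int.
Implicit Types (s t : R) (x z : int).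

(* The second class particle is the place where the two interfaces exchange their order. *)
Definition separates := forall t x, 0 <= t ->
  if X t <= x then H y (-1) 0 t x = (H y 0 0 t x).+1 else (H y (-1) 0 t x).+1 = H y 0 0 t x.
Hypothesis HX : separates.

Let le00 : (0 : R) <= 0. Proof. exact: lexx. Qed.

(** If the minimiser [z] were at [X s] or to its right, the interface from [0] would be one unit
    lower there; following it from [z] would bring it below the interface from [-1] at [x], against
    the order at time [t]. *)
Lemma backward_left s t x : 0 <= s <= t -> x < X t ->
  exists2 z : int, z < X s & (H y (-1) 0 s z + H y z s t x <= H y (-1) 0 t x)%N.
Proof.
move=> /andP[s0 st] xX; have [z hz] := H_comp_ge y0 yd (-1) x le00 s0 st.
exists z => //; rewrite ltNge; apply/negP => Xz.
have := HX z s0; rewrite Xz => E1.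
have := HX x (le_trans s0 st); rewrite leNgt xX /= => E2.
by have := H_comp_le y0 yd 0 t z x le00 s0; move: hz; rewrite -E2 E1; lia.
Qed.

Lemma backward_right s t x : 0 <= s <= t -> X t <= x ->
  exists2 z : int, X s <= z & (H y 0 0 s z + H y z s t x <= H y 0 0 t x)%N.
Proof.
move=> /andP[s0 st] xX; have [z hz] := H_comp_ge y0 yd 0 x le00 s0 st.
exists z => //; rewrite leNgt; apply/negP => Xz.
have := HX z s0; rewrite leNgt Xz /= => E1.
have := HX x (le_trans s0 st); rewrite xX => E2.
by have := H_comp_le y0 yd (-1) t z x le00 s0; move: hz; rewrite E2 -E1; lia.
Qed.

End transfer.

(** * The second class particle between two interfaces *)

Section separation.
Context {R : realType}.
Variables (y : int * nat -> R).
Hypothesis y0 : forall i, 0 < y i.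
Hypothesis yd : divg y.
Hypothesis ysp : spreading y.
Definition apart (y : int * nat -> R) := forall (x : int) s, is_epoch y x s -> is_epoch y (x + 1) s -> False.
Hypothesis yap : apart y.
Implicit Types (s t : R) (x z : int).

Let le00 : (0 : R) <= 0. Proof. exact: lexx. Qed.

Lemma H_parity z s t x : odd (H y z s t x) = odd `|x - z|.
Proof. by rewrite /H oddD odd_double addbF. Qed.

(** Composition at time [0] shows that the heights differ by at most one, the wedges being at
    distance one; parity excludes equality. *)
Lemma H_discrepancy t x :
  H y (-1) 0 t x = (H y 0 0 t x).+1 \/ H y 0 0 t x = (H y (-1) 0 t x).+1.
Proof.
have h1 := H_comp_le y0 yd 0 t (-1) x le00 le00.
have h2 := H_comp_le y0 yd (-1) t 0 x le00 le00.
rewrite (H_start y0 yd 0 (-1) le00 le00) in h1.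
rewrite (H_start y0 yd (-1) 0 le00 le00) in h2.
have p : odd (H y (-1) 0 t x) = ~~ odd (H y 0 0 t x) by rewrite !H_parity; lia.
have : (H y 0 0 t x != H y (-1) 0 t x)%N by apply/eqP => E; move: p; rewrite E; case: odd.
move: h1 h2; move: (H y 0 0 t x) (H y (-1) 0 t x) => a b; clear; lia.
Qed.

Definition ordered t := forall x, H y (-1) 0 t x = (H y 0 0 t x).+1 ->
  H y (-1) 0 t (x + 1) = (H y 0 0 t (x + 1)).+1.

Lemma Hm_limit s x : 0 < s -> exists2 e : R, 0 < e & forall r, 0 < r -> s - e < r < s ->
  H y 0 0 r x = Hm y 0 0 s x /\ H y (-1) 0 r x = Hm y (-1) 0 s x.
Proof.
move=> s0; have [e1 p1 h1] := H_left y0 yd 0 x s0; have [e2 p2 h2] := H_left y0 yd (-1) x s0.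
exists (Num.min e1 e2); first by rewrite lt_min p1.
move=> r r0; rewrite ltrBlDl -ltrBlDr lt_min !ltrBlDr => /andP[/andP[r1 r2] rs].
by rewrite h1 ?h2// rs ltrBlDl ?r1 ?r2.
Qed.

Lemma Hm_discrepancy s x : 0 < s ->
  Hm y (-1) 0 s x = (Hm y 0 0 s x).+1 \/ Hm y 0 0 s x = (Hm y (-1) 0 s x).+1.
Proof.
move=> s0; have [e e0 he] := Hm_limit x s0.
pose r := Num.max (s / 2) (s - e / 2).
have r0 : 0 < r by rewrite lt_max divr_gt0.
have rs : s - e < r < s by rewrite gt_max lt_max; apply/andP; split; [apply/orP; right|apply/andP; split]; lra.
by have [<- <-] := he r r0 rs; exact: H_discrepancy.
Qed.

Lemma Hm_ordered s x : 0 < s -> (forall r, 0 <= r < s -> ordered r) ->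
  Hm y (-1) 0 s x = (Hm y 0 0 s x).+1 -> Hm y (-1) 0 s (x + 1) = (Hm y 0 0 s (x + 1)).+1.
Proof.
move=> s0 hr; have [e1 p1 h1] := Hm_limit x s0; have [e2 p2 h2] := Hm_limit (x + 1) s0.
pose e := Num.min e1 e2; have e0 : 0 < e by rewrite lt_min p1.
have ee1 : e <= e1 by rewrite ge_min lexx.
have ee2 : e <= e2 by rewrite ge_min lexx orbT.
pose r := Num.max (s / 2) (s - e / 2).
have r0 : 0 < r by rewrite lt_max divr_gt0.
have rs : r < s by rewrite gt_max; apply/andP; split; lra.
have re : s - e < r by rewrite lt_max; apply/orP; right; lra.
have [<- <-] := h1 r r0 ltac:(by apply/andP; split; lra).
have [<- <-] := h2 r r0 ltac:(by apply/andP; split; lra).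
by apply: hr; rewrite (ltW r0).
Qed.

Lemma ordered_jump s : 0 < s -> (forall r, 0 <= r < s -> ordered r) -> ordered s.
Proof.
move=> s0 hr x.
have ap : `[< is_epoch y x s >] && `[< is_epoch y (x + 1) s >] = false.
  by apply/negbTE/negP => /andP[/asboolP h1 /asboolP h2]; exact: yap h1 h2.
have o1 := Hm_ordered (x := x) s0 hr; have o0 := Hm_ordered (x := x - 1) s0 hr.
have o2 := Hm_ordered (x := x + 1) s0 hr.
rewrite subrK in o0.
have d0 := Hm_discrepancy (x - 1) s0; have d1 := Hm_discrepancy x s0; have d2 := Hm_discrepancy (x + 1) s0.
have d3 := Hm_discrepancy (x + 1 + 1) s0.
have sa0 := Hm_step y0 yd 0 (x - 1) (ltW s0); have sa1 := Hm_step y0 yd 0 x (ltW s0).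
have sa2 := Hm_step y0 yd 0 (x + 1) (ltW s0).
have sb0 := Hm_step y0 yd (-1) (x - 1) (ltW s0); have sb1 := Hm_step y0 yd (-1) x (ltW s0).
have sb2 := Hm_step y0 yd (-1) (x + 1) (ltW s0).
rewrite subrK in sa0 sb0.
rewrite !(H_jump y0 yd)// addrK.
move: (`[< is_epoch y x s >]) (`[< is_epoch y (x + 1) s >]) ap => e1 e2 ap.
move: (Hm y 0 0 s (x - 1)) (Hm y 0 0 s x) (Hm y 0 0 s (x + 1)) (Hm y 0 0 s (x + 1 + 1))
  (Hm y (-1) 0 s (x - 1)) (Hm y (-1) 0 s x) (Hm y (-1) 0 s (x + 1)) (Hm y (-1) 0 s (x + 1 + 1))
  o1 o0 o2 d0 d1 d2 d3 sa0 sa1 sa2 sb0 sb1 sb2.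
clear -ap => a0 a1 a2 a3 b0 b1 b2 b3 o1 o0 o2 d0 d1 d2 d3 sa0 sa1 sa2 sb0 sb1 sb2.
(* At most one of the two sites rings. Where the interfaces are in the same order at the ringing
   site and on both sides of it, they have equal slopes and jump together; the order before [s]
   forces this in every case that is not immediate. *)
case: e1 ap; case: e2 => //= _.
- case: d2 => [->|E2]; first by [].
  have E1 : a1 = b1.+1 by case: d1 => // /o1; move: E2; clear; lia.
  have E0 : a0 = b0.+1 by case: d0 => // /o0; move: E1; clear; lia.
  by rewrite E0 E1 E2 !ltnS; clear; case: ifP => _; lia.
- rewrite !addn0 => E1; have E2 := o1 E1; have E3 := o2 E2.
  by rewrite E1 E2 E3 !ltnS.
- by rewrite !addn0.
Qed.

Lemma orderedP t : 0 <= t -> ordered t.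
Proof.
move=> t0; have [n1 [n1r n1l]] := ysp 0 (t + 1); have [n2 [n2r n2l]] := ysp (-1) (t + 1).
pose n := (n1 + n2 + 2)%N.
have far r x : 0 <= r < t + 1 -> (n <= `|x|)%N -> H y 0 0 r x = `|x|%N /\ H y (-1) 0 r x = `|(x + 1)%R|%N.
  move=> /andP[r0 rt] nx; split; apply/eqP; rewrite eqn_leq.
    have := H_ge y 0 0 r x; rewrite subr0 => ->; rewrite andbT.
    have [x0|x0] := lerP 0 x.
      rewrite -[X in (_ <= X)%N]addn0; apply: (H_le y0 yd) => //; first by lia.
      apply: lt_trans rt _; apply: lt_le_trans n1r _; apply: (Gt_mono y0 yd) => //.
      by move: nx; rewrite /n; lia.
    rewrite -[X in (_ <= X)%N]add0n; apply: (H_le y0 yd) => //; first by lia.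
    apply: lt_trans rt _; apply: lt_le_trans n1l _; apply: (Gt_mono y0 yd) => //.
    by move: nx; rewrite /n; lia.
  have := H_ge y (-1) 0 r x; rewrite opprK => ->; rewrite andbT.
  have [x0|x0] := lerP 0 x.
    rewrite -[X in (_ <= X)%N]addn0; apply: (H_le y0 yd) => //; first by lia.
    apply: lt_trans rt _; apply: lt_le_trans n2r _; apply: (Gt_mono y0 yd) => //.
    by move: nx; rewrite /n; lia.
  rewrite -[X in (_ <= X)%N]add0n; apply: (H_le y0 yd) => //; first by lia.
  apply: lt_trans rt _; apply: lt_le_trans n2l _; apply: (Gt_mono y0 yd) => //.
  by move: nx; rewrite /n; lia.
have := t0; have : t < t + 1 by lra.
move=> t1 t0'; have : 0 <= t < t + 1 by rewrite t0.
apply: (@real_induction R ordered (t + 1)).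
- move=> x; rewrite !H_start//; lia.
- move=> r /andP[r0 rt] or.
  have [e e0 he] : exists2 e : R, 0 < e & forall r' (k : nat), r <= r' < r + e -> (k < n + n + 3)%N ->
      H y 0 0 r' (k%:Z - n%:Z - 1) = H y 0 0 r (k%:Z - n%:Z - 1) /\
      H y (-1) 0 r' (k%:Z - n%:Z - 1) = H y (-1) 0 r (k%:Z - n%:Z - 1).
    elim: (n + n + 3)%N => [|k [e e0 he]]; first by exists 1.
    have [e1 p1 h1] := H_right y0 yd 0 (k%:Z - n%:Z - 1) r0.
    have [e2 p2 h2] := H_right y0 yd (-1) (k%:Z - n%:Z - 1) r0.
    exists (Num.min e (Num.min e1 e2)); first by rewrite !lt_min e0 p1.
    move=> r' l; rewrite -ltrBlDl !lt_min !ltrBlDl => /and4P[rr q q1 q2].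
    rewrite ltnS leq_eqVlt => /predU1P[->|lk]; last by apply: he; rewrite ?rr.
    by rewrite h1 ?h2 ?rr.
  exists (Num.min e (t + 1 - r)); first by rewrite lt_min e0 subr_gt0.
  move=> r'; rewrite -ltrBlDl lt_min => /and3P[rr q1 q2] x.
  have r'0 : 0 <= r' < t + 1 by apply/andP; split; lra.
  have q1' : r <= r' < r + e by rewrite rr; lra.
  have eqx x' : (`|x'| <= n.+1)%N -> H y 0 0 r' x' = H y 0 0 r x' /\ H y (-1) 0 r' x' = H y (-1) 0 r x'.
    move=> hx; have := he r' `|(x' + n%:Z + 1)%R|%N q1'.
    rewrite (_ : _%:Z - n%:Z - 1 = x'); last by move: hx; clear; lia.
    by apply; move: hx; clear; lia.
  have [xn|xn] := leqP n `|x|; last first.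
    have [-> ->] := eqx x (leq_trans (ltnW xn) (leqnSn _)).
    have [-> ->] := eqx (x + 1) ltac:(by move: xn; clear; lia).
    exact: or.
  have [xn'|xn'] := leqP n `|(x + 1)%R|.
    have [-> ->] := far r' x r'0 xn; have [-> ->] := far r' (x + 1) r'0 xn'.
    by move: xn xn'; rewrite /n; clear; lia.
  have [-> ->] := eqx x ltac:(by move: xn'; clear; lia).
  have [-> ->] := eqx (x + 1) ltac:(by move: xn'; clear; lia).
  exact: or.
- by move=> s /andP[s0 _]; exact: ordered_jump.
Qed.

(** The theorem takes the particle as given, whereas the law of the limit concerns the clocks alone;
    here the position is recovered as the first site where the interface from [-1] is the higher
    one. The window [n] makes the search finite. *)
Lemma separates_exists : exists X, separates y X.
Proof.
have one t : exists X : int, 0 <= t -> forall x,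
    if X <= x then H y (-1) 0 t x = (H y 0 0 t x).+1 else (H y (-1) 0 t x).+1 = H y 0 0 t x.
  have [t0|t0] := lerP 0 t; last by exists 0.
  have [n1 h1] := H_far y0 yd ysp 0 t0; have [n2 h2] := H_far y0 yd ysp (-1) t0.
  pose n := (n1 + n2 + 2)%N.
  pose P (k : nat) := H y (-1) 0 t (k%:Z - n%:Z) == (H y 0 0 t (k%:Z - n%:Z)).+1.
  have Pn : P (n + n)%N.
    rewrite /P (_ : (n + n)%N%:Z - n%:Z = n%:Z); last by lia.
    by rewrite h1 ?h2 /n; lia.
  have [k Pk kmin] := ex_minnP (ex_intro (fun k => is_true (P k)) _ Pn).
  have Pup (a : int) (j : nat) : H y (-1) 0 t a = (H y 0 0 t a).+1 ->
      H y (-1) 0 t (a + j%:Z) = (H y 0 0 t (a + j%:Z)).+1.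
    move=> ha; elim: j => [|j IH]; first by rewrite addr0.
    by rewrite (_ : a + j.+1%:Z = a + j%:Z + 1); [exact: orderedP|lia].
  exists (k%:Z - n%:Z) => _ x; case: ifPn => [kx|kx].
    have := Pup (k%:Z - n%:Z) `|(x - (k%:Z - n%:Z))%R|%N (eqP Pk).
    by rewrite (_ : k%:Z - n%:Z + _ = x)//; lia.
  case: (H_discrepancy t x) => // hx; exfalso.
  have [nx|nx] := lerP (- n%:Z) x.
    have /kmin : P `|(x + n%:Z)%R|%N.
      by rewrite /P (_ : _%:Z - n%:Z = x) ?hx//; lia.
    by move: kx nx; clear; lia.
  have := hx; rewrite h1 ?h2; move: nx; rewrite /n; lia.
have [X hX] := @boolp.choice _ _ _ one.
by exists X => t x t0; exact: hX.
Qed.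

End separation.

Lemma measurable_lpp d (T : measurableType d) (R : realType) (X : nat * nat -> T -> R) s i j :
  (forall k, measurable_fun setT (X k)) ->
  measurable_fun setT (fun w => lpp (fun i j => X (i, j) w) s i j).
Proof.
move=> mX; rewrite /lpp; elim: j i => [|j IHj]; elim=> [|i IHi].
- by apply: measurable_funD.
- by apply: measurable_funD => //; apply: measurable_maxr => //.
- by apply: measurable_funD => //; apply: measurable_maxr => //.
- by apply: measurable_funD => //; apply: measurable_maxr => //.
Qed.

Lemma lpp_start (R : realType) (w : nat -> nat -> R) s i j : (forall i j, 0 < w i j) ->
  lpp w s i j = s + lpp w 0 i j.
Proof.
move=> w0; rewrite /lpp; elim: j i => [|j IHj]; elim=> [|i IHi]; rewrite growE [in RHS]growE /=.
- by rewrite !maxxx add0r.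
- rewrite IHi !max_l ?addrA//; first exact: (ltW (lpp_ge 0 i 0 w0)).
  by rewrite lerDl (ltW (lpp_ge 0 i 0 w0)).
- rewrite IHj !max_r ?addrA//; first exact: (ltW (lpp_ge 0 0 j w0)).
  by rewrite lerDl (ltW (lpp_ge 0 0 j w0)).
- by rewrite IHi IHj -addr_maxr addrA.
Qed.

Lemma lpp_row (R : realType) (w : nat -> nat -> R) n : (forall i j, 0 < w i j) ->
  lpp w 0 n 0 = \sum_(i <- iota 0 n.+1) w i 0%N.
Proof.
move=> w0; elim: n => [|n IH]; first by rewrite /= big_seq1 /lpp growE /= maxxx add0r.
rewrite -[n.+2]addn1 iotaD big_cat -IH big_seq1 add0n /lpp growE /= max_l//.
exact: (ltW (lpp_ge 0 n 0 w0)).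
Qed.

Lemma lpp_col (R : realType) (w : nat -> nat -> R) n : (forall i j, 0 < w i j) ->
  lpp w 0 0 n = \sum_(i <- iota 0 n.+1) w 0%N i.
Proof.
move=> w0; elim: n => [|n IH]; first by rewrite /= big_seq1 /lpp growE /= maxxx add0r.
rewrite -[n.+2]addn1 iotaD big_cat -IH big_seq1 add0n /lpp growE /= max_r//.
exact: (ltW (lpp_ge 0 0 n w0)).
Qed.

(** * Tail bounds for heights *)

Section joint_law.
Context (R : realType) (I : choiceType).

Definition rays : set (set (I -> R)) :=
  [set C | exists s a, uniq s /\ C = [set v | forall j, j \in s -> a j < v j]].

Lemma rays_setI_closed : setI_closed rays.
Proof.
move=> _ _ [s [a [us ->]]] [t [b [ut ->]]].
exists (undup (s ++ t)), (fun j => if j \in s then if j \in t then Num.max (a j) (b j) else a j else b j).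
split; first exact: undup_uniq.
apply/seteqP; split => w /=.
  move=> [h1 h2] j; rewrite mem_undup mem_cat.
  case: ifPn => [js _|js /=]; last exact: h2.
  by case: ifPn => jt; rewrite ?gt_max ?h1 ?h2.
move=> h; split=> j js; have := h j; rewrite mem_undup mem_cat js ?orbT => /(_ isT)//.
  by case: ifPn => // _; rewrite gt_max => /andP[].
by case: ifPn => // _; rewrite gt_max => /andP[].
Qed.

Lemma measurable_coord (i : I) :
  measurable_fun setT ((fun v => v i) : g_sigma_algebraType rays -> measurableTypeR R).
Proof.
apply: (measurability _ (RGenOInfty.measurableE R)) => //.
move=> _ [_ [a ->] <-]; apply: sub_sigma_algebra; exists [:: i], (fun=> a); split=> //.
rewrite setTI; apply/seteqP; split => w /=; rewrite in_itv/= andbT.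
  by move=> h k; rewrite inE => /eqP->.
by apply; rewrite mem_head.
Qed.

Context d (Ω : measurableType d) (Q : probability Ω R).

Lemma indep_exp_law (r : I -> R) (Y Y' : I -> Ω -> R) B :
  indep_exp Q r Y -> indep_exp Q r Y' -> <<s rays >> B ->
  Q [set w | B (Y ^~ w)] = Q [set w | B (Y' ^~ w)].
Proof.
move=> hY hY' sB.
have mF (Z : I -> Ω -> R) : indep_exp Q r Z ->
    measurable_fun setT ((fun w => Z ^~ w) : Ω -> g_sigma_algebraType rays).
  move=> hZ; apply: (@measurability _ _ _ (g_sigma_algebraType rays) setT _ rays) => // _ [_ [s [a [us ->]]] <-].
  by rewrite setTI; exact: (measurable_cylinder hZ).
pose F1 : {mfun Ω >-> g_sigma_algebraType rays} := HB.pack ((fun w => Y ^~ w) : Ω -> g_sigma_algebraType rays) (isMeasurableFun.Build _ _ _ _ _ (mF Y hY)).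
pose F2 : {mfun Ω >-> g_sigma_algebraType rays} := HB.pack ((fun w => Y' ^~ w) : Ω -> g_sigma_algebraType rays) (isMeasurableFun.Build _ _ _ _ _ (mF Y' hY')).
have := @g_sigma_algebra_measure_unique _ R (g_sigma_algebraType rays) rays _ (fun=> setT) _ _
  (pushforward Q F1) (pushforward Q F2) rays_setI_closed.
rewrite /pushforward; apply => //.
- by move=> A rA; exact: sub_sigma_algebra.
- by move=> _; exists [::], (fun=> 0); split => //; apply/seteqP; split.
- by apply/seteqP; split => // w _; exists 0.
- by move=> _ [s [a [us ->]]]; exact: etrans (hY.2 s a us) (esym (hY'.2 s a us)).
- by move=> _; exact: (le_lt_trans (probability_le1 Q measurableT) (ltry 1)).
Qed.

End joint_law.

Lemma lpp_equidistributed d (Ω : measurableType d) (R : realType) (Q : probability Ω R)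
    (X X' : nat * nat -> Ω -> R) t i j :
  indep_exp Q (fun=> 1) X -> indep_exp Q (fun=> 1) X' ->
  Q [set w | t < lpp (fun i j => X (i, j) w) 0 i j] =
  Q [set w | t < lpp (fun i j => X' (i, j) w) 0 i j].
Proof.
move=> hX hX'.
apply: (@indep_exp_law R _ d Ω Q (fun=> 1) X X' [set v | t < lpp (fun i j => v (i, j)) 0 i j]) => //.
have m := @measurable_lpp _ (g_sigma_algebraType (@rays R (nat * nat)%type)) R (fun k v => v k) 0 i j
  (fun k => measurable_coord k).
have := m measurableT _ (measurable_itv `]t, +oo[); rewrite setTI.
congr (measurable _); apply/seteqP; split => v /=; by rewrite in_itv/= andbT.
Qed.

(** [I] and [J] are close to [al ^+ 2 * t] and [be ^+ 2 * t], where the parameters [al] and [be] are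
    optimal. Tilting them by [de] after the exit makes the total smaller by at least [K * de],
    against a curvature loss [t * de ^+ 2 / ga ^+ 2]; the term [de / ga ^+ 2] pays for rounding and
    [6 * u] for fluctuations. *)
Lemma exit_gap (R : realType) (al be de ga I J t k K u : R) :
  0 < ga -> ga <= al - de -> ga <= be -> al + be = 1 -> 0 <= de -> 0 <= t ->
  I <= al ^+ 2 * t + 1 -> be ^+ 2 * t <= J -> K <= k -> 0 <= k ->
  t * de ^+ 2 / ga ^+ 2 + de / ga ^+ 2 + 6 * u < K * de ->
  k / al + (I - k) / (al - de) + J / (be + de) + 4 * u < I / al + J / be - 2 * u.
Proof.
move=> g0 gal gbe ab de0 t0 hI hJ Kk k0 gap.
have al0 : 0 < al by lra.
have al10 : 0 < al - de by lra.
have be0 : 0 < be by lra.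
have be10 : 0 < be + de by lra.
have e1 : (I - k) / (al - de) = (I - k) / al + de * ((I - k) / (al * (al - de))).
  by field; rewrite !gt_eqF.
have e2 : J / (be + de) = J / be - de * (J / (be * (be + de))).
  by field; rewrite !gt_eqF.
have h1 : J / (be * (be + de)) >= be * t / (be + de).
  rewrite (_ : be * t / (be + de) = (be ^+ 2 * t) / (be * (be + de))); last by field; rewrite !gt_eqF.
  by rewrite ler_pM2r// invr_gt0 mulr_gt0.
have h2 : I / (al * (al - de)) <= al * t / (al - de) + 1 / ga ^+ 2.
  apply: (@le_trans _ _ ((al ^+ 2 * t + 1) / (al * (al - de)))).
    by rewrite ler_pM2r// invr_gt0 mulr_gt0.
  rewrite (_ : (al ^+ 2 * t + 1) / (al * (al - de)) = al * t / (al - de) + 1 / (al * (al - de))); last first.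
    by field; rewrite !gt_eqF.
  rewrite lerD2l !div1r lef_pV2 ?posrE ?mulr_gt0 ?exprn_gt0//.
  by rewrite expr2; apply: ler_pM; lra.
have h3 : k / (al * (al - de)) >= k.
  rewrite -{1}[k]mulr1 ler_wpM2l// invr_ge1 ?unitfE ?mulf_neq0 ?gt_eqF ?mulr_gt0//.
  by rewrite -[X in _ <= X]mulr1; apply: ler_pM; lra.
have h4 : al * t / (al - de) - be * t / (be + de) <= t * (de / ga ^+ 2).
  rewrite (_ : al * t / (al - de) - be * t / (be + de) = t * (de * (al + be) / ((al - de) * (be + de)))); last first.
    by field; rewrite !gt_eqF.
  rewrite ler_wpM2l// ab mulr1 ler_wpM2l// lef_pV2 ?posrE ?mulr_gt0 ?exprn_gt0//.
  by rewrite expr2; apply: ler_pM; lra.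
have h5 : de * ((I - k) / (al * (al - de)) - J / (be * (be + de))) <= de * (t * (de / ga ^+ 2) + 1 / ga ^+ 2 - k).
  rewrite ler_wpM2l// mulrBl; lra.
have h6 : de * K <= de * k by rewrite ler_wpM2l.
have e3 : t * de ^+ 2 / ga ^+ 2 + de / ga ^+ 2 = de * (t * (de / ga ^+ 2) + 1 / ga ^+ 2).
  by field; rewrite gt_eqF.
have e4 : (I - k) / al = I / al - k / al by rewrite mulrBl.
rewrite e1 e2 e4; move: h5 gap; rewrite e3.
rewrite !mulrBr !mulrDr; lra.
Qed.

Section height_bounds.
Context d (Ω : measurableType d) (R : realType) (Q : probability Ω R).
Variable (Y : int * nat -> Ω -> R).
Hypothesis hY : indep_exp Q (fun=> 1) Y.
Hypothesis Y0 : forall k w, 0 < Y k w.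
Hypothesis Yd : forall w, divg (Y ^~ w).

Lemma Gt_lpp z s (M : nat) : 0 <= s ->
  exists X : nat * nat -> Ω -> R, [/\ indep_exp Q (fun=> 1) X, (forall k w, 0 < X k w) &
    forall w i j, (i < M)%N -> (j < M)%N ->
      Gt (Y ^~ w) z s i j = s + lpp (fun i j => X (i, j) w) 0 i j].
Proof.
move=> s0; have [Z [hZ Z0 ZE]] := @Gt_law d Ω R Q Y z s M s0 hY Y0 Yd.
exists (fun k => Z (cell z k.1 k.2)); split => //.
- have fg : cancel (fun k : nat * nat => cell z k.1 k.2) (fun k : int * nat => dcell (k.1 - z) k.2).
    by move=> [i j] /=; rewrite (_ : z + i%:Z - j%:Z - z = i%:Z - j%:Z) ?dcellE//; ring.
  exact: (indep_exp_reindex fg hZ).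
- by move=> w i j iM jM; rewrite ZE// lpp_start.
Qed.

Lemma Gt_measurable z s i j : 0 <= s -> measurable_fun setT (fun w => Gt (Y ^~ w) z s i j).
Proof.
move=> s0; have [X [hX X0 XE]] := Gt_lpp z (maxn i j).+1 s0.
rewrite (_ : (fun w => _) = (fun w => s + lpp (fun i j => X (i, j) w) 0 i j)); last first.
  by apply/funext => w; rewrite XE// ltnS; [exact: leq_maxl|exact: leq_maxr].
by apply: measurable_funD => //; apply: measurable_lpp => k; exact: hX.1.
Qed.

(** The two wedges lead to different families of weights; these have the same joint law, hence so do
    the passage times. *)
Lemma Gt_translation z z' t i j :
  Q [set w | t < Gt (Y ^~ w) z 0 i j] = Q [set w | t < Gt (Y ^~ w) z' 0 i j].
Proof.
have [X [hX X0 XE]] := Gt_lpp z (maxn i j).+1 (lexx 0).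
have [X' [hX' X0' XE']] := Gt_lpp z' (maxn i j).+1 (lexx 0).
have im : (i < (maxn i j).+1)%N by rewrite ltnS leq_maxl.
have jm : (j < (maxn i j).+1)%N by rewrite ltnS leq_maxr.
rewrite (_ : [set w | _ < Gt _ z _ _ _] = [set w | t < lpp (fun i j => X (i, j) w) 0 i j]); last first.
  by apply/seteqP; split => w /=; rewrite XE// add0r.
rewrite (_ : [set w | _ < Gt _ z' _ _ _] = [set w | t < lpp (fun i j => X' (i, j) w) 0 i j]); last first.
  by apply/seteqP; split => w /=; rewrite XE'// add0r.
exact: lpp_equidistributed.
Qed.

Lemma sum_spread (I : choiceType) (X : I -> Ω -> R) (f : nat -> I) t n :
  indep_exp Q (fun=> 1) X -> injective f ->
  small Q [set w | \sum_(i <- iota 0 n.+1) X (f i) w <= t] (expR (t / 4 - n.+1%:R / 8)).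
Proof.
move=> hX fi.
have us : uniq [seq f i | i <- iota 0 n.+1] by rewrite map_inj_uniq ?iota_uniq.
(* With [th = 1 / 4] the exponent is [(t - (n + 1)) / 4 + (n + 1) / 8]. *)
have := @chernoff_lower d Ω R Q _ (fun=> 1) X (fun=> ltr01) hX 1 4^-1 (n.+1%:R - t) _ us.
move=> /(_ (fun _ _ => erefl)) /(_ ltr01); rewrite invr_gt0 => /(_ (ltr0Sn _ _)).
rewrite size_map size_iota => hs; apply: small_le (small_sub _ hs).
  by rewrite ler_expR; lra.
by move=> w; rewrite /mkset divr1 big_map => h; apply: le_trans h _; lra.
Qed.

Lemma small_expR_nat (A : nat -> set Ω) (t e : R) : 0 < e ->
  (forall n, small Q (A n) (expR (t / 4 - n.+1%:R / 8))) -> exists n, small Q (A n) e.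
Proof.
move=> e0 h.
have [n hn] : exists n : nat, 8 * (t / 4 - ln e) < n%:R.
  by exists (Num.truncn (8 * (t / 4 - ln e))).+1; rewrite truncnS_gt.
exists n; apply: small_le (h n); rewrite -[leRHS](@lnK _ e) ?posrE// ler_expR.
by rewrite -(natr1 n); lra.
Qed.

Lemma Gt_spread z (t e : R) : 0 < e ->
  (exists n, small Q [set w | Gt (Y ^~ w) z 0 n 0 <= t] e) /\
  (exists n, small Q [set w | Gt (Y ^~ w) z 0 0 n <= t] e).
Proof.
move=> e0; split; apply: (small_expR_nat (t := t) e0) => n; have [X [hX X0 XE]] := Gt_lpp z n.+1 (lexx 0).
  have fi : injective (fun i : nat => (i, 0%N)) by move=> i i' [].
  by apply: small_sub (sum_spread t n hX fi) => w /=; rewrite XE// add0r lpp_row.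
have fi : injective (fun i : nat => (0%N, i)) by move=> i i' [].
by apply: small_sub (sum_spread t n hX fi) => w /=; rewrite XE// add0r lpp_col.
Qed.

Section bounds.
Variables (c th u : R) (N : nat).
Hypothesis c0 : 0 < c.
Hypothesis th0 : 0 < th.
Hypothesis thc : th <= c / 2.
Hypothesis u0 : 0 <= u.
Let err := expR (- (th * u) + 2 * N%:R * (th / c) ^+ 2).

(** The line is the tangent of slope [a] to the parabola [r / 2 + (x - z) ^ 2 / (2 * r)], lowered by
    the fluctuation [3 * u]. *)
Definition above (a : R) (z : int) (s r : R) : set Ω := [set w | forall x : int,
  (1 - a ^+ 2) / 2 * r + a * (x - z)%:~R - 3 * u <= (H (Y ^~ w) z s (s + r) x)%:R].

(** Multiplied by [2 * al * be], with [al = (1 + a) / 2] and [be = (1 - a) / 2], the bound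
    [i / al + j / be] on passage times becomes [i + j - a * (i - j)], height minus slope times
    displacement. Cells with an index beyond [N] satisfy the inequality trivially, so finitely many
    cells control all sites. *)
Lemma H_lower (a : R) z (s r : R) : `|a| <= 1 - 2 * c -> 0 <= s -> 0 <= r -> r <= N%:R ->
  small Q (~` above a z s r) (N.+1%:R ^+ 2 * (3 * err)).
Proof.
move=> ac s0 r0 rN; move: ac; rewrite ler_norml => /andP[ac1 ac2].
pose al : R := (1 + a) / 2; pose be : R := (1 - a) / 2.
have ab : admissible c al be by split; rewrite /al /be; lra.
have al0 : 0 < al by rewrite /al; have := c0; lra.
have be0 : 0 < be by rewrite /be; have := c0; lra.
have [X [hX X0 XE]] := Gt_lpp z N.+1 s0.
have sm : small Q [set w | exists2 i, (i < N.+1)%N & [set w | exists2 j, (j < N.+1)%N &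
    [set w | i%:R / al + j%:R / be + 3 * u < lpp (fun i j => X (i, j) w) 0 i j] w] w]
    (N.+1%:R * (N.+1%:R * (3 * err))).
  apply: small_bigU => i iN; apply: small_bigU => j jN.
  exact: (lpp_upper c0 th0 thc u0 ab hX X0).
rewrite expr2 -mulrA; apply: small_sub sm => w /=; apply: contraPP => hn nab; apply: nab => x.
have [i [j [xE hE ht]]] := H_cell (Y0 ^~ w) (Yd w) z (s + r) x s0.
have key : r < i%:R / al + j%:R / be + 3 * u.
  have [iN|iN] := ltnP i N.+1; last first.
    have : N.+1%:R <= i%:R :> R by rewrite ler_nat.
    have : i%:R <= i%:R / al by rewrite ler_pdivlMr// -[X in _ <= X]mulr1 ler_wpM2l//; rewrite /al; have := c0; lra.
    have : 0 <= j%:R / be by rewrite divr_ge0// ltW.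
    by rewrite -(natr1 N); have := u0; lra.
  have [jN|jN] := ltnP j N.+1; last first.
    have : N.+1%:R <= j%:R :> R by rewrite ler_nat.
    have : j%:R <= j%:R / be by rewrite ler_pdivlMr// -[X in _ <= X]mulr1 ler_wpM2l//; rewrite /be; have := c0; lra.
    have : 0 <= i%:R / al by rewrite divr_ge0// ltW.
    by rewrite -(natr1 N); have := u0; lra.
  move: ht; rewrite XE// ltrD2l => /lt_le_trans; apply; rewrite leNgt; apply/negP => hlt.
  by apply: hn; exists i => //; exists j.
have xR : (x - z)%:~R = i%:R - j%:R :> R
  by rewrite xE (_ : z + i%:Z - j%:Z - z = i%:Z - j%:Z); [rewrite rmorphB /= -!pmulrn|ring].
rewrite -hE natrD xR.
have : 2 * al * be * r < 2 * al * be * (i%:R / al + j%:R / be + 3 * u)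
  by rewrite ltr_pM2l//; apply: mulr_gt0 => //; apply: mulr_gt0.
have -> : 2 * al * be * (i%:R / al + j%:R / be + 3 * u) = i%:R + j%:R - a * (i%:R - j%:R) + 2 * al * be * (3 * u).
  by rewrite /al /be; field; apply/andP; split; apply: lt0r_neq0; [move: be0|move: al0]; rewrite /al /be; lra.
have -> : 2 * al * be = (1 - a ^+ 2) / 2 by rewrite /al /be; field.
have : (1 - a ^+ 2) / 2 * (3 * u) <= 1 * (3 * u).
  by rewrite ler_wpM2r ?mulr_ge0//; have := sqr_ge0 a; lra.
by lra.
Qed.

(** Uses the cell on the diagonal of [x] next to the optimal point for time [t' = t + M]. The extra
    time [M] absorbs the loss [3 * u + K / c] of [lpp_lower], so this cell is still empty at time
    [t]. The factor [1 - 4 * c] leaves room for tilting the parameters by [de] in both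
    directions. *)
Lemma H_upper z (s t M : R) (x : int) (K : nat) (de : R) : 0 <= s -> 0 <= t -> 0 < M -> `|x%:~R| <= (1 - 4 * c) * (t + M) ->
  0 <= de <= c -> t + M + 2 <= N%:R -> (K <= N)%N -> 3 * u + K%:R / c < M ->
  (t + M) * de ^+ 2 / c ^+ 2 + de / c ^+ 2 + 6 * u < K%:R * de ->
  small Q [set w | ((t + M) ^+ 2 + x%:~R ^+ 2) / (2 * (t + M)) + 2 < (H (Y ^~ w) z s (s + t) (z + x))%:R]
    (10 * N.+1%:R * err).
Proof.
move=> s0 t0 M0; set t' := t + M => xt /andP[de0 dec] tN KN KM gap.
have t'0 : 0 < t' by rewrite /t'; lra.
pose v : R := x%:~R / t'; have xE : x%:~R = v * t' by rewrite /v divfK// gt_eqF.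
have vb : `|v| <= 1 - 4 * c by rewrite normrM normfV (gtr0_norm t'0) ler_pdivrMr.
move: vb; rewrite ler_norml => /andP[v1 v2].
pose al : R := (1 + v) / 2; pose be : R := (1 - v) / 2.
have c0' := c0.
have al0 : 0 < al by rewrite /al; lra.
have be0 : 0 < be by rewrite /be; lra.
(* Round [al ^+ 2 * t'] up to [m + 1]; the diagonal then forces [n], and each rounding costs at most
   one. *)
have [m [m1 m2]] : exists m : nat, al ^+ 2 * t' < m.+1%:R /\ m.+1%:R <= al ^+ 2 * t' + 1.
  exists (Num.truncn (al ^+ 2 * t')); split; first by rewrite truncnS_gt.
  by rewrite -natr1 lerD2r truncn_le// mulr_ge0 ?exprn_ge0 ?ltW.
have e1 : al ^+ 2 * t' - be ^+ 2 * t' = x%:~R by rewrite xE /al /be; field.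
have mx : 0 <= m%:Z - x.
  have : (-1)%:~R < (m%:Z - x)%:~R :> R.
    rewrite rmorphB /= -pmulrn mulrN1z -e1; move: m1; rewrite -natr1.
    have : 0 < be ^+ 2 * t' by rewrite mulr_gt0// exprn_gt0.
    by lra.
  by rewrite ltr_int; move: (m%:Z - x) => a; clear; lia.
pose n := `|(m%:Z - x)%R|%N.
have nE : n.+1%:R = m.+1%:R - x%:~R :> R.
  by rewrite -!natr1 [n%:R]pmulrn /n gez0_abs// rmorphB /= -pmulrn; ring.
have n1 : be ^+ 2 * t' < n.+1%:R by rewrite nE -e1; lra.
have n2 : n.+1%:R <= be ^+ 2 * t' + 1 by rewrite nE -e1; lra.
have al1 : al ^+ 2 * t' <= t' by rewrite ger_pMl// expr_le1// /al; lra.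
have be1 : be ^+ 2 * t' <= t' by rewrite ger_pMl// expr_le1// /be; lra.
have mN : (m < N)%N by rewrite -(ltr_nat R); move: m2; rewrite -natr1; lra.
have nN : (n < N)%N by rewrite -(ltr_nat R); move: n2; rewrite -natr1; lra.
have ab : admissible c al be by split; rewrite /al /be; lra.
have ab1 : admissible c (al - de) (be + de) by split; rewrite /al /be; lra.
have ab2 : admissible c (al + de) (be - de) by split; rewrite /al /be; lra.
have [X [hX X0 XE]] := Gt_lpp z N.+1 s0.
have := @lpp_lower d Ω R Q c th u N c0 th0 thc u0 X al be (al - de) (be + de) (al + de) (be - de) K m n
  hX X0 ab ab1 ab2 mN nN KN.
have H1 k : (K <= k <= m.+1)%N -> k%:R / al + (m.+1 - k)%:R / (al - de) + n%:R / (be + de) + 4 * u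
     < m.+1%:R / al + n.+1%:R / be - 2 * u.
  move=> /andP[Kk km]; rewrite natrB//.
  have : n%:R / (be + de) <= n.+1%:R / (be + de).
    by rewrite ler_wpM2r ?ler_nat// invr_ge0; rewrite /be; lra.
  have := @exit_gap R al be de c m.+1%:R n.+1%:R t' k%:R K%:R u.
  move=> /(_ c0); case: ab ab1 => _ cbe abe [cad _ _]; move=> /(_ cad cbe abe de0 (ltW t'0) m2 (ltW n1)).
  by rewrite ler_nat => /(_ Kk (ler0n _ _) gap); lra.
have H2 k : (K <= k <= n.+1)%N -> k%:R / be + m%:R / (al + de) + (n.+1 - k)%:R / (be - de) + 4 * u
     < m.+1%:R / al + n.+1%:R / be - 2 * u.
  move=> /andP[Kk km]; rewrite natrB//.
  have : m%:R / (al + de) <= m.+1%:R / (al + de).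
    by rewrite ler_wpM2r ?ler_nat// invr_ge0; rewrite /al; lra.
  have := @exit_gap R be al de c n.+1%:R m.+1%:R t' k%:R K%:R u.
  move=> /(_ c0); case: ab ab2 => cal _ abe [_ cbd _]; rewrite addrC in abe; move=> /(_ cbd cal abe de0 (ltW t'0) n2 (ltW m1)).
  by rewrite ler_nat => /(_ Kk (ler0n _ _) gap); lra.
move=> /(_ H1 H2); apply: small_sub => w /=; apply: contraPP => /negP; rewrite -leNgt => hG; apply/negP; rewrite -leNgt.
have tI : t' <= m.+1%:R / al + n.+1%:R / be.
  have : al * t' <= m.+1%:R / al by rewrite ler_pdivlMr// mulrAC -expr2 ltW.
  have : be * t' <= n.+1%:R / be by rewrite ler_pdivlMr// mulrAC -expr2 ltW.
  have : al * t' + be * t' = t' by rewrite -mulrDl /al /be; field.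
  by lra.
have hlt : s + t < Gt (Y ^~ w) z s m.+1 n.+1.
  by rewrite XE ?ltnS// ltrD2l; move: hG KM tI; rewrite /t'; lra.
have zE : z + x = z + m.+1%:Z - n.+1%:Z.
  have : n%:Z = m%:Z - x by rewrite /n gez0_abs.
  by move: (n) => n'; clear; lia.
have := H_le (Y0 ^~ w) (Yd w) s0 zE hlt; rewrite -(ler_nat R) natrD => /le_trans; apply.
have -> : (t' ^+ 2 + x%:~R ^+ 2) / (2 * t') = al ^+ 2 * t' + be ^+ 2 * t'.
  by rewrite xE /al /be; field; rewrite gt_eqF.
by lra.
Qed.

End bounds.
End height_bounds.

(** Strict convexity in linear form: tangents of slope [x / n + d] up to time [s] and [x / n - d]
    afterwards add up to the parabola, minus [d ^+ 2 * n / 2], plus [2 * d] times the deviation of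
    [z] from the straight line. For a deviation [ep] the best choice is [d = 2 * ep / n], with gain
    [2 * ep ^+ 2 / n]. *)
Lemma tilt_identity (R : realType) (n s x z d : R) : n != 0 ->
  (1 - (x / n + d) ^+ 2) / 2 * s + (x / n + d) * z +
  ((1 - (x / n - d) ^+ 2) / 2 * (n - s) + (x / n - d) * (x - z)) =
  n / 2 + x ^+ 2 / (2 * n) - d ^+ 2 * n / 2 + 2 * (d * (z - x / n * s)).
Proof. by move=> n0; field. Qed.

Lemma parab_shift (R : realType) (t M x : R) : 0 < t -> 0 <= M ->
  ((t + M) ^+ 2 + x ^+ 2) / (2 * (t + M)) <= (t + M) / 2 + x ^+ 2 / (2 * t).
Proof.
move=> t0 M0; have tM : 0 < t + M by lra.
have -> : ((t + M) ^+ 2 + x ^+ 2) / (2 * (t + M)) = (t + M) / 2 + x ^+ 2 / (2 * (t + M)).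
  by field; rewrite gt_eqF.
by rewrite lerD2l ler_wpM2l ?sqr_ge0// lef_pV2 ?posrE; lra.
Qed.

Lemma leq_chain a a' b b' c c' e : (a <= a'.+1)%N -> (b <= b')%N -> (a' + b' <= c')%N ->
  (c' <= e.+1)%N -> (e <= c)%N -> (a + b <= c + 2)%N.
Proof. lia. Qed.

(** * Straightness of the backward paths *)

Section one_scale.
Context d (Ω : measurableType d) (R : realType) (Q : probability Ω R).
Variable (Y : int * nat -> Ω -> R).
Hypothesis hY : indep_exp Q (fun=> 1) Y.
Hypothesis Y0 : forall k w, 0 < Y k w.
Hypothesis Yd : forall w, divg (Y ^~ w).
Variables (c th u s de M ep : R) (K N NB : nat).

(** [th] and [u] are the Chernoff parameters; [de], [K] and [M] those of [H_upper]. The decisive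
    condition compares [(M + 2 + 6 * u) * NB] with [2 * ep ^+ 2]: the total error on heights stays
    below the gain produced by a deviation [ep]. *)
Definition scale_ok := [/\ 0 < th, th <= c / 2, 0 <= u, 0 <= de <= c & [/\
  (K <= N)%N, 3 * u + K%:R / c < M, 5 <= M, NB%:R + 1 + M + 2 <= N%:R & [/\
  N%:R * de ^+ 2 / c ^+ 2 + de / c ^+ 2 + 6 * u < K%:R * de, 1 <= s, 2 * ep / s <= c,
  (M + 2 + 6 * u) * NB%:R < 2 * ep ^+ 2 & 2 / s <= c /\ 2 <= ep ]]].

Hypothesis c0 : 0 < c.
Hypothesis c8 : 8 * c <= 1.
Hypothesis ok : scale_ok.
Let err := expR (- (th * u) + 2 * N%:R * (th / c) ^+ 2).

Definition valid (n : nat) (x : int) := [/\ (n <= NB)%N, s <= n%:R & `|x%:~R| <= (1 - 8 * c) * n%:R].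

(** The upper bound is taken at time [n + 1] because a real time is bracketed by consecutive
    integers. Both signs of the tilt on both time intervals allow deviations of either sign to be
    refuted. *)
Definition good_at (n : nat) (x z : int) : set Ω := [set w |
  [/\ (H (Y ^~ w) 0 0 (n%:R + 1) x)%:R <= n%:R / 2 + x%:~R ^+ 2 / (2 * n%:R) + M,
     above Y u (x%:~R / n%:R + 2 * ep / n%:R) 0 0 s w,
     above Y u (x%:~R / n%:R - 2 * ep / n%:R) 0 0 s w,
     above Y u (x%:~R / n%:R - 2 * ep / n%:R) z s (n%:R - s) w &
     above Y u (x%:~R / n%:R + 2 * ep / n%:R) z s (n%:R - s) w]].

Definition good : set Ω := [set w | forall n x z, valid n x -> (`|z| <= N)%N -> good_at n x z w].

Let sp : 0 < s. Proof. by case: ok => _ _ _ _ [_ _ _ _ [_ s1 _ _ _]]; exact: lt_le_trans s1. Qed.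

Lemma good_at_small n x z : valid n x ->
  small Q (~` good_at n x z) (10 * N.+1%:R * err + 4 * (N.+1%:R ^+ 2 * (3 * err))).
Proof.
move=> [nN sn xn]; case: ok => th0 thc u0 /andP[de0 dec] [KN KM M5 hN [gap s1 epc str [sc e2]]].
have n0 : 0 < n%:R :> R by exact: lt_le_trans sn.
have nN' : n%:R <= NB%:R :> R by rewrite ler_nat.
have v8 : `|x%:~R / n%:R| <= 1 - 8 * c by rewrite normrM normfV (gtr0_norm n0) ler_pdivrMr.
have d0 : 0 <= 2 * ep / n%:R by rewrite divr_ge0// ?mulr_ge0//; lra.
have dc : 2 * ep / n%:R <= c.
  by apply: le_trans epc; rewrite ler_wpM2l ?lef_pV2 ?posrE//; lra.
have a1 : `|x%:~R / n%:R + 2 * ep / n%:R| <= 1 - 2 * c.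
  by apply: le_trans (ler_normD _ _) _; rewrite (ger0_norm d0); have := c0; lra.
have a2 : `|x%:~R / n%:R - 2 * ep / n%:R| <= 1 - 2 * c.
  by apply: le_trans (ler_normB _ _) _; rewrite (ger0_norm d0); have := c0; lra.
have sN : s <= N%:R by lra.
have nsN : n%:R - s <= N%:R by have := sp; lra.
have ns0 : 0 <= n%:R - s by lra.
have s0 := ltW sp.
have B1 := H_lower hY Y0 Yd c0 th0 thc u0 0 a1 (lexx 0) s0 sN.
have B2 := H_lower hY Y0 Yd c0 th0 thc u0 0 a2 (lexx 0) s0 sN.
have B3 := H_lower hY Y0 Yd c0 th0 thc u0 z a2 s0 ns0 nsN.
have B4 := H_lower hY Y0 Yd c0 th0 thc u0 z a1 s0 ns0 nsN.
have t0 : 0 <= n%:R + 1 :> R by lra.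
have M0 : 0 < M by lra.
have xt : `|x%:~R| <= (1 - 4 * c) * (n%:R + 1 + M).
  by apply: le_trans xn _; apply: ler_pM => //; have := c0; have := c8; lra.
have tN : n%:R + 1 + M + 2 <= N%:R by lra.
have gap' : (n%:R + 1 + M) * de ^+ 2 / c ^+ 2 + de / c ^+ 2 + 6 * u < K%:R * de.
  apply: le_lt_trans gap; rewrite !lerD2r -!mulrA ler_wpM2r//; last by lra.
  by rewrite mulr_ge0// divr_ge0// exprn_ge0// ltW.
have B0 := H_upper hY Y0 Yd c0 th0 thc u0 0 (lexx 0) t0 M0 xt (introT andP (conj de0 dec)) tN KN KM gap'.
apply: small_le (small_sub _ (smallU B0 (smallU (smallU B1 B2) (smallU B3 B4)))); first by rewrite /err; lra.
move=> w; apply: contraPP => /not_orP[h0 /not_orP[/not_orP[h1 h2] /not_orP[h3 h4]]]; apply: contrapT.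
move=> /contrapT; apply; split; [|exact: contrapT|exact: contrapT|exact: contrapT|exact: contrapT].
move: h0 => /= /negP; rewrite -leNgt !add0r => /le_trans; apply.
have := @parab_shift R n%:R (1 + M) x%:~R n0 ltac:(lra); rewrite addrA.
by lra.
Qed.

Lemma good_small : small Q (~` good) (NB.+1%:R * (N.+1.*2%:R * (N.+1.*2%:R *
  (10 * N.+1%:R * err + 4 * (N.+1%:R ^+ 2 * (3 * err)))))).
Proof.
set e := 10 * _ * _ + _.
have e0 : 0 <= e by rewrite /e addr_ge0// !mulr_ge0// ?exprn_ge0 ?expR_ge0.
have sm : small Q [set w | exists2 n, (n < NB.+1)%N & [set w | exists2 i, (i < N.+1.*2)%N &
   [set w | exists2 j, (j < N.+1.*2)%N &
     [set w | valid n (i%:Z - N%:Z) /\ ~ good_at n (i%:Z - N%:Z) (j%:Z - N%:Z) w] w] w] w]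
   (NB.+1%:R * (N.+1.*2%:R * (N.+1.*2%:R * e))).
  apply: small_bigU => n _; apply: small_bigU => i _; apply: small_bigU => j _.
  have [v|nv] := pselect (valid n (i%:Z - N%:Z)).
    by apply: small_sub (good_at_small (j%:Z - N%:Z) v) => w [].
  apply: (@small_sub _ _ _ _ _ set0); first by move=> w [].
  by apply: small_measurable => //; rewrite measure0 lee_fin.
apply: small_sub sm => w; apply: contraPP => hn; apply: contrapT => /contrapT; apply.
move=> n x z v zN; apply: contrapT => ng; apply: hn; have [nN sn xn] := v.
have [_ _ _ _ [_ _ M5 hN _]] := ok.
have xN : (`|x| <= N)%N.
  have n0 : 0 <= n%:R :> R by [].
  have : `|x%:~R| <= NB%:R :> R.
    apply: le_trans xn _; apply: (@le_trans _ _ n%:R); last by rewrite ler_nat.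
    by rewrite ger_pMl ?(lt_le_trans sp)//; have := c0; lra.
  rewrite -(ler_nat R) natr_absz intr_norm; lra.
exists n => //; exists `|(x + N%:Z)%R|%N; first by move: xN; clear; lia.
exists `|(z + N%:Z)%R|%N; first by move: zN; clear; lia.
rewrite /= (_ : `|(x + N%:Z)%R|%:Z - N%:Z = x); last by move: xN; clear; lia.
by rewrite (_ : `|(z + N%:Z)%R|%:Z - N%:Z = z); last by move: zN; clear; lia.
Qed.

Section path.
Variables (w : Ω) (X : R -> int).
Hypothesis gw : good w.
Hypothesis HX : separates (Y ^~ w) X.

Let y0 := Y0 ^~ w.
Let le00 : (0 : R) <= 0. Proof. exact: lexx. Qed.

Lemma good_contra (n : nat) (x z : int) : valid n x ->
  ep <= z%:~R - x%:~R / n%:R * s \/ z%:~R - x%:~R / n%:R * s <= - ep ->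
  ~ ((H (Y ^~ w) 0 0 s z + H (Y ^~ w) z s n%:R x <= H (Y ^~ w) 0 0 (n%:R + 1) x + 2)%N).
Proof.
move=> v side hH; have [nN sn xn] := v; have [_ _ u0 _ [_ _ M5 hN [_ s1 _ str [_ e2]]]] := ok.
have n0 : 0 < n%:R :> R by apply: lt_le_trans sn; exact: sp.
have hHR : (H (Y ^~ w) 0 0 s z)%:R + (H (Y ^~ w) z s n%:R x)%:R <= (H (Y ^~ w) 0 0 (n%:R + 1) x)%:R + 2 :> R.
  by rewrite -!natrD ler_nat.
have nNB : n%:R <= NB%:R :> R by rewrite ler_nat.
have x2 : x%:~R ^+ 2 / (2 * n%:R) <= n%:R / 2 :> R.
  rewrite ler_pdivrMr ?mulr_gt0// (_ : n%:R / 2 * (2 * n%:R) = n%:R ^+ 2); last by field.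
  rewrite -(real_normK (num_real x%:~R)) lerXn2r ?nnegrE//.
  by apply: le_trans xn _; rewrite ger_pMl//; have := c0; lra.
(* [good] covers only [z] in the window; its instance [z = 0] already bounds the height at [x],
   hence the height at [z], hence [z] itself. *)
have zN : (`|z| <= N)%N.
  have h0 := gw v (z := 0) (leq0n _); case: h0 => ub _ _ _ _.
  have : (`|z|%N%:R : R) <= (H (Y ^~ w) 0 0 s z)%:R.
    by rewrite ler_nat; have := H_ge (Y ^~ w) 0 0 s z; rewrite subr0.
  rewrite -(ler_nat R); have : 0 <= (H (Y ^~ w) z s n%:R x)%:R :> R by [].
  by lra.
have [ub A1 A2 A3 A4] := gw v zN.
have E1 := tilt_identity s x%:~R z%:~R (2 * ep / n%:R) (lt0r_neq0 n0).
have E2 := tilt_identity s x%:~R z%:~R (- (2 * ep / n%:R)) (lt0r_neq0 n0).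
have dn : (2 * ep / n%:R) ^+ 2 * n%:R / 2 = 2 * ep ^+ 2 / n%:R by field; rewrite gt_eqF.
have str' : M + 2 + 6 * u < 2 * ep ^+ 2 / n%:R.
  rewrite ltr_pdivlMr//; apply: le_lt_trans str; rewrite ler_wpM2l//; lra.
have d0 : 0 <= 2 * ep / n%:R by rewrite divr_ge0// ?mulr_ge0//; lra.
have := A1 z; have := A2 z; have := A3 x; have := A4 x.
rewrite add0r subr0 (addrC s) subrK rmorphB /=.
case: side => hs h4 h3 h2 h1.
  have : 2 * ep / n%:R * ep <= 2 * ep / n%:R * (z%:~R - x%:~R / n%:R * s) by rewrite ler_wpM2l.
  have -> : 2 * ep / n%:R * ep = 2 * ep ^+ 2 / n%:R by field; rewrite gt_eqF.
  by move: E1; rewrite dn; lra.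
have : 2 * ep / n%:R * ep <= 2 * ep / n%:R * - (z%:~R - x%:~R / n%:R * s).
  by rewrite ler_wpM2l//; lra.
have -> : 2 * ep / n%:R * ep = 2 * ep ^+ 2 / n%:R by field; rewrite gt_eqF.
by move: E2; rewrite opprK sqrrN dn; lra.
Qed.

(** Left of the particle the backward path comes from the wedge at [-1]; exchanging it for the wedge
    at [0] costs one unit at time [s] and one at time [T], the [2] allowed in [good_contra]. The
    path stays left of [X s], so its straightness bounds [X s] from below. *)
Lemma straight_left (n : nat) (T : R) x : valid n x -> n%:R <= T < n%:R + 1 -> x < X T ->
  x%:~R / n%:R * s - ep < (X s)%:~R.
Proof.
move=> v /andP[nT Tn] xX; have [nN sn xn] := v; have s0 := ltW sp.
have sT : 0 <= s <= T by rewrite s0 (le_trans sn).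
have [z zX hz] := backward_left y0 (Yd w) HX sT xX.
rewrite ltNge; apply/negP => Xs; apply: (@good_contra n x z v).
  right; have : z%:~R < (X s)%:~R :> R by rewrite ltr_int.
  by move: Xs; lra.
have h1 := HX z s0; have h2 := HX x (le_trans s0 (le_trans sn nT)).
have m1 := H_mono y0 (Yd w) z x s0 nT.
have m2 := H_mono y0 (Yd w) 0 x le00 (ltW Tn).
have g1 : (H (Y ^~ w) 0 0 s z <= (H (Y ^~ w) (-1) 0 s z).+1)%N by case: ifP h1 => _; clear; lia.
have g2 : (H (Y ^~ w) (-1) 0 T x <= (H (Y ^~ w) 0 0 T x).+1)%N by case: ifP h2 => _; clear; lia.
exact: leq_chain g1 m1 hz g2 m2.
Qed.

Lemma straight_right (n : nat) (T : R) x : valid n x -> n%:R <= T < n%:R + 1 -> X T <= x ->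
  (X s)%:~R < x%:~R / n%:R * s + ep.
Proof.
move=> v /andP[nT Tn] xX; have [nN sn xn] := v; have s0 := ltW sp.
have sT : 0 <= s <= T by rewrite s0 (le_trans sn).
have [z zX hz] := backward_right y0 (Yd w) HX sT xX.
rewrite ltNge; apply/negP => Xs; apply: (@good_contra n x z v).
  left; have : (X s)%:~R <= z%:~R :> R by rewrite ler_int.
  by move: Xs; lra.
have m1 := H_mono y0 (Yd w) z x s0 nT.
have m2 := H_mono y0 (Yd w) 0 x le00 (ltW Tn).
exact: leq_chain (leqnSn _) m1 hz (leqnSn _) m2.
Qed.

(** Replacing [v * T] by a neighbouring integer and [T] by its integer part changes the slope by at
    most [2 / s]; as [2 <= ep], this and [ep / s] fit into [2 * ep / s]. *)
Lemma speed_step (T v : R) : 0 <= T -> s <= (Num.truncn T)%:R -> T < NB%:R + 1 -> `|v| <= 1 - 9 * c ->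
  (v * T < (X T)%:~R -> v - 2 * ep / s < (X s)%:~R / s) /\
  ((X T)%:~R <= v * T -> (X s)%:~R / s < v + 2 * ep / s).
Proof.
move=> T0 sT TN v9; have [_ _ _ _ [_ _ _ _ [_ s1 _ _ [sc e2]]]] := ok; have s0 := sp.
set n := Num.truncn T in sT.
have /andP[nT Tn] := truncn_itv T0; rewrite -/n -natr1 in nT Tn.
have nN : (n <= NB)%N by rewrite -ltnS -(ltr_nat R) -natr1; lra.
have n0 : 0 < n%:R :> R by exact: lt_le_trans sT.
have n0' : n%:R != 0 :> R by rewrite gt_eqF.
have n2 : 2 / n%:R <= 2 / s by rewrite ler_pM2l// lef_pV2 ?posrE.
have vT : `|v * (T - n%:R)| <= 1.
  rewrite normrM -[leRHS]mulr1; apply: ler_pM => //; first by have := c0; lra.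
  by rewrite ger0_norm; lra.
move: vT; rewrite ler_norml => /andP[vT1 vT2].
have near (x : int) : `|x%:~R - v * T| <= 1 -> valid n x /\ `|x%:~R / n%:R - v| <= 2 / n%:R.
  rewrite ler_norml => /andP[x1 x2].
  have hv : `|x%:~R / n%:R - v| <= 2 / n%:R.
    rewrite (_ : x%:~R / n%:R - v = (x%:~R - v * n%:R) / n%:R); last by field.
    by rewrite normrM normfV (gtr0_norm n0) ler_pM2r ?invr_gt0// ler_norml; lra.
  split => //; split => //.
  rewrite -ler_pdivrMr// -[X in _ / X](gtr0_norm n0) -normfV -normrM.
  rewrite -(subrK v (_ / _)); apply: le_trans (ler_normD _ _) _.
  by have := c0; lra.
have es : 2 / s + ep / s <= 2 * ep / s by rewrite -mulrDl ler_pM2r ?invr_gt0//; lra.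
have div1 (a : R) : a * s / s = a by rewrite mulfK// gt_eqF.
split => [h|h].
- have [] := near (Num.floor (v * T)).
    by rewrite ler_norml; have := floor_le (v * T); have := floorD1_gt (v * T); rewrite intrD; lra.
  move=> va; rewrite ler_norml => /andP[hx _].
  have := @straight_left n T _ va (introT andP (conj nT Tn)).
  have -> : Num.floor (v * T) < X T.
    by rewrite -(ltr_int R); apply: le_lt_trans h; exact: floor_le.
  move=> /(_ isT) hs; have : (Num.floor (v * T))%:~R / n%:R - ep / s < (X s)%:~R / s.
    by rewrite ltr_pdivlMr// mulrBl divfK// gt_eqF.
  by lra.
- have [] := near (Num.floor (v * T) + 1).
    by rewrite ler_norml intrD; have := floor_le (v * T); have := floorD1_gt (v * T); rewrite intrD; lra.
  move=> va; rewrite ler_norml => /andP[_ hx].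
  have := @straight_right n T _ va (introT andP (conj nT Tn)).
  have -> : X T <= Num.floor (v * T) + 1.
    by rewrite -(ler_int R); apply: le_trans h _; apply: ltW; exact: floorD1_gt.
  move=> /(_ isT) hs; have : (X s)%:~R / s < (Num.floor (v * T) + 1)%:~R / n%:R + ep / s.
    by rewrite ltr_pdivrMr// mulrDl divfK// gt_eqF.
  by lra.
Qed.

End path.
End one_scale.

(** * Choice of parameters along polynomial scales *)

Section scales.
Context (R : realType).
Implicit Types (c : R) (k : nat).

(* Any sufficiently spread exponents would do; with [k] the scale, times are of
   order [k ^ 64], fluctuations of heights at most [k ^ 55] and deviations of
   the backward paths at most [k ^ 61]. *)
Definition tm k : R := k%:R ^+ 64.
Definition errk c k : R := expR (- ((k%:R ^+ 35)^-1 * k%:R ^+ 37) +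
  2 * (k ^ 67)%N%:R * ((k%:R ^+ 35)^-1 / c) ^+ 2).
Definition ok_at c k := scale_ok c (k%:R ^+ 35)^-1 (k%:R ^+ 37) (tm k) (k%:R ^+ 16)^-1
  (k%:R ^+ 55) (k%:R ^+ 61) (k ^ 54) (k ^ 67) (k ^ 66).
Definition bad_at c k : R := (k ^ 66)%N.+1%:R * ((k ^ 67)%N.+1.*2%:R * ((k ^ 67)%N.+1.*2%:R *
  (10 * (k ^ 67)%N.+1%:R * errk c k + 4 * ((k ^ 67)%N.+1%:R ^+ 2 * (3 * errk c k))))).

(** [2 ^+ 32] makes [(2 * k) ^ 64 <= k ^ 66], so that the range [k ^ 66] reaches the next scale;
    [10 / c ^+ 2] lets one factor [k] absorb the constants depending on [c]. *)
Definition threshold c : R := 2 ^+ 32 + 10 / c ^+ 2.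

Lemma scale_okP c k : 0 < c -> 8 * c <= 1 -> threshold c <= k%:R -> ok_at c k.
Proof.
move=> c0 c8; rewrite /threshold => hk; set x : R := k%:R in hk *.
have c2 : 0 < c ^+ 2 by rewrite exprn_gt0.
have ic0 : 0 < 1 / c ^+ 2 by rewrite divr_gt0.
have p32 : 10 <= 2 ^+ 32 :> R.
  by apply: (@le_trans _ _ (2 ^+ 4)); [lra|rewrite ler_weXn2l//; lra].
have x1 : 1 <= x by lra.
have x10 : 10 <= x by lra.
have x0 : 0 < x by lra.
have xc2 : 1 / c ^+ 2 <= x / 10 by lra.
have cc2 : 1 / c <= 1 / c ^+ 2 by rewrite ler_pM2l// lef_pV2 ?posrE// expr2 ler_piMl//; lra.
have ic8 : 8 <= 1 / c by rewrite ler_pdivlMr//; lra.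
have xc : x^-1 <= c / 10.
  rewrite -[leRHS]invrK lef_pV2 ?posrE ?invr_gt0 ?divr_gt0// invf_div.
  by have -> : 10 / c = 10 * (1 / c) by [rewrite mul1r]; lra.
have pw (a b : nat) : (a <= b)%N -> x ^+ a <= x ^+ b by move=> ab; rewrite ler_weXn2l.
have pw1 (a : nat) : 1 <= x ^+ a by rewrite exprn_ege1.
have pS (a : nat) : x ^+ a.+1 = x * x ^+ a by rewrite exprS.
have p0 (a : nat) : 0 < x ^+ a by rewrite exprn_gt0.
have iv (a : nat) : (x ^+ a.+1)^-1 <= c / 10.
  by apply: le_trans xc; rewrite lef_pV2 ?posrE// -{1}[x]expr1 pw.
have iv1 (a b : nat) : (a <= b)%N -> x ^+ b * (x ^+ a)^-1 = x ^+ (b - a).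
  by move=> ab; rewrite expfB_cond// -?exprB ?unitfE ?gt_eqF//.
rewrite /ok_at /scale_ok /tm -/x !natrX -/x; split.
- by rewrite invr_gt0.
- by have := iv 34; lra.
- exact: ltW.
- by rewrite invr_ge0 ltW//=; have := iv 15; lra.
split.
- by rewrite leq_exp2l// -(ltr_nat R); lra.
- have := pw 37 54 isT; have : x ^+ 54 / c <= x ^+ 54 * (x / 10).
    by rewrite ler_pM2l//; rewrite -[c^-1]mul1r; lra.
  by rewrite [x ^+ 55]pS; have : 10 * x ^+ 54 <= x * x ^+ 54 by [rewrite ler_pM2r]; have := p0 54; lra.
- by have := pw 1%N 55 isT; rewrite expr1; lra.
- have := pw 55 66 isT; have := pw 1%N 66 isT; rewrite [x ^+ 67]pS expr1.
  by have : 10 * x ^+ 66 <= x * x ^+ 66 by [rewrite ler_pM2r]; lra.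
split.
- have h1 : x ^+ 67 * (x ^+ 16)^-1 ^+ 2 / c ^+ 2 <= x ^+ 36 / 10.
    have -> : x ^+ 67 * (x ^+ 16)^-1 ^+ 2 = x ^+ 35.
      by rewrite -exprVn -exprM exprVn iv1.
    by rewrite [x ^+ 36]pS; have : x ^+ 35 * (1 / c ^+ 2) <= x ^+ 35 * (x / 10) by [rewrite ler_pM2l]; lra.
  have h2 : (x ^+ 16)^-1 / c ^+ 2 <= x / 10.
    have : (x ^+ 16)^-1 * (1 / c ^+ 2) <= 1 * (1 / c ^+ 2) by rewrite ler_pM2r// invf_le1.
    by lra.
  have := pw 36 37 isT; have := pw 1%N 37 isT; rewrite expr1.
  have -> : x ^+ 54 * (x ^+ 16)^-1 = x * x ^+ 37 by rewrite iv1// -pS.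
  by have : 10 * x ^+ 37 <= x * x ^+ 37 by [rewrite ler_pM2r]; have := p0 37; lra.
- exact: pw1.
- have -> : 2 * x ^+ 61 / x ^+ 64 = 2 * (x ^+ 3)^-1.
    by field; rewrite gt_eqF.
  by have := iv 2; have := c0; lra.
- have -> : 2 * (x ^+ 61) ^+ 2 = 2 * (x * x ^+ 121) by rewrite -exprM -pS.
  have : (x ^+ 55 + 2 + 6 * x ^+ 37) * x ^+ 66 <= 9 * x ^+ 55 * x ^+ 66.
    by rewrite ler_pM2r//; have := pw 37 55 isT; have := pw1 55%N; lra.
  rewrite -mulrA -exprD; have : 10 * x ^+ 121 <= x * x ^+ 121 by rewrite ler_pM2r.
  by have := p0 121; lra.
- split; last by have := pw 1%N 61 isT; rewrite expr1; lra.
  by have := iv 63; have := c0; lra.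
Qed.

Lemma tm_next c k : 0 < c -> threshold c <= k%:R -> tm k.+1 <= (k ^ 66)%N%:R.
Proof.
move=> c0; rewrite /threshold /tm => hk; have ic0 : 0 < 10 / c ^+ 2 by rewrite divr_gt0// exprn_gt0.
have hk' : 2 ^+ 32 <= k%:R :> R by lra.
have k1 : 1 <= k%:R :> R by apply: le_trans hk'; rewrite exprn_ege1//; lra.
apply: (@le_trans _ _ ((2 * k%:R) ^+ 64)); first by rewrite lerXn2r ?nnegrE//; rewrite -natr1; lra.
rewrite exprMn natrX -[66%N]/(2 + 64)%N exprD ler_pM2r ?exprn_gt0//; last by lra.
by rewrite -[64%N]/(32 * 2)%N exprM lerXn2r ?nnegrE ?exprn_ge0//; lra.
Qed.

Lemma expR_ge_pow (m : nat) (x : R) : 0 <= x -> (x / m.+1%:R) ^+ m.+1 <= expR x.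
Proof.
move=> x0; rewrite [X in _ <= expR X](_ : x = m.+1%:R * (x / m.+1%:R)) ?expRM_natl; last by rewrite mulrC divfK.
rewrite lerXn2r ?nnegrE ?expR_ge0 ?divr_ge0//.
by have := expR_ge1Dx (x / m.+1%:R); move: (x / _) => a; lra.
Qed.

Lemma pow_le_expR (m : nat) : exists2 C : R, 0 < C & forall x, 1 <= x -> x ^+ m <= C * expR x.
Proof.
exists (m.+1%:R ^+ m.+1); first by rewrite exprn_gt0.
move=> x x1; apply: (@le_trans _ _ (x ^+ m.+1)); first by rewrite ler_weXn2l.
have := expR_ge_pow m (le_trans ler01 x1).
by rewrite expr_div_n ler_pdivrMr ?exprn_gt0// mulrC.
Qed.

(** [A] stands for [k ^ 67] and [B] for [k ^ 66]; the constant is [2 * 4 * 4 * 68]. *)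
Lemma bad_poly (A B e : R) : 2176 <= A -> 0 <= B -> B + 1 <= 2 * A -> 0 <= e ->
  (B + 1) * ((A + 1) * 2 * ((A + 1) * 2 * (10 * (A + 1) * e + 4 * ((A + 1) ^+ 2 * (3 * e))))) <= A * A ^+ 5 * e.
Proof.
move=> A4 B0 BA e0.
apply: (@le_trans _ _ (2176 * A ^+ 5 * e)); last by rewrite ler_wpM2r// ler_pM2r// exprn_gt0//; lra.
have AA : 1 <= A * A by rewrite -[1]mulr1; apply: ler_pM; lra.
have AA' : A <= A * A by rewrite ler_peMr//; lra.
have -> : 2176 * A ^+ 5 * e = 2 * A * (4 * A * (4 * A * (68 * A ^+ 2 * e))) by ring.
have in1 : 10 * (A + 1) * e + 4 * ((A + 1) ^+ 2 * (3 * e)) <= 68 * A ^+ 2 * e.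
  have -> : 10 * (A + 1) * e + 4 * ((A + 1) ^+ 2 * (3 * e)) = (10 * (A + 1) + 12 * (A + 1) ^+ 2) * e by ring.
  by rewrite ler_wpM2r//; rewrite !expr2 mulrDl !mulrDr !mul1r !mulr1; lra.
have in0 : 0 <= 10 * (A + 1) * e + 4 * ((A + 1) ^+ 2 * (3 * e)).
  by rewrite addr_ge0// !mulr_ge0// ?exprn_ge0; lra.
have A2 : (A + 1) * 2 <= 4 * A by lra.
have A20 : 0 <= (A + 1) * 2 by lra.
apply: ler_pM => //; [lra|by do 2 apply: mulr_ge0 => //|].
apply: ler_pM => //; first by apply: mulr_ge0.
exact: ler_pM.
Qed.

(** The product [th * u] is [k ^ 2], so the exponential error is at most [expR (1 - k ^ 2)]. It
    beats the polynomial prefactor, at most [k ^ 402 = (k ^ 67) ^ 6], with a factor [2 ^ k] to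
    spare. *)
Lemma bad_at_bound c : 0 < c -> 8 * c <= 1 ->
  exists C : R, forall k, threshold c <= k%:R -> bad_at c k <= C / 2 ^+ k.
Proof.
move=> c0 c8; have [C0 C00 hC] := pow_le_expR 402; exists (C0 * expR 1) => k hk; set x : R := k%:R.
have c2 : 0 < c ^+ 2 by rewrite exprn_gt0.
have ic0 : 0 < 1 / c ^+ 2 by rewrite divr_gt0.
have p32 : 10 <= 2 ^+ 32 :> R.
  by apply: (@le_trans _ _ (2 ^+ 4)); [lra|rewrite ler_weXn2l//; lra].
rewrite /threshold -/x in hk.
have x10 : 10 <= x by lra.
have x1 : 1 <= x by lra.
have x0 : 0 < x by lra.
have p0 (a : nat) : 0 < x ^+ a by rewrite exprn_gt0.
have pw (a b : nat) : (a <= b)%N -> x ^+ a <= x ^+ b by move=> ab; rewrite ler_weXn2l.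
have e1 : errk c k <= expR (1 - x ^+ 2).
  rewrite ler_expR natrX -/x.
  have -> : (x ^+ 35)^-1 * x ^+ 37 = x ^+ 2 by field; rewrite gt_eqF.
  have -> : 2 * x ^+ 67 * ((x ^+ 35)^-1 / c) ^+ 2 = 2 * (1 / c ^+ 2) / x ^+ 3.
    by field; rewrite !gt_eqF.
  have : 2 * (1 / c ^+ 2) / x ^+ 3 <= 1.
    by rewrite ler_pdivrMr//; have := pw 1%N 3%N isT; rewrite expr1; lra.
  by lra.
have e0 : 0 <= errk c k by exact: expR_ge0.
have tot : bad_at c k <= x ^+ 402 * errk c k.
  rewrite /bad_at -!muln2 !natrM -!(natr1 (k ^ 66)) -!(natr1 (k ^ 67)) !natrX -/x.
  set A := x ^+ 67; set B := x ^+ 66; set e := errk c k in e0 *.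
  have A1 : 1 <= A by rewrite exprn_ege1.
  have BA : B + 1 <= 2 * A by have := pw 66 67 isT; rewrite -/A -/B; lra.
  have B0 : 0 < B by exact: p0.
  have -> : x ^+ 402 = A * A ^+ 5 by rewrite -!exprM -exprD.
  have A4 : 2176 <= A.
    apply: (@le_trans _ _ (x ^+ 4)); last exact: pw.
    apply: (@le_trans _ _ (10 ^+ 4)); last by rewrite lerXn2r// nnegrE; lra.
    by lra.
  apply: bad_poly => //; exact: ltW.
apply: le_trans tot _; apply: (@le_trans _ _ (x ^+ 402 * expR (1 - x ^+ 2))).
  by rewrite ler_pM2l.
have h1 := hC x x1.
apply: (@le_trans _ _ (C0 * expR x * expR (1 - x ^+ 2))); first by rewrite ler_pM2r ?expR_gt0.
have -> : C0 * expR x * expR (1 - x ^+ 2) = C0 * expR 1 * expR (x - x ^+ 2).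
  by rewrite -!mulrA; congr (_ * _); rewrite -!expRD; congr expR; ring.
rewrite ler_pM2l; last by rewrite mulr_gt0 ?expR_gt0.
have -> : x - x ^+ 2 = - (x ^+ 2 - x) by ring.
rewrite expRN lef_pV2 ?posrE ?expR_gt0 ?exprn_gt0//.
apply: (@le_trans _ _ (expR x)); last first.
  by rewrite ler_expR; have : 10 * x <= x * x by [rewrite ler_pM2r]; rewrite -expr2; lra.
rewrite -[x]mulr1 /x expRM_natl lerXn2r ?nnegrE ?expR_ge0//.
by have := expR_ge1Dx (1 : R); lra.
Qed.

End scales.

(** * Convergence of paths whose drift between scales is summable *)

Section steady_paths.
Context (R : realType).
Implicit Types (V : R -> R) (v U eta : R).

(** A sequence of margins tending to [0], so that almost sure statements hold for all of them
    together. *)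
Definition margin (m : nat) : R := (8 * m.+1%:R)^-1.

(** This is [2 * k ^ 61 / k ^ 64], the deviation of the velocity over one scale; [slack k] bounds
    the sum of these deviations from scale [k] on. *)
Definition slack3 (k : nat) : R := 2 / k%:R ^+ 3.
Definition slack (k : nat) : R := 2 / k%:R.

(** Information flows backwards in time, as along the backward paths: the velocity at a later time
    constrains the velocity at the start of the scale. *)
Definition steady V := forall m : nat, exists k1 : nat, forall k, (k1 <= k)%N -> forall T v,
  tm R k <= T <= tm R k.+1 -> `|v| <= 1 - 9 * margin m ->
  (v < V T -> v - slack3 k < V (tm R k)) /\ (V T <= v -> V (tm R k) < v + slack3 k).

Lemma margin_gt0 m : 0 < margin m.
Proof. by rewrite invr_gt0 mulr_gt0. Qed.

Lemma margin_le m : 8 * margin m <= 1.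
Proof. by rewrite /margin invfM mulrA divff// mul1r invf_le1// ler1n. Qed.

Lemma margin_small (g : R) : 0 < g -> exists m, 9 * margin m < g.
Proof.
move=> g0; exists (Num.truncn (2 / g)); rewrite /margin.
have := truncnS_gt (2 / g); set n : R := _.+1%:R => h.
have n0 : 0 < n by rewrite /n.
rewrite ltr_pdivrMr ?mulr_gt0//; move: h; rewrite ltr_pdivrMr// => h; lra.
Qed.

Lemma inv_small (g : R) : 0 < g -> exists k1 : nat, forall k, (k1 <= k)%N -> (2 <= k)%N -> slack k < g.
Proof.
move=> g0; exists (Num.truncn (2 / g)).+1 => k hk k2.
rewrite /slack; have k0 : 0 < k%:R :> R by rewrite ltr0n; exact: leq_trans k2.
rewrite ltr_pdivrMr// mulrC -ltr_pdivrMr//.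
by apply: lt_le_trans (truncnS_gt _) _; rewrite ler_nat.
Qed.

Lemma tm_mono j k : (j <= k)%N -> tm R j <= tm R k.
Proof. by move=> jk; rewrite /tm lerXn2r ?nnegrE// ler_nat. Qed.

Lemma tm_ge k : (0 < k)%N -> k%:R <= tm R k.
Proof. by move=> k0; rewrite /tm exprS ler_peMr// exprn_ege1// ler1n. Qed.

Lemma tm_bracket (j : nat) (T : R) : tm R j <= T -> exists2 k, (j <= k)%N & tm R k <= T <= tm R k.+1.
Proof.
move=> jT; have ex : exists k, T < tm R k.+1.
  exists (Num.truncn T); apply: lt_le_trans (truncnS_gt T) (tm_ge _); exact: ltn0Sn.
case: (ex_minnP ex) => k kT kmin; exists k; last first.
  rewrite (ltW kT) andbT; case: k kT kmin => [|k] kT kmin.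
    rewrite (le_trans _ jT)// tm_mono//.
  by rewrite leNgt; apply/negP => /kmin; rewrite ltnn.
by rewrite -ltnS ltnNge; apply/negP => kj; have := le_lt_trans (tm_mono kj) (le_lt_trans jT kT); rewrite ltxx.
Qed.

Lemma telescope_le k : (2 <= k)%N -> slack3 k <= slack k - slack k.+1.
Proof.
rewrite /slack3 /slack => k2; have k2' : 2 <= k%:R :> R by rewrite (ler_nat R 2).
have k0 : k%:R != 0 :> R by apply: lt0r_neq0; lra.
have k0' : k%:R + 1 != 0 :> R by apply: lt0r_neq0; lra.
rewrite -(natr1 k) -subr_ge0.
have -> : 2 / k%:R - 2 / (k%:R + 1) - 2 / k%:R ^+ 3 = 2 * (k%:R ^+ 2 - k%:R - 1) / (k%:R ^+ 3 * (k%:R + 1)) :> R.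
  by field; rewrite k0 k0'.
have kk : 0 <= k%:R + 1 :> R by lra.
apply: divr_ge0; last by rewrite mulr_ge0 ?exprn_ge0.
have : 2 * k%:R <= k%:R * k%:R :> R by rewrite ler_wpM2r//; lra.
by rewrite -expr2; lra.
Qed.

Lemma steady_long V m : steady V -> exists k1 : nat, forall j, (k1 <= j)%N -> forall T v,
  tm R j <= T -> `|v| <= 1 - 9 * margin m - slack j ->
  (v < V T -> v - slack j < V (tm R j)) /\ (V T <= v -> V (tm R j) < v + slack j).
Proof.
move=> /(_ m)[k1 hk]; exists (maxn k1 2) => j; rewrite geq_max => /andP[kj j2] T v jT.
have [k jk kT] := tm_bracket jT; move: v.
have j0 (i : nat) : (2 <= i)%N -> 0 < slack i.
  by move=> i2; rewrite /slack divr_gt0// ltr0n; exact: leq_trans i2.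
suff gen n v : `|v| <= 1 - 9 * margin m - (slack j - slack (j + n)) ->
    (v < V (tm R (j + n)) -> v - (slack j - slack (j + n)) < V (tm R j)) /\
    (V (tm R (j + n)) < v -> V (tm R j) < v + (slack j - slack (j + n))).
  move=> v hv; have k2 : (2 <= k)%N by exact: leq_trans jk.
  have kE : (j + (k - j) = k)%N by rewrite subnKC.
  have d0 : 0 < slack3 k by rewrite /slack3 divr_gt0// exprn_gt0// ltr0n; exact: leq_trans k2.
  have tl := telescope_le k2; have p1 := j0 k k2; have p2 := j0 k.+1 (leqW k2); have pj := j0 j j2.
  have [h1 h2] := hk k (leq_trans kj jk) T v kT ltac:(by move: hv pj; lra).
  move: hv; rewrite ler_norml => /andP[v1 v2].
  split => h.
    have [g1 _] := gen (k - j)%N (v - slack3 k) ltac:(by rewrite kE ler_norml; lra).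
    by move: g1; rewrite kE => /(_ (h1 h)); lra.
  have [_ g2] := gen (k - j)%N (v + slack3 k) ltac:(by rewrite kE ler_norml; lra).
  by move: g2; rewrite kE => /(_ (h2 h)); lra.
elim: n v => [|n IH] v; first by rewrite addn0 subrr !subr0 addr0.
rewrite addnS ler_norml => /andP[v1 v2].
have n2 : (2 <= j + n)%N by exact: leq_trans (leq_addr _ _).
have tl := telescope_le n2; have pj := j0 j j2; have pn := j0 _ n2; have pn' := j0 _ (leqW n2).
have mono : slack (j + n) <= slack j.
  by rewrite /slack ler_pM2l// lef_pV2 ?posrE ?ltr0n// ?ler_nat ?leq_addr//; [exact: leq_trans n2|exact: leq_trans j2].
have d0 : 0 < slack3 (j + n) by rewrite /slack3 divr_gt0// exprn_gt0// ltr0n; exact: leq_trans n2.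
have T' : tm R (j + n) <= tm R (j + n).+1 <= tm R (j + n).+1 by rewrite lexx tm_mono.
have [h1 h2] := hk (j + n)%N (leq_trans kj (leq_addr _ _)) _ v T' ltac:(by rewrite ler_norml; lra).
split => h.
  have [g1 _] := IH (v - slack3 (j + n)) ltac:(by rewrite ler_norml; lra).
  by have := g1 (h1 h); lra.
have [_ g2] := IH (v + slack3 (j + n)) ltac:(by rewrite ler_norml; lra).
by have := g2 (h2 (ltW h)); lra.
Qed.

(** Take a scale [j] where [V] is close to [U] and the remaining slack is small. If [V] left the
    neighbourhood of [U] at a later time, going back to scale [j] would put [V (tm R j)] away from
    [U]. *)
Lemma steady_cvg V U : steady V -> `|U| < 1 ->
  (forall eta, 0 < eta -> forall k0, exists2 j, (k0 <= j)%N & `|V (tm R j) - U| < eta) ->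
  V T @[T --> +oo] --> U.
Proof.
move=> st U1 acc; apply/cvgrPdist_le => e e0.
pose g := Num.min e ((1 - `|U|) / 2).
have g0 : 0 < g by rewrite lt_min e0 divr_gt0// subr_gt0.
have ge : g <= e by rewrite ge_min lexx.
have gU : g <= (1 - `|U|) / 2 by rewrite ge_min lexx orbT.
have [m hm] := margin_small (divr_gt0 g0 (ltr0Sn R 3)).
have [k1 h1] := steady_long m st; have [k2 h2] := inv_small (divr_gt0 g0 (ltr0Sn R 3)).
have [j] := acc (g / 2) (divr_gt0 g0 (ltr0Sn R 1)) (maxn 2 (maxn k1 k2)).
rewrite !geq_max => /and3P[j2 j1 j3] hj.
have jg := h2 j j3 j2.
exists (tm R j); split; first exact: num_real.
move=> T /ltW jT.
move: hj; rewrite ltr_norml => /andP[c1 c2].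
have UB := ler_normD U g; have UB' := ler_normB U g; rewrite (gtr0_norm g0) in UB UB'.
have g4 : g = 4 * (g / 4) by lra.
have [a1 _] := h1 j j1 T (U + g) jT ltac:(lra).
have [_ a2] := h1 j j1 T (U - g) jT ltac:(lra).
rewrite ler_norml; apply/andP; split.
  rewrite leNgt; apply/negP => h; have : U + g < V T by lra.
  by move=> /a1; lra.
rewrite leNgt; apply/negP => h; have : V T <= U - g by lra.
by move=> /a2; lra.
Qed.

(** A scale above [v + eta] forces all earlier large scales above [v]; infinitely many such scales
    therefore give all large ones. *)
Lemma steady_above V v eta : steady V -> 0 < eta -> -1 < v -> v + eta < 1 ->
  (forall k0, exists2 j, (k0 <= j)%N & v + eta < V (tm R j)) ->
  exists k1, forall j, (k1 <= j)%N -> v < V (tm R j).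
Proof.
move=> st e0 v1 v2 io.
pose g := Num.min eta (1 - `|v + eta|).
have ve : `|v + eta| < 1 by rewrite ltr_norml; apply/andP; split; lra.
have g0 : 0 < g by rewrite lt_min e0 subr_gt0.
have ge : g <= eta by rewrite ge_min lexx.
have gU : g <= 1 - `|v + eta| by rewrite ge_min lexx orbT.
have [m hm] := margin_small (divr_gt0 g0 (ltr0Sn R 1)).
have [k1 h1] := steady_long m st; have [k2 h2] := inv_small (divr_gt0 g0 (ltr0Sn R 1)).
exists (maxn 2 (maxn k1 k2)) => j; rewrite !geq_max => /and3P[j2 j1 j3].
have jg := h2 j j3 j2; have [i ji hi] := io j.
have [a1 _] := h1 j j1 _ (v + eta) (tm_mono ji) ltac:(lra).
by have := a1 hi; lra.
Qed.

End steady_paths.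

(** * Almost sure regularity and steadiness *)

Section almost_sure.
Context d (Ω : measurableType d) (R : realType) (Q : probability Ω R).

(** Borel-Cantelli for events known only through measurable covers; the covers are chosen first, and
    are empty below [k0]. *)
Lemma small_ae (A : nat -> set Ω) (C : R) (k0 : nat) :
  (forall k, (k0 <= k)%N -> small Q (A k) (C / 2 ^+ k)) ->
  {ae Q, forall w, exists k1, forall k, (k1 <= k)%N -> ~ A k w}.
Proof.
move=> sA; pose C' := Num.max 0 C.
have C0 : 0 <= C' by rewrite le_max lexx.
have [B hB] : {B : nat -> set Ω & forall k, [/\ measurable (B k), ((k0 <= k)%N -> A k `<=` B k) & (Q (B k) <= (C' / 2 ^+ k)%:E)%E]}.
  apply: (@boolp.choice _ _ (fun k B => [/\ measurable B, ((k0 <= k)%N -> A k `<=` B) & (Q B <= (C' / 2 ^+ k)%:E)%E])) => k.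
  have [kk|kk] := leqP k0 k; last by exists set0; split => //; rewrite measure0 lee_fin divr_ge0// exprn_ge0.
  have [B [mB AB QB]] := sA k kk; exists B; split => //; apply: le_trans QB _.
  by rewrite lee_fin ler_pM2r ?invr_gt0 ?exprn_gt0// le_max lexx orbT.
have fin : (\sum_(n <oo) Q (B n) < +oo)%E.
  apply: (@le_lt_trans _ _ (2 * C')%:E); last exact: ltry.
  apply: le_trans (epsilon_trick0 xpredT (mulr_ge0 (ler0n R 2) C0)).
  apply: lee_nneseries => // n _; have [_ _] := hB n => /le_trans; apply.
  by rewrite lee_fin natrX exprS invfM mulrACA divff// mul1r.
have := lim_sup_set_cvg0 (fun k => let: And3 h _ _ := hB k in h) fin => Q0.
exists (lim_sup_set B); split => //.
  by apply: bigcapT_measurable => n; apply: bigcup_measurable => k _; case: (hB k).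
move=> w; apply: contraPP => nB; apply: contrapT => /contrapT; apply.
have [n nn] : exists n, forall k, (n <= k)%N -> ~ B k w.
  apply: contrapT => h; apply: nB => n _; apply: contrapT => h'; apply: h; exists n => k nk Bk.
  by apply: h'; exists k.
exists (maxn n k0) => k; rewrite geq_max => /andP[nk kk] Ak; apply: (nn k nk).
by case: (hB k) => _ + _; apply.
Qed.

Variable (Y : int * nat -> Ω -> R).
Hypothesis hY : indep_exp Q (fun=> 1) Y.
Hypothesis Y0 : forall k w, 0 < Y k w.
Hypothesis Yd : forall w, divg (Y ^~ w).

Lemma small_negligible (A : set Ω) : (forall e, 0 < e -> small Q A e) -> measurable A -> Q.-negligible A.
Proof.
move=> h mA; apply/negligibleP => //; apply/eqP; rewrite eq_le measure_ge0 andbT.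
apply/lee_addgt0Pr => e e0; rewrite add0e; apply: small_ge => //; exact: h.
Qed.

Lemma spreading_ae : {ae Q, forall w, spreading (Y ^~ w)}.
Proof.
have one z (m : nat) : {ae Q, forall w, exists n, m%:R < Gt (Y ^~ w) z 0 n 0 /\ m%:R < Gt (Y ^~ w) z 0 0 n}.
  have N1 : Q.-negligible [set w | forall n, Gt (Y ^~ w) z 0 n 0 <= m%:R].
    apply: small_negligible => [e e0|].
      have [[n hn] _] := Gt_spread hY Y0 Yd z m%:R e0.
      by apply: small_sub hn => w /=.
    rewrite (_ : [set w | _] = \bigcap_n ~` [set w | m%:R < Gt (Y ^~ w) z 0 n 0]).
      by apply: bigcapT_measurable => n; apply: measurableC; apply: measurable_gt; exact: (Gt_measurable hY).
    by apply/seteqP; split => w h n; [move=> _; apply/negP; rewrite -leNgt|have /negP := h n I; rewrite -leNgt].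
  have N2 : Q.-negligible [set w | forall n, Gt (Y ^~ w) z 0 0 n <= m%:R].
    apply: small_negligible => [e e0|].
      have [_ [n hn]] := Gt_spread hY Y0 Yd z m%:R e0.
      by apply: small_sub hn => w /=.
    rewrite (_ : [set w | _] = \bigcap_n ~` [set w | m%:R < Gt (Y ^~ w) z 0 0 n]).
      by apply: bigcapT_measurable => n; apply: measurableC; apply: measurable_gt; exact: (Gt_measurable hY).
    by apply/seteqP; split => w h n; [move=> _; apply/negP; rewrite -leNgt|have /negP := h n I; rewrite -leNgt].
  apply: negligibleS (negligibleU N1 N2) => w /=; apply: contraPP => /not_orP[].
  move=> /existsNP[n1 /negP h1] /existsNP[n2 /negP h2]; apply: contrapT => /contrapT; apply.
  rewrite -ltNge in h1; rewrite -ltNge in h2; exists (maxn n1 n2); split.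
    by apply: lt_le_trans h1 _; apply: (Gt_mono (Y0 ^~ w) (Yd w)) => //; exact: leq_maxl.
  by apply: lt_le_trans h2 _; apply: (Gt_mono (Y0 ^~ w) (Yd w)) => //; exact: leq_maxr.
(* Integers are enumerated by their codes, which reduces the almost sure quantifier to one over
   [nat]. *)
have all1 : {ae Q, forall w, forall i m : nat, forall z, choice.unpickle i = Some z ->
    exists n, m%:R < Gt (Y ^~ w) z 0 n 0 /\ m%:R < Gt (Y ^~ w) z 0 0 n}.
  apply: ae_foralln => i; apply: ae_foralln => m.
  case E : (choice.unpickle i) => [z|]; last by apply: aeW => w z.
  by apply: filterS (one z m) => w h z' [<-].
apply: filterS all1 => w h z t.
have [n [n1 n2]] := h (choice.pickle z) (Num.truncn t).+1 z (choice.pickleK z).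
by exists n; split; apply: lt_trans (truncnS_gt t) _.
Qed.

Lemma steady_ae : {ae Q, forall w, forall X, separates (Y ^~ w) X -> steady (fun T => (X T)%:~R / T)}.
Proof.
have one m : {ae Q, forall w, exists k1, forall k, (k1 <= k)%N ->
    ~ ~ good Y (margin R m) (k%:R ^+ 37) (tm R k) (k%:R ^+ 55) (k%:R ^+ 61) (k ^ 67) (k ^ 66) w}.
  have c0 := margin_gt0 R m; have c8 := margin_le R m.
  have [C hC] := bad_at_bound c0 c8.
  apply: (@small_ae (fun k => ~` good Y (margin R m) (k%:R ^+ 37) (tm R k) (k%:R ^+ 55) (k%:R ^+ 61) (k ^ 67) (k ^ 66)) C
    (Num.truncn (threshold (margin R m))).+1) => k hk.
  have hk' : threshold (margin R m) <= k%:R by apply: le_trans (ltW (truncnS_gt _)) _; rewrite ler_nat.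
  apply: small_le (hC k hk') _.
  exact: (good_small hY Y0 Yd c0 c8 (scale_okP c0 c8 hk')).
apply: filterS (ae_foralln one) => w gw X HX m.
have c0 := margin_gt0 R m; have c8 := margin_le R m.
have [k1 hk1] := gw m; exists (maxn k1 (Num.truncn (threshold (margin R m))).+1) => k.
rewrite geq_max => /andP[kk1 hk] T v /andP[kT Tk] hv.
have hk' : threshold (margin R m) <= k%:R by apply: le_trans (ltW (truncnS_gt _)) _; rewrite ler_nat.
have k0 : (0 < k)%N by exact: leq_trans hk.
have t0 : 0 < tm R k by rewrite exprn_gt0// ltr0n.
have T0 : 0 < T by exact: lt_le_trans kT.
have tT : tm R k <= (Num.truncn T)%:R.
  by move: kT; rewrite /tm -natrX ler_nat -truncn_ge_nat// ltW.
have TN : T < (k ^ 66)%N%:R + 1 by have := tm_next c0 hk'; lra.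
have gk := contrapT (hk1 k kk1).
have := speed_step Y0 Yd c0 (scale_okP c0 c8 hk') gk HX (ltW T0) tT TN hv.
have -> : 2 * k%:R ^+ 61 / tm R k = slack3 R k by rewrite /tm /slack3; field; rewrite pnatr_eq0 -lt0n.
by rewrite -ltr_pdivlMr// -ler_pdivrMr.
Qed.

End almost_sure.

(** * Expected heights and the law of the speed *)

Section bounded_expectation.
Context d (Ω : measurableType d) (R : realType) (Q : probability Ω R).
Implicit Types (f g : Ω -> R) (A : set Ω).

Definition pr A : R := fine (Q A).
Definition Ex f : R := fine (\int[Q]_w (f w)%:E).
Definition bdd f := [/\ measurable_fun setT f, forall w, 0 <= f w & exists B : R, forall w, f w <= B].

Lemma prE A : measurable A -> Q A = (pr A)%:E.
Proof. by move=> mA; rewrite fineK// fin_num_measure. Qed.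

Lemma pr_ge0 A : 0 <= pr A.
Proof. exact: fine_ge0. Qed.

Lemma pr_small A e : measurable A -> small Q A e -> pr A <= e.
Proof. by move=> mA /(small_ge mA); rewrite prE// lee_fin. Qed.

Lemma pr_setC A : measurable A -> pr (~` A) = 1 - pr A.
Proof.
move=> mA; have := probability_setC Q mA; rewrite !prE//; last exact: measurableC.
by rewrite -EFinB => -[].
Qed.

Lemma ExE f : bdd f -> (\int[Q]_w (f w)%:E = (Ex f)%:E)%E.
Proof.
move=> [mf f0 [B fB]]; rewrite fineK// ge0_fin_numE; last by apply: integral_ge0 => w _; rewrite lee_fin.
apply: (@le_lt_trans _ _ (\int[Q]_w B%:E)%E).
  apply: ge0_le_integral => //.
  - by move=> w _; rewrite lee_fin.
  - exact/measurable_EFinP.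
  - by move=> w _; rewrite lee_fin.
have -> : (\int[Q]_w B%:E = B%:E * Q setT)%E by exact: (integral_cst Q measurableT B%:E).
by rewrite probability_setT mule1 ltry.
Qed.

Lemma bddD f g : bdd f -> bdd g -> bdd (fun w => f w + g w).
Proof.
move=> [mf f0 [B fB]] [mg g0 [C gC]]; split.
- exact: measurable_funD.
- by move=> w; rewrite addr_ge0.
- by exists (B + C) => w; rewrite lerD.
Qed.

Lemma bdd_cst c : 0 <= c -> bdd (fun=> c).
Proof. by move=> c0; split => //; exists c. Qed.

Lemma bdd_indic c A : 0 <= c -> measurable A -> bdd (fun w => c * \1_A w).
Proof.
move=> c0 mA; split.
- by apply: measurable_funM => //; exact: measurable_indic.
- by move=> w; rewrite mulr_ge0// indicE.
- by exists c => w; rewrite indicE; case: (_ \in _); rewrite ?mulr1 ?mulr0.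
Qed.

Lemma ExD f g : bdd f -> bdd g -> Ex (fun w => f w + g w) = Ex f + Ex g.
Proof.
move=> bf bg; have := ExE (bddD bf bg); case: (bf) (bg) => [mf f0 _] [mg g0 _].
under eq_integral do rewrite EFinD.
rewrite ge0_integralD//; last 4 first.
- by move=> w _; rewrite lee_fin.
- exact/measurable_EFinP.
- by move=> w _; rewrite lee_fin.
- exact/measurable_EFinP.
by rewrite !ExE// -EFinD => -[].
Qed.

Lemma Ex_le f g : bdd f -> bdd g -> (forall w, f w <= g w) -> Ex f <= Ex g.
Proof.
move=> bf bg fg; rewrite -lee_fin -!ExE//; case: (bf) (bg) => [mf f0 _] [mg g0 _].
apply: ge0_le_integral => //.
- by move=> w _; rewrite lee_fin.
- exact/measurable_EFinP.
- exact/measurable_EFinP.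
- by move=> w _; rewrite lee_fin.
Qed.

Lemma Ex_cst c : Ex (fun=> c) = c.
Proof.
rewrite /Ex (_ : (\int[Q]_w c%:E = c%:E * Q setT)%E); last exact: (integral_cst Q measurableT c%:E).
by rewrite probability_setT mule1.
Qed.

Lemma Ex_indic c A : 0 <= c -> measurable A -> Ex (fun w => c * \1_A w) = c * pr A.
Proof.
move=> c0 mA; rewrite /Ex; under eq_integral do rewrite EFinM.
rewrite (_ : (\int[Q]_w (c%:E * (\1_A w)%:E) = c%:E * \int[Q]_w (\1_A w)%:E)%E); last first.
  by apply: ge0_integralZl => //; apply/measurable_EFinP; exact: measurable_indic.
by rewrite (_ : (\int[Q]_w (\1_A w)%:E = (pr A)%:E)%E)//; rewrite integral_indic// setIT; exact: prE.
Qed.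

Lemma nat_measurable (g : Ω -> nat) (P : nat -> Prop) :
  (forall k, measurable [set w | (k < g w)%N]) -> measurable [set w | P (g w)].
Proof.
move=> mg; have eqk k : measurable [set w | g w = k].
  rewrite (_ : [set w | _] = (if k is k'.+1 then [set w | (k' < g w)%N] else setT) `&` ~` [set w | (k < g w)%N]).
    by apply: measurableI; [case: k|apply: measurableC].
  apply/seteqP; split => w /=; first by case: k => [|k] E; split => //=; rewrite E ?ltnn.
  by case: k => [|k] [] /= h /negP; rewrite -leqNgt => h'; apply/eqP; rewrite eqn_leq h' ?h.
rewrite (_ : [set w | _] = \bigcup_(k in P) [set w | g w = k]).
  by apply: bigcup_measurable.
by apply/seteqP; split => w /=; [move=> h; exists (g w)|move=> [k Pk E]; rewrite E].
Qed.

Lemma nat_measurable2 (g h : Ω -> nat) (P : nat -> nat -> Prop) :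
  (forall k, measurable [set w | (k < g w)%N]) -> (forall k, measurable [set w | (k < h w)%N]) ->
  measurable [set w | P (g w) (h w)].
Proof.
move=> mg mh; rewrite (_ : [set w | _] = \bigcup_k ([set w | g w = k] `&` [set w | P k (h w)])).
  apply: bigcupT_measurable => k; apply: measurableI.
    exact: (nat_measurable (fun n => n = k)).
  exact: (nat_measurable (P k)).
by apply/seteqP; split => w /=; [move=> ?; exists (g w)|move=> [k _ [->]]].
Qed.

Lemma minn_sum (g : Ω -> nat) K w :
  (minn (g w) K)%:R = \sum_(k < K) \1_[set w | (k < g w)%N] w :> R.
Proof.
elim: K => [|K IH]; first by rewrite minn0 big_ord0.
rewrite big_ord_recr /= -IH indicE; rewrite -natrD; congr _%:R.
have -> : (w \in [set w0 | (K < g w0)%N]) = (K < g w)%N by apply/idP/idP; rewrite inE.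
by case: ltnP => /=; lia.
Qed.

Lemma bdd_minn (g : Ω -> nat) K : (forall k, measurable [set w | (k < g w)%N]) ->
  bdd (fun w => (minn (g w) K)%:R).
Proof.
move=> mg; split => //; last by exists K%:R => w; rewrite ler_nat geq_minr.
under eq_fun do rewrite minn_sum.
by apply: measurable_sum => k; exact: measurable_indic.
Qed.

Lemma Ex_minn (g : Ω -> nat) K : (forall k, measurable [set w | (k < g w)%N]) ->
  Ex (fun w => (minn (g w) K)%:R) = \sum_(k < K) pr [set w | (k < g w)%N].
Proof.
move=> mg; elim: K => [|K IH].
  by rewrite big_ord0; under [X in Ex X]eq_fun do rewrite minn0; exact: Ex_cst.
rewrite big_ord_recr /= -IH -[pr _]mul1r -Ex_indic// -ExD; [|exact: bdd_minn|exact: bdd_indic].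
by congr Ex; apply/funext => w; rewrite !minn_sum big_ord_recr /= mul1r.
Qed.

End bounded_expectation.

Section heights_law.
Context d (Ω : measurableType d) (R : realType) (Q : probability Ω R).
Variable (Y : int * nat -> Ω -> R).
Hypothesis hY : indep_exp Q (fun=> 1) Y.
Hypothesis Y0 : forall k w, 0 < Y k w.
Hypothesis Yd : forall w, divg (Y ^~ w).
Implicit Types (z x : int) (t : R).

Let le00 : (0 : R) <= 0. Proof. exact: lexx. Qed.

Lemma H_level z t x k : [set w | (k < H (Y ^~ w) z 0 t x)%N] =
  if (k < `|x - z|)%N then setT else
    ~` [set w | t < Gt (Y ^~ w) z 0 (dcell (x - z) (k - `|x - z|)./2).1 (dcell (x - z) (k - `|x - z|)./2).2].
Proof.
case: ltnP => kx; first by apply/seteqP; split => w //= _; exact: leq_trans kx (H_ge _ _ _ _ _).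
apply/seteqP; split => w /=.
  move=> h; apply/negP; rewrite -leNgt (fillE (Y0 ^~ w) (Yd w))//.
  by move: h kx; rewrite /H; move: (fill _ _ _ _ _) => f; clear; lia.
move=> /negP; rewrite -leNgt (fillE (Y0 ^~ w) (Yd w))// /H.
by move: kx; move: (fill _ _ _ _ _) => f; clear; lia.
Qed.

Lemma H_level_measurable z t x k : measurable [set w | (k < H (Y ^~ w) z 0 t x)%N].
Proof.
rewrite H_level; case: ifP => // _; apply: measurableC; apply: measurable_gt.
exact: (Gt_measurable hY).
Qed.

Lemma H_level_translation z z' t x x' k : x - z = x' - z' ->
  pr Q [set w | (k < H (Y ^~ w) z 0 t x)%N] = pr Q [set w | (k < H (Y ^~ w) z' 0 t x')%N].
Proof.
move=> E; rewrite !H_level E; case: ifP => // _; rewrite !pr_setC; last 2 first.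
- by apply: measurable_gt; exact: (Gt_measurable hY).
- by apply: measurable_gt; exact: (Gt_measurable hY).
by rewrite /pr (Gt_translation hY Y0 Yd z z').
Qed.

Definition below t x : set Ω := [set w | (H (Y ^~ w) (-1) 0 t x < H (Y ^~ w) 0 0 t x)%N].

Lemma below_measurable t x : measurable (below t x).
Proof. by apply: (nat_measurable2 (fun a b => (a < b)%N)) => k; exact: H_level_measurable. Qed.

Section fixed_time.
Variables (t : R) (K : nat).

(** Truncation at [K] makes the expectation finite at once; [high] controls its effect. *)
Definition EH z x : R := Ex Q (fun w => (minn (H (Y ^~ w) z 0 t x) K)%:R).
Definition high x : set Ω := [set w | (K <= H (Y ^~ w) 0 0 t x)%N].

Let bm z x := bdd_minn R K (H_level_measurable z t x).

Lemma high_measurable x : measurable (high x).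
Proof. by apply: (nat_measurable (fun a => (K <= a)%N)) => k; exact: H_level_measurable. Qed.

Lemma EH_translation x : EH (-1) x = EH 0 (x + 1).
Proof.
rewrite /EH !Ex_minn; try by move=> k; exact: H_level_measurable.
by apply: eq_bigr => k _; apply: H_level_translation; lia.
Qed.

(** By translation, [EH 0 (x + 1) - EH 0 x] is the expected difference of the two interfaces at [x],
    whose untruncated value is [-1] on [below] and [1] elsewhere. Truncation turns the identity into
    two inequalities, with error [2 * pr Q (high x)]. *)
Lemma EH_step_le x : EH 0 (x + 1) + 2 * pr Q (below t x) <= EH 0 x + 1 + 2 * pr Q (high x).
Proof.
have mb := below_measurable t x; have mh := high_measurable x.
rewrite -EH_translation.
have b1 := bdd_indic (ler0n R 2) mb; have b2 := bdd_indic (ler0n R 2) mh; have b3 := bdd_cst Ω (ler01 (R := R)).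
have <- : Ex Q (fun w => (minn (H (Y ^~ w) (-1) 0 t x) K)%:R + 2 * \1_(below t x) w) =
    EH (-1) x + 2 * pr Q (below t x) by rewrite ExD ?Ex_indic//; exact: bm.
have <- : Ex Q (fun w => (minn (H (Y ^~ w) 0 0 t x) K)%:R + 1 + 2 * \1_(high x) w) =
    EH 0 x + 1 + 2 * pr Q (high x).
  by rewrite (ExD _ (bddD (bm 0 x) b3) b2) ExD ?Ex_indic ?Ex_cst//; exact: bm.
apply: Ex_le; [by apply: bddD; [exact: bm|]|by apply: bddD => //; apply: bddD => //; exact: bm|].
move=> w; rewrite !indicE.
have -> : (w \in below t x) = (H (Y ^~ w) (-1) 0 t x < H (Y ^~ w) 0 0 t x)%N by apply/idP/idP; rewrite inE.
have -> : (w \in high x) = (K <= H (Y ^~ w) 0 0 t x)%N by apply/idP/idP; rewrite inE.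
rewrite -!natrM -!natrD (_ : 1 = 1%:R :> R)// -!natrD ler_nat.
case: (H_discrepancy (Y0 ^~ w) (Yd w) t x); move: (H _ _ _ _ _) (H _ _ _ _ _) => a b -> ; clear.
  by rewrite ltnNge leqnSn /=; lia.
by rewrite ltnSn; case: (leqP K) => /=; lia.
Qed.

Lemma EH_step_ge x : EH 0 x + 1 <= EH 0 (x + 1) + 2 * pr Q (below t x) + 2 * pr Q (high x).
Proof.
have mb := below_measurable t x; have mh := high_measurable x.
rewrite -EH_translation.
have b1 := bdd_indic (ler0n R 2) mb; have b2 := bdd_indic (ler0n R 2) mh; have b3 := bdd_cst Ω (ler01 (R := R)).
have <- : Ex Q (fun w => (minn (H (Y ^~ w) 0 0 t x) K)%:R + 1) = EH 0 x + 1.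
  by rewrite ExD ?Ex_cst//; exact: bm.
have <- : Ex Q (fun w => (minn (H (Y ^~ w) (-1) 0 t x) K)%:R + 2 * \1_(below t x) w + 2 * \1_(high x) w) =
    EH (-1) x + 2 * pr Q (below t x) + 2 * pr Q (high x).
  by rewrite (ExD _ (bddD (bm (-1) x) b1) b2) ExD ?Ex_indic//; exact: bm.
apply: Ex_le; [by apply: bddD; [exact: bm|]|by apply: bddD => //; apply: bddD => //; exact: bm|].
move=> w; rewrite !indicE.
have -> : (w \in below t x) = (H (Y ^~ w) (-1) 0 t x < H (Y ^~ w) 0 0 t x)%N by apply/idP/idP; rewrite inE.
have -> : (w \in high x) = (K <= H (Y ^~ w) 0 0 t x)%N by apply/idP/idP; rewrite inE.
rewrite -!natrM (_ : 1 = 1%:R :> R)// -!natrD ler_nat.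
case: (H_discrepancy (Y0 ^~ w) (Yd w) t x); move: (H _ _ _ _ _) (H _ _ _ _ _) => a b -> ; clear.
  by rewrite ltnNge leqnSn /=; case: (leqP K) => /=; lia.
by rewrite ltnSn; case: (leqP K) => /=; lia.
Qed.

Lemma EH_le x (h : R) : 0 <= h ->
  EH 0 x <= h + K%:R * pr Q [set w | h < (H (Y ^~ w) 0 0 t x)%:R].
Proof.
move=> h0; have mA : measurable [set w | h < (H (Y ^~ w) 0 0 t x)%:R].
  by apply: (nat_measurable (fun a => h < a%:R)) => k; exact: H_level_measurable.
rewrite -(Ex_indic Q (ler0n R K) mA) -[X in _ <= X + _](Ex_cst Q) -ExD; [|exact: bdd_cst|exact: bdd_indic].
apply: Ex_le; [exact: bm|by apply: bddD; [exact: bdd_cst|exact: bdd_indic]|].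
move=> w; rewrite indicE.
have -> : (w \in [set w | h < (H (Y ^~ w) 0 0 t x)%:R]) = (h < (H (Y ^~ w) 0 0 t x)%:R) by apply/idP/idP; rewrite inE.
case: ltP => hh; first by rewrite mulr1 ler_wpDl// ler_nat geq_minr.
by rewrite mulr0 addr0; apply: le_trans hh; rewrite ler_nat geq_minl.
Qed.

Lemma EH_ge x (h : R) : 0 <= h -> h <= K%:R ->
  h <= EH 0 x + h * pr Q [set w | (H (Y ^~ w) 0 0 t x)%:R < h].
Proof.
move=> h0 hK; have mA : measurable [set w | (H (Y ^~ w) 0 0 t x)%:R < h].
  by apply: (nat_measurable (fun a => a%:R < h)) => k; exact: H_level_measurable.
rewrite -(Ex_indic Q h0 mA) -[X in X <= _](Ex_cst Q) -ExD; [|exact: bm|exact: bdd_indic].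
apply: Ex_le; [exact: bdd_cst|by apply: bddD; [exact: bm|exact: bdd_indic]|].
move=> w; rewrite indicE.
have -> : (w \in [set w | (H (Y ^~ w) 0 0 t x)%:R < h]) = ((H (Y ^~ w) 0 0 t x)%:R < h) by apply/idP/idP; rewrite inE.
case: ltP => hh; first by rewrite mulr1 ler_wpDl.
by rewrite mulr0 addr0; case: (leqP (H (Y ^~ w) 0 0 t x) K).
Qed.

End fixed_time.

(** Outside a null set, [below t x] says that [x] lies to the left of the second class particle. *)
Lemma below_mono t x x' : {ae Q, forall w, apart (Y ^~ w)} -> 0 <= t -> x <= x' ->
  pr Q (below t x') <= pr Q (below t x).
Proof.
move=> ap t0 xx.
have [N [mN QN0 NE]] : {ae Q, forall w, exists X, separates (Y ^~ w) X}.
  apply: filterS2 ap (spreading_ae hY Y0 Yd) => w a s.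
  exact: separates_exists (Y0 ^~ w) (Yd w) s a.
have sub : below t x' `<=` below t x `|` N.
  move=> w bx; have [Nw|Nw] := pselect (N w); [by right|left].
  have [X hX] : exists X, separates (Y ^~ w) X by apply: contrapT => h; apply: Nw; exact: NE.
  have := hX t x' t0; have := hX t x t0; move: bx; rewrite /below /=.
  case: ifP => h1; case: ifP => h2.
  - by move=> b _ E; move: b; rewrite E ltnNge leqnSn.
  - by move: (le_trans h1 xx); rewrite h2.
  - by move=> _ <-.
  - by move=> _ <-.
rewrite -lee_fin -!prE; try exact: below_measurable.
apply: le_trans (le_measure Q _ _ sub) _; rewrite ?inE; [exact: below_measurable|by apply: measurableU => //; exact: below_measurable|].
apply: (le_trans (measureU2 Q (below_measurable t x) mN)).
by rewrite -[leRHS]adde0; apply: leeD => //; rewrite le_eqVlt; apply/predU1l; exact: QN0.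
Qed.

End heights_law.

Section speed_law.
Context d (Ω : measurableType d) (R : realType) (Q : probability Ω R).
Variable (Y : int * nat -> Ω -> R).
Hypothesis hY : indep_exp Q (fun=> 1) Y.
Hypothesis Y0 : forall k w, 0 < Y k w.
Hypothesis Yd : forall w, divg (Y ^~ w).
Hypothesis Yap : {ae Q, forall w, apart (Y ^~ w)}.
Implicit Types (x b : int) (k L : nat).

Definition parab (t : R) x : R := t / 2 + x%:~R ^+ 2 / (2 * t).

(** A difference quotient over [L] sites. Monotonicity compares the probability at [b] with the
    averaged increments on its left and on its right; the curvature of the parabola contributes
    [L / (4 * n)], and an error [n * r] on the heights contributes [n * r / L]. *)
Lemma below_bounds (n r dl : R) (K L : nat) b : 0 < n -> (0 < L)%N ->
  (forall x, b - L%:Z <= x <= b + L%:Z ->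
    `|EH Q Y n K 0 x - parab n x| <= n * r /\ pr Q (high Y n K x) <= dl) ->
  `|pr Q (below Y n b) - (1 - b%:~R / n) / 2| <= L%:R / (4 * n) + n * r / L%:R + dl.
Proof.
move=> n0 L0 hx.
have L0' : 0 < L%:R :> R by rewrite ltr0n.
have mono x x' := below_mono hY Y0 Yd (t := n) (x := x) (x' := x') Yap (ltW n0).
set p := pr Q (below Y n b); set E := EH Q Y n K 0.
have up i : (i <= L)%N -> E b - E (b - i%:Z) <= i%:R * (1 - 2 * p + 2 * dl).
  elim: i => [|i IH] iL; first by rewrite subr0 subrr mul0r.
  have hb : b - L%:Z <= b - i.+1%:Z <= b + L%:Z by move: iL; clear; lia.
  have [_ hh] := hx _ hb; have := EH_step_le hY Y0 Yd n K (b - i.+1%:Z).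
  rewrite (_ : b - i.+1%:Z + 1 = b - i%:Z); last by clear; lia.
  have pm : p <= pr Q (below Y n (b - i.+1%:Z)) by apply: mono; clear; lia.
  by move: (IH (ltnW iL)); rewrite -(natr1 i) mulrDl mul1r /E /p in pm *; lra.
have dn i : (i <= L)%N -> i%:R * (1 - 2 * p - 2 * dl) <= E (b + i%:Z) - E b.
  elim: i => [|i IH] iL; first by rewrite addr0 subrr mul0r.
  have hb : b - L%:Z <= b + i%:Z <= b + L%:Z by move: iL; clear; lia.
  have [_ hh] := hx _ hb; have := EH_step_ge hY Y0 Yd n K (b + i%:Z).
  rewrite (_ : b + i%:Z + 1 = b + i.+1%:Z); last by clear; lia.
  have pm : pr Q (below Y n (b + i%:Z)) <= p by apply: mono; clear; lia.
  by move: (IH (ltnW iL)); rewrite -(natr1 i) mulrDl mul1r /E /p in pm *; lra.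
have [e0 _] := hx b ltac:(by clear; lia).
have [e1 _] := hx (b - L%:Z) ltac:(by clear; lia).
have [e2 _] := hx (b + L%:Z) ltac:(by clear; lia).
have u := up L (leqnn L); have l := dn L (leqnn L).
move: e0 e1 e2; rewrite !ler_norml /parab !rmorphB !rmorphD /= -!pmulrn -/E.
set B : R := b%:~R => /andP[e01 e02] /andP[e11 e12] /andP[e21 e22].
have q1 : (B - L%:R) ^+ 2 / (2 * n) = B ^+ 2 / (2 * n) - L%:R * (B / n - L%:R / (2 * n)) by field; rewrite gt_eqF.
have q2 : (B + L%:R) ^+ 2 / (2 * n) = B ^+ 2 / (2 * n) + L%:R * (B / n + L%:R / (2 * n)) by field; rewrite gt_eqF.
rewrite q1 in e11 e12; rewrite q2 in e21 e22.
have c1 : L%:R * (B / n - L%:R / (2 * n)) - 2 * (n * r) <= L%:R * (1 - 2 * p + 2 * dl) by lra.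
have c2 : L%:R * (1 - 2 * p - 2 * dl) <= L%:R * (B / n + L%:R / (2 * n)) + 2 * (n * r) by lra.
have nr : n * r = L%:R * (n * r / L%:R) by rewrite [RHS]mulrC divfK// gt_eqF.
have c1' : B / n - L%:R / (2 * n) - 2 * (n * r / L%:R) <= 1 - 2 * p + 2 * dl.
  by rewrite -(ler_pM2l L0') mulrBr [L%:R * (2 * _)]mulrCA -nr.
have c2' : 1 - 2 * p - 2 * dl <= B / n + L%:R / (2 * n) + 2 * (n * r / L%:R).
  by rewrite -(ler_pM2l L0') [X in _ <= X]mulrDr [L%:R * (2 * _)]mulrCA -nr.
have h4 : L%:R / (2 * n) = 2 * (L%:R / (4 * n)) by field; rewrite gt_eqF.
by rewrite h4 in c1' c2'; apply/andP; split; lra.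
Qed.

Lemma scale_heights (c : R) : 0 < c -> 8 * c <= 1 -> exists2 C : R, 0 <= C & forall k x,
  threshold c <= k%:R -> `|x%:~R| <= (1 - 8 * c) * tm R k ->
  pr Q [set w | parab (tm R k) x + k%:R ^+ 55 < (H (Y ^~ w) 0 0 (tm R k) x)%:R] <= C / 2 ^+ k /\
  pr Q [set w | (H (Y ^~ w) 0 0 (tm R k) x)%:R < parab (tm R k) x - k%:R ^+ 55] <= C / 2 ^+ k.
Proof.
move=> c0 c8; have [C hC] := bad_at_bound c0 c8; exists (Num.max 0 C); first by rewrite le_max lexx.
move=> k x hk hx.
have hb : bad_at c k <= Num.max 0 C / 2 ^+ k.
  by apply: le_trans (hC k hk) _; rewrite ler_pM2r ?invr_gt0 ?exprn_gt0// le_max lexx orbT.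
have [th0 thc u0 /andP[de0 dec] [KN KM M5 hN [gap s1 epc str [sc e2]]]] := scale_okP c0 c8 hk.
set s := tm R k in hx s1 epc sc *; set u : R := k%:R ^+ 37 in u0 KM gap str *.
set M : R := k%:R ^+ 55 in KM M5 hN str *.
have s0 : 0 < s by lra.
have sNB : s <= (k ^ 66)%N%:R.
  by have := tm_next c0 hk; apply: le_trans; rewrite /s; apply: tm_mono.
have sN : s + M + 2 <= (k ^ 67)%N%:R by lra.
set N := (k ^ 67)%N in KN hN gap sN *.
have err0 : 0 <= errk c k by exact: expR_ge0.
have N0 : 0 <= N.+1%:R :> R by [].
set T : R := 10 * N.+1%:R * errk c k + 4 * (N.+1%:R ^+ 2 * (3 * errk c k)).
have T1 : 0 <= 10 * N.+1%:R * errk c k by rewrite !mulr_ge0.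
have T2 : 0 <= N.+1%:R ^+ 2 * (3 * errk c k) by rewrite !mulr_ge0// exprn_ge0.
have bT : T <= bad_at c k.
  have T0 : 0 <= T by rewrite /T; lra.
  rewrite /bad_at -/N -/T; apply: (@le_trans _ _ (N.+1.*2%:R * T)); first by rewrite ler_peMl// ler1n.
  apply: (@le_trans _ _ (N.+1.*2%:R * (N.+1.*2%:R * T))); first by rewrite ler_peMl ?mulr_ge0// ler1n.
  by rewrite ler_peMl ?mulr_ge0// ler1n.
have ic : 0 < c^-1 by rewrite invr_gt0.
have uM : 3 * u <= M by have : 0 <= (k ^ 54)%N%:R / c by [rewrite divr_ge0// ltW]; lra.
split.
- apply: pr_small; first by apply: (nat_measurable (fun a => parab s x + M < a%:R)) => j; exact: (H_level_measurable hY Y0 Yd).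
  have xt : `|x%:~R| <= (1 - 4 * c) * (s + M).
    by apply: le_trans hx _; apply: ler_pM => //; lra.
  have gap' : (s + M) * ((k%:R ^+ 16)^-1) ^+ 2 / c ^+ 2 + (k%:R ^+ 16)^-1 / c ^+ 2 + 6 * u < (k ^ 54)%N%:R * (k%:R ^+ 16)^-1.
    apply: le_lt_trans gap; rewrite !lerD2r -!mulrA ler_wpM2r//; last by lra.
    by rewrite mulr_ge0// divr_ge0// exprn_ge0// ltW.
  have M0 : 0 < M by lra.
  have := H_upper hY Y0 Yd c0 th0 thc u0 0 (lexx 0) (ltW s0) M0 xt (introT andP (conj de0 dec)) sN KN KM gap'.
  move=> hs; apply: small_le (small_sub _ hs); first by apply: le_trans hb; apply: le_trans bT; apply: (@le_trans _ _ (10 * N.+1%:R * errk c k)); [exact: lexx|rewrite /T; lra].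
  move=> w /=; rewrite !add0r; apply: le_lt_trans; rewrite /parab.
  by have := parab_shift x%:~R s0 (ltW M0); lra.
- apply: pr_small; first by apply: (nat_measurable (fun a => a%:R < parab s x - M)) => j; exact: (H_level_measurable hY Y0 Yd).
  have xa : `|x%:~R / s| <= 1 - 2 * c.
    by rewrite normrM normfV (gtr0_norm s0) ler_pdivrMr//; apply: le_trans hx _; rewrite ler_pM2r//; lra.
  have sN' : s <= N%:R by lra.
  have hs := H_lower hY Y0 Yd c0 th0 thc u0 0 xa (lexx 0) (ltW s0) sN'.
  apply: small_le (small_sub _ hs); first by apply: le_trans hb; apply: le_trans bT; apply: (@le_trans _ _ (N.+1%:R ^+ 2 * (3 * errk c k))); [exact: lexx|rewrite /T; lra].
  move=> w /= hw ab; have := ab x; rewrite subr0 add0r.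
  have -> : (1 - (x%:~R / s) ^+ 2) / 2 * s + x%:~R / s * x%:~R = parab s x.
    by rewrite /parab; field; rewrite gt_eqF.
  by move: hw; lra.
Qed.

(** The cut [K = 3 * n] lies above [parab n x + M], so truncation acts only where the upper bound on
    the height fails. *)
Lemma EH_near_parab (n M dl : R) (K : nat) x : 0 < n -> 0 < M -> M <= n / 2 -> 0 <= dl ->
  K%:R = 3 * n -> `|x%:~R| <= n ->
  pr Q [set w | parab n x + M < (H (Y ^~ w) 0 0 n x)%:R] <= dl ->
  pr Q [set w | (H (Y ^~ w) 0 0 n x)%:R < parab n x - M] <= dl ->
  `|EH Q Y n K 0 x - parab n x| <= M + 3 * n * dl /\ pr Q (high Y n K x) <= dl.
Proof.
move=> n0 M0 Mn dl0 K3 xn h1 h2.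
have pn : parab n x <= n.
  have : x%:~R ^+ 2 / (2 * n) <= n / 2.
    rewrite ler_pdivrMr ?mulr_gt0// (_ : n / 2 * (2 * n) = n ^+ 2); last by field.
    by rewrite -(real_normK (num_real x%:~R)) lerXn2r ?nnegrE ?normr_ge0 ?(ltW n0).
  by rewrite /parab; lra.
have p0 : n / 2 <= parab n x by rewrite /parab lerDl divr_ge0 ?sqr_ge0//; lra.
have u1 := EH_le hY Y0 Yd n K x (h := parab n x + M) ltac:(lra).
have u2 := EH_ge hY Y0 Yd n (K := K) x (h := parab n x - M) ltac:(lra) ltac:(by rewrite K3; lra).
rewrite K3 in u1.
have q1 : 3 * n * pr Q [set w | parab n x + M < (H (Y ^~ w) 0 0 n x)%:R] <= 3 * n * dl by rewrite ler_pM2l// mulr_gt0.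
have q2 : (parab n x - M) * pr Q [set w | (H (Y ^~ w) 0 0 n x)%:R < parab n x - M] <= 3 * n * dl.
  by apply: ler_pM => //; [lra|exact: pr_ge0|lra].
split; first by rewrite ler_norml; apply/andP; split; lra.
apply: le_trans h1; rewrite -lee_fin -!prE.
- apply: le_measure; rewrite ?inE; [exact: (high_measurable hY)| |].
    by apply: (nat_measurable (fun a => parab n x + M < a%:R)) => j; exact: (H_level_measurable hY Y0 Yd).
  move=> w; rewrite /high /= -(ler_nat R) K3; apply: lt_le_trans; lra.
- by apply: (nat_measurable (fun a => parab n x + M < a%:R)) => j; exact: (H_level_measurable hY Y0 Yd).
- exact: (high_measurable hY).
Qed.

Lemma below_limit (v e : R) : `|v| < 1 -> 0 < e -> exists k1 : nat, forall k, (k1 <= k)%N ->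
  `|pr Q (below Y (tm R k) (Num.floor (v * tm R k))) - (1 - v) / 2| <= e.
Proof.
move=> v1 e0; pose g := 1 - `|v|; have g0 : 0 < g by rewrite subr_gt0.
pose e' := Num.min e (g / 4); have e'0 : 0 < e' by rewrite lt_min e0 divr_gt0.
have e'e : e' <= e by rewrite ge_min lexx.
have e'g : e' <= g / 4 by rewrite ge_min lexx orbT.
have [m hm] := @margin_small R (g / 4) ltac:(by rewrite divr_gt0).
have c0 := margin_gt0 R m; have c8 := margin_le R m.
set c := margin R m in c0 c8 hm *.
have c8' : 1 - 8 * c <= 1 by lra.
have c8g : 8 * c <= g / 4 by lra.
have [C C0 hC] := scale_heights c0 c8.
pose r0 : R := 1 + 3 * C.
have r00 : 0 < r0 by rewrite /r0; lra.
(* The summands are what [kth], [a1], [a2], [a3] and [x10] require, in this order. *)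
pose W : R := threshold c + 8 * r0 / (e * e') + 8 * (1 + C) / e + 8 / g + 10.
have t1 : 0 < threshold c by rewrite /threshold addr_gt0 ?exprn_gt0// divr_gt0// exprn_gt0.
have t2 : 0 < 8 * r0 / (e * e') by rewrite divr_gt0 ?mulr_gt0.
have t3 : 0 < 8 * (1 + C) / e by rewrite divr_gt0// mulr_gt0//; lra.
have t4 : 0 < 8 / g by rewrite divr_gt0.
exists (Num.truncn W).+1 => k hk.
have Wk : W < k%:R by apply: lt_le_trans (truncnS_gt W) _; rewrite ler_nat.
set x : R := k%:R in Wk; rewrite /W in Wk.
have x10 : 10 <= x by lra.
have x2 : 2 <= x by lra.
have x0 : 0 < x by lra.
have kth : threshold c <= k%:R by rewrite -/x; lra.
set n := tm R k.
have xn : x <= n by apply: tm_ge; rewrite -(ltr_nat R) -/x.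
have n0 : 0 < n by exact: lt_le_trans xn.
set dl := C / 2 ^+ k.
have ix : 0 < x^-1 by rewrite invr_gt0.
have dlx : dl <= C / x.
  rewrite ler_wpM2l// lef_pV2 ?posrE ?exprn_gt0//.
  by rewrite /x -natrX ler_nat ltnW// ltn_expl.
have dl0 : 0 <= dl by rewrite divr_ge0// exprn_ge0.
have a1 : r0 / x <= e * e' / 8.
  rewrite ler_pdivrMr//; have : 8 * r0 / (e * e') <= x by lra.
  by rewrite ler_pdivrMr ?mulr_gt0//; lra.
have a2 : (1 + C) / x <= e / 8.
  rewrite ler_pdivrMr//; have : 8 * (1 + C) / e <= x by lra.
  by rewrite ler_pdivrMr//; lra.
have a3 : 8 <= g * n.
  have : 8 / g <= n by lra.
  by rewrite ler_pdivrMr// mulrC.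
pose M : R := x ^+ 55.
have Mn : M / n <= 1 / x.
  rewrite /M /n /tm -/x (_ : x ^+ 55 / x ^+ 64 = (x ^+ 9)^-1); last by field; rewrite gt_eqF.
  by rewrite div1r lef_pV2 ?posrE ?exprn_gt0// -[leLHS]expr1 ler_weXn2l//; lra.
pose r : R := M / n + 3 * dl.
have rx : r <= r0 / x by rewrite /r /r0 mulrDl; have : 3 * dl <= 3 * (C / x) by [rewrite ler_pM2l]; lra.
have r0' : 0 <= r.
  by apply: addr_ge0; [apply: divr_ge0; [exact: exprn_ge0 _ (ltW x0)|exact: ltW]|exact: mulr_ge0].
have nr : n * r = M + 3 * n * dl by rewrite /r; field; rewrite gt_eqF.
set b := Num.floor (v * n).
have bv1 : b%:~R <= v * n by exact: floor_le.
have bv2 : v * n < b%:~R + 1 by have := floorD1_gt (v * n); rewrite rmorphD.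
have en0 : 0 <= e' * n by rewrite mulr_ge0// ltW.
(* [L] is a small fraction of [n]: small enough for the curvature error, large enough for the height
   error [r], which tends to [0]. *)
pose L := (Num.truncn (e' * n)).+1.
have L1 : e' * n < L%:R by exact: truncnS_gt.
have L2 : L%:R <= e' * n + 1 by rewrite /L -natr1 lerD2r truncn_le.
have vn : `|v * n| = `|v| * n by rewrite normrM (gtr0_norm n0).
have inr (y : int) : b - L%:Z <= y <= b + L%:Z -> `|y%:~R| <= (1 - 8 * c) * n.
  move=> /andP[]; rewrite -!(ler_int R) rmorphB rmorphD /= -pmulrn => y1 y2.
  have : `|v * n| <= (1 - g) * n by rewrite vn /g opprB addrCA subrr addr0.
  rewrite ler_norml => /andP[w1 w2].
  have cn : 8 * c * n <= g / 4 * n by rewrite ler_wpM2r// ltW.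
  have eg : e' * n <= g / 4 * n by rewrite ler_wpM2r// ltW.
  move: y1 y2 w1 w2 cn eg bv1 bv2 L1 L2 a3; clear => *.
  by rewrite ler_norml; apply/andP; split; lra.
have M0 : 0 < M by rewrite exprn_gt0.
have Mn' : M <= n / 2.
  rewrite mulrC -ler_pdivrMr//; apply: le_trans Mn _; by rewrite div1r lef_pV2 ?posrE.
have key (y : int) : b - L%:Z <= y <= b + L%:Z ->
    `|EH Q Y n (3 * k ^ 64) 0 y - parab n y| <= n * r /\ pr Q (high Y n (3 * k ^ 64) y) <= dl.
  move=> /inr hy; have [h1 h2] := hC k y kth hy; rewrite -/n -/x -/M -/dl in h1 h2.
  have K3 : (3 * k ^ 64)%N%:R = 3 * n by rewrite natrM natrX.
  have yn : `|y%:~R| <= n by apply: le_trans hy _; rewrite ger_pMl.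
  by rewrite nr; exact: EH_near_parab.
have L0 : (0 < L)%N by [].
have main := below_bounds n0 L0 key.
have m1 : L%:R / (4 * n) <= e' / 4 + 1 / x.
  rewrite ler_pdivrMr; last exact: (mulr_gt0 (ltr0Sn R 3) n0).
  apply: le_trans L2 _.
  have : 1 <= 1 / x * n by rewrite div1r mulrC ler_pdivlMr// mul1r.
  by clear; lra.
have m2 : n * r / L%:R <= e / 8.
  rewrite ler_pdivrMr ?ltr0n//; apply: (@le_trans _ _ (e / 8 * (e' * n))); last by rewrite ler_pM2l ?divr_gt0// ltW.
  have : n * r <= n * (e * e' / 8) by rewrite ler_pM2l//; exact: le_trans a1.
  by clear; lra.
have m3 : `|b%:~R / n - v| <= 1 / x.
  rewrite (_ : b%:~R / n - v = (b%:~R - v * n) / n); last by field; rewrite gt_eqF.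
  rewrite normrM normfV (gtr0_norm n0) ler_pdivrMr//.
  have : 1 <= 1 / x * n by rewrite div1r mulrC ler_pdivlMr// mul1r.
  by move: bv1 bv2; rewrite ler_norml; clear => ? ? ?; apply/andP; split; lra.
have cx : 0 <= C / x by rewrite divr_ge0// ltW.
move: main m3; rewrite !ler_norml => /andP[k1 k2] /andP[k3 k4].
have a2' : 1 / x + C / x <= e / 8 by rewrite -mulrDl.
move: k1 k2 k3 k4 m1 m2 dlx cx a2' e'e e0; clear.
move: (L%:R / _) (n * r / _) (b%:~R / n) (pr _ _) (1 / x) (C / x) => a1 a2 a3 a4 a5 a6 k1 k2 k3 k4 m1 m2 k5 k6 k7 k8 k9.
by apply/andP; split; lra.
Qed.

End speed_law.

Section limsup.
Context (R : realType) (u : R^nat).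
Hypothesis u1 : forall k, `|u k| <= 1.

Let bu : bounded_fun u.
Proof. by exists 1; split; [exact: num_real|move=> M M1 k _; exact: le_trans (u1 k) (ltW M1)]. Qed.

Let sup_ub n : has_ubound (sdrop u n).
Proof. by exists 1 => _ [k _ <-]; have := u1 k; rewrite ler_norml => /andP[]. Qed.

Let inf_lb : has_lbound (range (sups u)).
Proof.
exists (- 1) => _ [n _ <-]; apply: (@le_trans _ _ (u n)).
  by have := u1 n; rewrite ler_norml => /andP[].
by apply: ub_le_sup; [exact: sup_ub|exists n => /=].
Qed.

Lemma limn_sup_lt a : limn_sup u < a -> exists k1, forall k, (k1 <= k)%N -> u k < a.
Proof.
rewrite limn_supE// => /inf_lt[|_ [n _ <-] h]; first by exists (sups u 0%N), 0%N.
exists n => k nk; apply: le_lt_trans h; apply: ub_le_sup; [exact: sup_ub|by exists k].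
Qed.

Lemma limn_sup_gt a : a < limn_sup u -> forall k0, exists2 k, (k0 <= k)%N & a < u k.
Proof.
rewrite limn_supE// => h k0.
have : a < sup (sdrop u k0).
  by apply: lt_le_trans h _; apply: ge_inf => //; exists k0.
by move=> /sup_gt[|_ [k kk <-] ?]; [exists (u k0), k0 => /=|exists k].
Qed.

End limsup.

Lemma count_lt (R : realType) (a : int) n :
  \sum_(i < n) (i%:Z < a)%R%:R = (if a <= 0 then 0%N else minn `|a| n)%:R :> R.
Proof.
elim: n => [|n IH]; first by rewrite big_ord0 minn0; case: ifP.
by rewrite big_ord_recr /= IH -natrD; congr _%:R; case: ifPn => a0; case: ltrP => an /=; lia.
Qed.

Section speed.
Context d (Ω : measurableType d) (R : realType) (Q : probability Ω R).
Variable (Y : int * nat -> Ω -> R).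
Hypothesis hY : indep_exp Q (fun=> 1) Y.
Hypothesis Y0 : forall k w, 0 < Y k w.
Hypothesis Yd : forall w, divg (Y ^~ w).
Hypothesis Yap : {ae Q, forall w, apart (Y ^~ w)}.

(* The position of the second class particle at time [tm R k], truncated to
   [[- tm R k, tm R k]] and rescaled, read off the two interfaces. *)
Definition spd (k : nat) (w : Ω) : R :=
  (\sum_(i < (k ^ 64).*2) \1_(below Y (tm R k) (i%:Z - (k ^ 64)%N%:Z)) w - tm R k) / tm R k.

(** The sequence is bounded, so the upper limit makes sense at every sample point and is measurable
    before any convergence is known. *)
Definition speed (w : Ω) : R := limn_sup (spd ^~ w).

Lemma tmE k : tm R k = (k ^ 64)%N%:R.
Proof. by rewrite natrX. Qed.

Lemma spd_bound k w : `|spd k w| <= 1.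
Proof.
have t0 : 0 <= tm R k by rewrite tmE.
have s0 : 0 <= \sum_(i < (k ^ 64).*2) \1_(below Y (tm R k) (i%:Z - (k ^ 64)%N%:Z)) w :> R.
  by apply: sumr_ge0 => i _; rewrite indicE.
have s2 : \sum_(i < (k ^ 64).*2) \1_(below Y (tm R k) (i%:Z - (k ^ 64)%N%:Z)) w <= 2 * tm R k.
  apply: (@le_trans _ _ (\sum_(i < (k ^ 64).*2) 1)).
    by apply: ler_sum => i _; rewrite indicE lern1 leq_b1.
  by rewrite sumr_const card_ord -mul2n natrM tmE.
rewrite /spd normrM normfV (ger0_norm t0); have [->|tn] := eqVneq (tm R k) 0; first by rewrite invr0 mulr0.
by rewrite ler_pdivrMr ?lt_neqAle 1?eq_sym ?tn// mul1r ler_norml; apply/andP; split; lra.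
Qed.

Lemma spd_measurable k : measurable_fun setT (spd k).
Proof.
apply: measurable_funM => //; apply: measurable_funB => //; apply: measurable_sum => i.
by apply: measurable_indic; exact: (below_measurable hY Y0 Yd).
Qed.

Lemma speed_measurable : measurable_fun setT speed.
Proof.
apply: measurable_fun_limn_sup => [w _|w _|k].
- by exists 1 => _ [k _ <-]; have := spd_bound k w; rewrite ler_norml => /andP[].
- by exists (-1) => _ [k _ <-]; have := spd_bound k w; rewrite ler_norml => /andP[].
- exact: spd_measurable.
Qed.

Section path.
Variables (w : Ω) (X : R -> int).
Hypothesis HX : separates (Y ^~ w) X.

Lemma belowE t x : 0 <= t -> (w \in below Y t x) = (x < X t).
Proof.
move=> t0; have := HX x t0; have -> : (w \in below Y t x) = (H (Y ^~ w) (-1) 0 t x < H (Y ^~ w) 0 0 t x)%N.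
  by apply/idP/idP; rewrite inE.
case: ifPn => [h ->|h <-]; first by rewrite ltnNge leqnSn ltNge h.
by rewrite ltnSn ltNge h.
Qed.

(** The sum in [spd] counts the sites of the window to the left of the particle, so [spd] is the
    velocity clipped to [[-1, 1]]; clipping does not affect the comparison with a level strictly
    inside. *)
Lemma spdE k (v : R) : (0 < k)%N -> `|v| < 1 -> (v < spd k w) = (v < (X (tm R k))%:~R / tm R k).
Proof.
move=> k0; rewrite ltr_norml => /andP[v1 v2].
have n0 : (0 < k ^ 64)%N by rewrite expn_gt0 k0.
have t0 : 0 < tm R k by rewrite tmE ltr0n.
rewrite /spd !ltr_pdivlMr//.
have -> : \sum_(i < (k ^ 64).*2) \1_(below Y (tm R k) (i%:Z - (k ^ 64)%N%:Z)) w =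
    \sum_(i < (k ^ 64).*2) (i%:Z < X (tm R k) + (k ^ 64)%N%:Z)%R%:R :> R.
  by apply: eq_bigr => i _; rewrite indicE belowE ?ltW// ltrBlDr.
rewrite count_lt; set n := (k ^ 64)%N in n0 *.
have tE : tm R k = n%:R by exact: tmE.
move: (X (tm R k)) => x; rewrite tE in t0 *; move: (n) n0 t0 => m m0 t0.
have vm1 : - m%:R < v * m%:R by rewrite -mulN1r ltr_pM2r.
have vm2 : v * m%:R < m%:R by rewrite -[ltRHS]mul1r ltr_pM2r.
case: ifPn => [x0|x0].
  have : x%:~R <= - m%:R :> R by rewrite pmulrn -rmorphN ler_int; move: x0; clear; lia.
  by move=> xm; rewrite sub0r; apply/idP/idP; lra.
have [xm|xm] := leqP `|(x + m%:Z)%R| m.*2.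
  have -> : (`|(x + m%:Z)%R|%N%:R : R) = x%:~R + m%:R.
    by rewrite natr_absz ger0_norm ?rmorphD//= ?pmulrn//; move: x0; clear; lia.
  by rewrite addrK.
have : m%:R <= x%:~R :> R by rewrite pmulrn ler_int; move: x0 xm; clear; lia.
by move=> mx; rewrite -muln2 natrM; apply/idP/idP; lra.
Qed.

Lemma spd_below k (v : R) : (0 < k)%N -> `|v| < 1 -> (v < spd k w) = (w \in below Y (tm R k) (Num.floor (v * tm R k))).
Proof.
move=> k0 v1; have t0 : 0 < tm R k by rewrite tmE ltr0n expn_gt0 k0.
by rewrite spdE// belowE ?ltW// ltr_pdivlMr// floor_lt_int.
Qed.

End path.

Lemma pr_le A B : measurable A -> measurable B -> A `<=` B -> pr Q A <= pr Q B.
Proof. by move=> mA mB AB; rewrite -lee_fin -!prE//; apply: le_measure; rewrite ?inE. Qed.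

Lemma pr_ae A B N : measurable A -> measurable B -> Q.-negligible N -> A `<=` B `|` N -> pr Q A <= pr Q B.
Proof.
move=> mA mB [M [mM QM NM]] AB; rewrite -lee_fin -!prE//.
apply: (@le_trans _ _ (Q (B `|` M))).
  apply: le_measure; rewrite ?inE//; first exact: measurableU.
  by move=> w /AB[|/NM]; [left|right].
apply: (le_trans (measureU2 Q mB mM)).
by rewrite -[leRHS]adde0; apply: leeD => //; rewrite le_eqVlt; apply/predU1l; exact: QM.
Qed.

(** Fatou's lemma for events, with the measurability of the lower limit. *)
Lemma pr_liminf (B : nat -> set Ω) c : (forall k, measurable (B k)) ->
  (forall e, 0 < e -> exists k1, forall k, (k1 <= k)%N -> pr Q (B k) <= c + e) ->
  measurable (\bigcup_n \bigcap_(k >= n) B k) /\ pr Q (\bigcup_n \bigcap_(k >= n) B k) <= c.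
Proof.
move=> mB hB; pose F n := \bigcap_(k >= n) B k.
have mF n : measurable (F n) by apply: bigcap_measurable => //; exists n => /=.
have mU : measurable (\bigcup_n F n) by exact: bigcupT_measurable.
split => //; apply/ler_addgt0Pr => e e0; have [k1 hk] := hB e e0.
have ndF : nondecreasing_seq F.
  move=> n m nm; apply/subsetPset => w h k /= mk; apply: h => /=; exact: leq_trans mk.
rewrite -lee_fin -prE//.
have cv := nondecreasing_cvg_mu (mu := Q) mF mU ndF.
rewrite -(cvg_lim _ cv)//; apply: lime_le; first by apply/cvg_ex; eexists; exact: cv.
near=> n; rewrite /= prE// lee_fin; apply: (@le_trans _ _ (pr Q (B (maxn k1 n)))).
  by apply: pr_le => // w h; apply: h => /=; exact: leq_maxr.
by apply: hk; exact: leq_maxl.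
Unshelve. all: by end_near.
Qed.

Lemma speed_gt_measurable a : measurable [set w | a < speed w].
Proof. exact: measurable_gt speed_measurable. Qed.

Lemma speed_lt_measurable a : measurable [set w | speed w < a].
Proof.
have := speed_measurable measurableT (measurable_itv `]-oo, a[); rewrite setTI.
by congr (measurable _); apply/seteqP; split => w /=; rewrite in_itv.
Qed.

Lemma separates_ae : {ae Q, forall w, exists X, separates (Y ^~ w) X}.
Proof.
apply: filterS2 Yap (spreading_ae hY Y0 Yd) => w a s.
exact: separates_exists (Y0 ^~ w) (Yd w) s a.
Qed.

(** An upper limit below [v] puts all large scales below [v], so Fatou applies directly. *)
Lemma speed_lt_le (v : R) : `|v| < 1 -> pr Q [set w | speed w < v] <= (1 + v) / 2.
Proof.
move=> v1; pose B k := ~` below Y (tm R k) (Num.floor (v * tm R k)).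
have mB k : measurable (B k) by apply: measurableC; exact: (below_measurable hY Y0 Yd).
have [mU hU] : measurable (\bigcup_n \bigcap_(k >= n) B k) /\ pr Q (\bigcup_n \bigcap_(k >= n) B k) <= (1 + v) / 2.
  apply: pr_liminf => // e e0; have [k1 hk] := below_limit hY Y0 Yd Yap v1 e0.
  exists k1 => k /hk; rewrite pr_setC; last exact: (below_measurable hY Y0 Yd).
  by rewrite ler_norml; lra.
apply: le_trans hU; apply: (pr_ae _ mU separates_ae); first exact: speed_lt_measurable.
move=> w /= hw; have [[X HX]|nX] := pselect (exists X, separates (Y ^~ w) X); [left|by right].
have [k1 hk] := limn_sup_lt (fun k => spd_bound k w) hw.
exists (maxn 1 k1) => // k /=; rewrite geq_max => /andP[k0 kk].
by rewrite /B /= => b; have := hk k kk; rewrite ltNge le_eqVlt (spd_below HX)// orbC mem_set.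
Qed.

(** An upper limit above [v] gives only infinitely many scales above [v]; [steady_above] turns them
    into all large scales at the price of lowering [v] by [eta], and then Fatou applies. *)
Lemma speed_gt_le (v : R) : `|v| < 1 -> pr Q [set w | v < speed w] <= (1 - v) / 2.
Proof.
rewrite ltr_norml => /andP[v1 v2]; apply/ler_addgt0Pr => e e0.
pose eta := Num.min e ((1 + v) / 2).
have eta0 : 0 < eta by rewrite lt_min e0 divr_gt0//; lra.
have etae : eta <= e by rewrite ge_min lexx.
have etav : eta <= (1 + v) / 2 by rewrite ge_min lexx orbT.
pose v' := v - eta; have v'1 : `|v'| < 1 by rewrite ltr_norml /v'; apply/andP; split; lra.
pose B k := below Y (tm R k) (Num.floor (v' * tm R k)).
have mB k : measurable (B k) by exact: (below_measurable hY Y0 Yd).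
have [mU hU] : measurable (\bigcup_n \bigcap_(k >= n) B k) /\ pr Q (\bigcup_n \bigcap_(k >= n) B k) <= (1 - v') / 2.
  apply: pr_liminf => // e1 e10; have [k1 hk] := below_limit hY Y0 Yd Yap v'1 e10.
  by exists k1 => k /hk; rewrite ler_norml; lra.
apply: (@le_trans _ _ ((1 - v') / 2)); last by rewrite /v'; lra.
apply: le_trans hU; apply: (pr_ae _ mU (negligibleU separates_ae (steady_ae hY Y0 Yd))); first exact: speed_gt_measurable.
move=> w /= hw; have [[X HX]|nX] := pselect (exists X, separates (Y ^~ w) X); last by right; left.
have [st|nst] := pselect (forall X, separates (Y ^~ w) X -> steady (fun T => (X T)%:~R / T)); last by right; right.
left; have io := limn_sup_gt (fun k => spd_bound k w) hw.
have vv : `|v| < 1 by rewrite ltr_norml v1.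
have [k1 hk] := steady_above (st X HX) eta0 (v := v') ltac:(by rewrite /v'; lra) ltac:(by rewrite /v'; lra)
  ltac:(move=> k0; have [k kk hk] := io (maxn 1 k0); move: kk; rewrite geq_max => /andP[k1 kk]; exists k => //;
     rewrite /v' subrK -(spdE HX)//).
exists (maxn 1 k1) => // k /=; rewrite geq_max => /andP[k0 kk].
by have := hk k kk; rewrite -(spdE HX)// (spd_below HX)// inE.
Qed.

(** The two one-sided bounds add up to [1], so after an arbitrarily small shift of [v] they become
    an equality. *)
Lemma speed_tail (v : R) : `|v| < 1 -> pr Q [set w | v < speed w] = (1 - v) / 2.
Proof.
move=> v1; apply/eqP; rewrite eq_le speed_gt_le//=; apply/ler_addgt0Pr => e e0.
move: (v1); rewrite ltr_norml => /andP[w1 w2].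
pose eta := Num.min e ((1 - v) / 2).
have eta0 : 0 < eta by rewrite lt_min e0 divr_gt0//; lra.
have etae : eta <= e by rewrite ge_min lexx.
have etav : eta <= (1 - v) / 2 by rewrite ge_min lexx orbT.
have v'1 : `|v + eta| < 1 by rewrite ltr_norml; apply/andP; split; lra.
have h := speed_lt_le v'1.
have : pr Q (~` [set w | speed w < v + eta]) <= pr Q [set w | v < speed w].
  apply: pr_le; [by apply: measurableC; exact: speed_lt_measurable|exact: speed_gt_measurable|].
  by move=> w /= /negP; rewrite -leNgt; apply: lt_le_trans; lra.
by rewrite pr_setC; [lra|exact: speed_lt_measurable].
Qed.

Lemma speed_gt (a : R) : Q [set w | a < speed w] =
  (if a < -1 then 1 else if a < 1 then (1 - a) / 2 else 0)%:E.
Proof.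
rewrite prE; last exact: speed_gt_measurable.
congr _%:E; case: ltP => a1.
  apply/eqP; rewrite eq_le -lee_fin -prE; last exact: speed_gt_measurable.
  rewrite probability_le1/=; last exact: speed_gt_measurable.
  apply/ler_addgt0Pr => e e0; pose v := Num.min 0 (-1 + e).
  have v0 : v <= 0 by rewrite ge_min lexx.
  have ve : v <= -1 + e by rewrite ge_min lexx orbT.
  have v1 : -1 < v by rewrite lt_min; apply/andP; split; lra.
  have vv : `|v| < 1 by rewrite ltr_norml v1 /=; lra.
  have := pr_le (speed_gt_measurable v) (speed_gt_measurable a).
  rewrite (speed_tail vv) => h; have : (1 - v) / 2 <= pr Q [set w | a < speed w].
    by apply: h => w /=; apply: lt_trans; lra.
  by lra.
case: ltP => a2; last first.
  apply/eqP; rewrite eq_le pr_ge0 andbT; apply/ler_addgt0Pr => e e0; pose v := Num.max 0 (1 - e).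
  have v0 : 0 <= v by rewrite le_max lexx.
  have ve : 1 - e <= v by rewrite le_max lexx orbT.
  have v1 : v < 1 by rewrite gt_max; apply/andP; split; lra.
  have vv : `|v| < 1 by rewrite ltr_norml v1 andbT; lra.
  have := pr_le (speed_gt_measurable a) (speed_gt_measurable v).
  rewrite (speed_tail vv) => h; have : pr Q [set w | a < speed w] <= (1 - v) / 2.
    by apply: h => w /=; apply: le_lt_trans; lra.
  by lra.
have [a1'|a1'] := eqVneq a (-1); last first.
  by apply: speed_tail; rewrite ltr_norml a2 andbT lt_neqAle eq_sym a1'.
rewrite a1'; apply/eqP; rewrite eq_le; apply/andP; split.
  rewrite -lee_fin -prE; last exact: speed_gt_measurable.
  apply: (le_trans (probability_le1 Q (speed_gt_measurable _))); rewrite lee_fin; lra.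
apply/ler_addgt0Pr => e e0; pose v := Num.min 0 (-1 + e).
have v0 : v <= 0 by rewrite ge_min lexx.
have ve : v <= -1 + e by rewrite ge_min lexx orbT.
have v1 : -1 < v by rewrite lt_min; apply/andP; split; lra.
have vv : `|v| < 1 by rewrite ltr_norml v1 /=; lra.
have := pr_le (speed_gt_measurable v) (speed_gt_measurable (-1)).
rewrite (speed_tail vv) => h; have : (1 - v) / 2 <= pr Q [set w | -1 < speed w].
  by apply: h => w /=; apply: lt_trans; lra.
by lra.
Qed.

(** Read off the law. The path estimates cover only velocities away from the endpoints, and
    [steady_cvg] asks for such a limit. *)
Lemma speed_interior : {ae Q, forall w, `|speed w| < 1}.
Proof.
have n1 : Q.-negligible (~` [set w | -1 < speed w]).
  have E : Q (~` [set w | -1 < speed w]) = 0%E.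
    rewrite probability_setC; last exact: speed_gt_measurable.
    have lt1 : (-1 : R) < 1 by lra.
    by rewrite speed_gt ltxx lt1 -EFinB; congr _%:E; lra.
  by apply/negligibleP => //; apply: measurableC; exact: speed_gt_measurable.
have n2 : Q.-negligible (~` [set w | speed w < 1]).
  apply/negligibleP; first by apply: measurableC; exact: speed_lt_measurable.
  apply/eqP; rewrite eq_le measure_ge0 andbT; apply/lee_addgt0Pr => e e0; rewrite add0e.
  pose v := Num.max 0 (1 - e).
  have v0 : 0 <= v by rewrite le_max lexx.
  have ve : 1 - e <= v by rewrite le_max lexx orbT.
  have v1 : v < 1 by rewrite gt_max; apply/andP; split; lra.
  have vv : `|v| < 1 by rewrite ltr_norml v1 andbT; lra.
  apply: (@le_trans _ _ (Q [set w | v < speed w])).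
    apply: le_measure; rewrite ?inE; [by apply: measurableC; exact: speed_lt_measurable|exact: speed_gt_measurable|].
    by move=> w /= /negP; rewrite -leNgt; apply: lt_le_trans.
  by rewrite prE ?speed_tail// ?lee_fin; [lra|exact: speed_gt_measurable].
apply: negligibleS (negligibleU n1 n2) => w /=; apply: contra_notP => /not_orP[/contrapT h1 /contrapT h2].
by rewrite ltr_norml h1 h2.
Qed.

(** By definition of the upper limit, [spd] is eventually below [speed w + g / 2] and infinitely
    often above [speed w - g]; a late scale with both properties starts [steady_cvg]. *)
Lemma speed_cvg : {ae Q, forall w, forall X, separates (Y ^~ w) X -> (X T)%:~R / T @[T --> +oo] --> speed w}.
Proof.
apply: filterS2 speed_interior (steady_ae hY Y0 Yd) => w U1 st X HX.
apply: (steady_cvg (st X HX) U1) => eta eta0 k0.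
pose g := Num.min eta ((1 - `|speed w|) / 2).
have g0 : 0 < g by rewrite lt_min eta0 divr_gt0// subr_gt0.
have ge : g <= eta by rewrite ge_min lexx.
have gU : g <= (1 - `|speed w|) / 2 by rewrite ge_min lexx orbT.
have a1 : `|speed w - g| < 1.
  by apply: le_lt_trans (ler_normB _ _) _; rewrite (gtr0_norm g0); lra.
have a2 : `|speed w + g / 2| < 1.
  apply: le_lt_trans (ler_normD _ _) _; rewrite (gtr0_norm (divr_gt0 g0 (ltr0Sn R 1))); lra.
have lt1 : limn_sup (spd ^~ w) < speed w + g / 2 by rewrite -/(speed w) ltrDl divr_gt0.
have [k1 hk1] := limn_sup_lt (fun k => spd_bound k w) lt1.
have gt1 : speed w - g < limn_sup (spd ^~ w) by rewrite -/(speed w) gtrBl.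
have [k kk hk] := limn_sup_gt (fun k => spd_bound k w) gt1 (maxn 1 (maxn k0 k1)).
move: kk; rewrite !geq_max => /and3P[kp kk0 kk1]; exists k => //.
move: hk; rewrite (spdE HX)// => h1.
have h2 : ~~ (speed w + g / 2 < spd k w) by rewrite -leNgt ltW// hk1.
move: h2; rewrite (spdE HX)// -leNgt => h2.
by rewrite ltr_norml; apply/andP; split; lra.
Qed.

End speed.

(** * From Poisson clocks to the theorem *)

Section uniform.
Context (R : realType).

Lemma uniform_tail (a : R) : (\int[lebesgue_measure]_(x in `]a, +oo[) (uniform_pdf (-1 : R) 1 x)%:E)%E =
  (if a < -1 then 1 else if a < 1 then (1 - a) / 2 else 0)%:E.
Proof.
rewrite integral_uniform_pdf.
have cst (D : set R) : measurable D -> D `<=` `[-1, 1]%classic ->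
    (\int[lebesgue_measure]_(x in D) (uniform_pdf (-1 : R) 1 x)%:E = (2^-1)%:E * lebesgue_measure D)%E.
  move=> mD D1; rewrite -integral_cst//; apply: eq_integral => x; rewrite inE => /D1 /=.
  by rewrite in_itv /= /uniform_pdf => ->; rewrite opprK.
have itvI : `]a, +oo[%classic `&` `[-1, 1]%classic = [set x : R | a < x /\ -1 <= x <= 1].
  by apply/seteqP; split => x /=; rewrite !in_itv /= andbT.
case: ltP => a1.
  rewrite (_ : _ `&` _ = `[-1, 1]%classic); last first.
    by rewrite setIidr// => x /=; rewrite !in_itv /= andbT => /andP[h _]; exact: lt_le_trans h.
  rewrite cst// lebesgue_measure_itv /= lte_fin ifT; last by lra.
  by rewrite -EFinB -EFinM; congr _%:E; lra.
case: ltP => a2.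
  rewrite (_ : _ `&` _ = `]a, 1]%classic); last first.
    apply/seteqP; split => x /=; rewrite !in_itv /= andbT; first by move=> [-> /andP[]].
    by move=> /andP[h ->]; split => //; rewrite andbT ltW// (le_lt_trans a1).
  rewrite cst//; last first.
    by move=> x /=; rewrite !in_itv /= => /andP[h ->]; rewrite andbT ltW// (le_lt_trans a1).
  rewrite lebesgue_measure_itv /= lte_fin a2.
  by rewrite -EFinB -EFinM; congr _%:E; lra.
rewrite (_ : _ `&` _ = set0) ?integral_set0//.
apply/seteqP; split => x //=; rewrite !in_itv /= andbT => -[h /andP[_ h']].
by move: (lt_le_trans h h'); rewrite ltNge a2.
Qed.

Lemma uniform_law d (Ω : measurableType d) (Q : probability Ω R) (U : Ω -> R) (B : set R) :
  measurable_fun setT U -> (forall a : R, Q [set w | a < U w] =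
    (if a < -1 then 1 else if a < 1 then (1 - a) / 2 else 0)%:E) -> measurable B ->
  (Q (U @^-1` B) = \int[lebesgue_measure]_(x in B) (uniform_pdf (-1 : R) 1 x)%:E)%E.
Proof.
move=> mU tU mB; have ab : (-1 : R) < 1 by lra.
have mU' : measurable_fun setT (U : Ω -> measurableTypeR R) := mU.
pose F : {mfun Ω >-> measurableTypeR R} := HB.pack (U : Ω -> measurableTypeR R) (isMeasurableFun.Build _ _ _ _ _ mU').
change (pushforward Q F B = uniform_prob ab B).
apply: (@measure_unique _ R (measurableTypeR R) (@RGenOInfty.G R) (fun n => `]- n%:R, +oo[%classic)) => //.
- exact: RGenOInfty.measurableE.
- move=> _ _ [x ->] [y ->]; exists (Num.max x y).
  by apply/seteqP; split => z /=; rewrite !in_itv /= !andbT gt_max; [move=> [-> ->]|move=> /andP[]].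
- by move=> n; eexists; reflexivity.
- apply/seteqP; split => // x _; exists (Num.truncn `|x|).+1 => //=; rewrite in_itv /= andbT.
  by rewrite ltrNl; apply: le_lt_trans (truncnS_gt _); rewrite -normrN ler_norm.
- move=> _ [x ->]; rewrite /= /uniform_prob uniform_tail -tU /pushforward /=.
  by congr (Q _); apply/seteqP; split => w /=; rewrite in_itv /= andbT.
- move=> n; apply: le_lt_trans (ltry 1); apply: (probability_le1 Q).
  by rewrite -[X in measurable X]setTI; exact: mU.
Qed.

End uniform.

Section clocks.
Context d (Ω : measurableType d) (R : realType) (Q : probability Ω R).
Variable tau : int * nat -> Ω -> R.

Lemma clocks_indep : poisson_clocks Q tau -> indep_exp Q (fun=> 1) tau.
Proof.
move=> [mt [law ind]]; split => // s a us.
pose J : {fset (int * nat)} := [fset x in s]%fset.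
have Js i : (i \in J) = (i \in s) by rewrite !inE.
have := ind J (fun i => `]a i, +oo[%classic) (fun i => measurable_itv _).
have -> : \bigcap_(i in [set` J]) (tau i @^-1` `]a i, +oo[) = [set w | forall i, i \in s -> a i < tau i w].
  apply/seteqP; split => w /= h i.
    by rewrite -Js => /h /=; rewrite in_itv /= andbT.
  by rewrite /= Js => /h /=; rewrite in_itv /= andbT.
move=> ->.
have -> : (\prod_(i <- J) Q (tau i @^-1` `]a i, +oo[) = \prod_(i <- s) Q (tau i @^-1` `]a i, +oo[))%E.
  by apply: perm_big; apply: uniq_perm => // i; exact: Js.
elim: s {us J Js} => [|i s IH]; first by rewrite !big_nil.
rewrite !big_cons IH EFinM law ?(measurable_itv _)//; congr (_ * _)%E.
exact: exp_law_tail (a i) ltr01.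
Qed.

Hypothesis hY : indep_exp Q (fun=> 1) tau.

Lemma countable_ae (T : countType) (P : T -> Ω -> Prop) :
  (forall i, {ae Q, forall w, P i w}) -> {ae Q, forall w, forall i, P i w}.
Proof.
move=> h.
have all1 : {ae Q, forall w, forall k i, choice.unpickle k = Some i -> P i w}.
  apply: ae_foralln => k; case E : (choice.unpickle k) => [i|]; last by apply: aeW => w i.
  by apply: filterS (h i) => w h' i' [<-].
by apply: filterS all1 => w h' i; exact: h' (choice.pickleK i).
Qed.

Lemma positive_ae : {ae Q, forall w, forall i, 0 < tau i w}.
Proof.
apply: countable_ae => i; have m0 : measurable [set w | 0 < tau i w] by apply: measurable_gt; exact: hY.1.
apply/negligibleP; first exact: measurableC.
have := hY.2 [:: i] (fun=> 0) isT; rewrite big_seq1 maxxx mulr0 expR0.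
rewrite (_ : [set w | _] = [set w | 0 < tau i w]) => [Q1|].
  by have := probability_setC Q m0; rewrite Q1 subee.
by apply/seteqP; split => w /= h; [apply: h; rewrite mem_head|move=> j; rewrite inE => /eqP ->].
Qed.

Lemma divg_ae : {ae Q, forall w, divg (tau ^~ w)}.
Proof.
(* The second component of the index serves as the level to be exceeded, so one countable index
   covers sites and levels. *)
have one (i : int * nat) : {ae Q, forall w, exists n, i.2%:R < psum (tau ^~ w) i.1 0 n}.
  case: i => x m /=.
  have N1 : Q.-negligible [set w | forall n, psum (tau ^~ w) x 0 n <= m%:R].
    apply: small_negligible => [e e0|].
      have [n hn] := @small_expR_nat _ _ _ Q (fun n => [set w | \sum_(i <- iota 0 n.+1) tau (x, i) w <= m%:R]) m%:R e e0
        (fun n => sum_spread m%:R n hY (fun i j (e : (x, i) = (x, j)) => congr1 snd e)).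
      apply: small_sub hn => w /= h; apply: le_trans (h n.+1).
      by rewrite /psum -(big_mkord xpredT (fun l => tau (x, (0 + l)%N) w)).
    rewrite (_ : [set w | _] = \bigcap_n ~` [set w | m%:R < psum (tau ^~ w) x 0 n]).
      apply: bigcapT_measurable => n; apply: measurableC; apply: measurable_gt.
      by apply: measurable_sum => l; exact: hY.1.
    by apply/seteqP; split => w h n; [move=> _; apply/negP; rewrite -leNgt|have /negP := h n I; rewrite -leNgt].
  apply: negligibleS N1 => w /=; apply: contra_notP => /existsNP[n /negP h].
  by exists n; rewrite ltNge.
apply: filterS (countable_ae one) => w h x B; have [n hn] := h (x, (Num.truncn B).+1).
by exists n; apply: lt_trans hn; exact: truncnS_gt.
Qed.

(** A common epoch would express the first interval of the clock at [x] through the other intervals,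
    and an exponential variable charges no value determined by independent ones. *)
Lemma apart_ae : {ae Q, forall w, apart (tau ^~ w)}.
Proof.
have one (i : int * (nat * nat)) : {ae Q, forall w,
    \sum_(k < i.2.1.+1) tau (i.1, k : nat) w <> \sum_(k < i.2.2.+1) tau (i.1 + 1, k : nat) w}.
  case: i => x [n m] /=.
  pose V w := \sum_(k < m.+1) tau (x + 1, k : nat) w - \sum_(k < n) tau (x, k.+1) w.
  have mV : meas_others tau (x, 0%N) V.
    rewrite /meas_others /V; apply: measurable_funB; apply: measurable_sum => k.
      by apply: (measurable_fun_others (Y := tau)); rewrite xpair_eqE; lia.
    by apply: (measurable_fun_others (Y := tau)); rewrite xpair_eqE; lia.
  have VE w : tau (x, 0%N) w = V w <->
      \sum_(k < n.+1) tau (x, k : nat) w = \sum_(k < m.+1) tau (x + 1, k : nat) w.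
    rewrite /V [X in _ <-> X = _]big_ord_recl /=.
    by split => [->|<-]; [rewrite subrK|rewrite addrK].
  have mW : measurable [set w | tau (x, 0%N) w = V w].
    rewrite (_ : [set w | _] = (fun w => tau (x, 0%N) w - V w) @^-1` [set 0]).
      rewrite -[X in measurable X]setTI; apply: measurable_funB => //; first exact: hY.1.
      exact: (meas_othersW hY mV).
    by apply/seteqP; split => w /=; [move=> ->; rewrite subrr|exact: subr0_eq].
  have /(negligibleP Q mW) := indep_atomless (fun=> ltr01) hY mV.
  by apply: negligibleS => w /= /contrapT /VE.
apply: filterS (countable_ae one) => w h x s [n hn] [m hm].
by apply: (h (x, (n, m))); rewrite /= -hn -hm.
Qed.

End clocks.

Lemma cst1_divg (R : realType) : divg (fun=> 1 : R).
Proof.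
move=> x B; exists (Num.truncn B).+1; rewrite /psum sumr_const card_ord -mulr_natl mulr1.
exact: truncnS_gt.
Qed.

(* On a null set the clocks are replaced by deterministic ones, so that they are regular everywhere. *)
Lemma clocks_regular d (Ω : measurableType d) (R : realType) (Q : probability Ω R) (tau : int * nat -> Ω -> R) :
  indep_exp Q (fun=> 1) tau -> exists Y : int * nat -> Ω -> R,
  [/\ indep_exp Q (fun=> 1) Y, forall i w, 0 < Y i w, forall w, divg (Y ^~ w) &
      {ae Q, forall w, Y ^~ w = tau ^~ w}].
Proof.
move=> hY.
have [N [mN QN NE]] : {ae Q, forall w, (forall i, 0 < tau i w) /\ divg (tau ^~ w)}.
  by apply: filterS2 (positive_ae hY) (divg_ae hY) => w.
pose Y i w := tau i w * \1_(~` N) w + \1_N w.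
have Yout w : ~ N w -> Y ^~ w = tau ^~ w.
  by move=> Nw; apply/funext => i; rewrite /Y !indicE in_setC memNset// mulr1 addr0.
have Yin w : N w -> Y ^~ w = fun=> 1.
  by move=> Nw; apply/funext => i; rewrite /Y !indicE in_setC mem_set// mulr0 add0r.
have reg w : (forall i, 0 < Y i w) /\ divg (Y ^~ w).
  have [Nw|Nw] := pselect (N w); last first.
    have [p dv] : (forall i, 0 < tau i w) /\ divg (tau ^~ w) by apply: contrapT => h; apply: Nw; exact: NE.
    by rewrite Yout//; split => // i; have := congr1 (@^~ i) (Yout _ Nw) => /= ->.
  by rewrite Yin//; split; [move=> i; have := congr1 (@^~ i) (Yin _ Nw) => /= ->|exact: cst1_divg].
have negN : Q.-negligible N by apply/negligibleP.
have mY i : measurable_fun setT (Y i).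
  apply: measurable_funD; last exact: measurable_indic.
  by apply: measurable_funM; [exact: hY.1|apply: measurable_indic; exact: measurableC].
have cylY (s : seq (int * nat)) a : measurable [set w | forall i, i \in s -> a i < Y i w].
  exact: measurable_cylinders.
exists Y; split; [|by move=> i w; exact: (reg w).1|by move=> w; exact: (reg w).2|].
  split => // s a us; rewrite -(hY.2 s a us) !prE//; last exact: (measurable_cylinder hY).
  congr _%:E; apply/eqP; rewrite eq_le; apply/andP; split; apply: (pr_ae _ _ negN) => //.
  - exact: (measurable_cylinder hY).
  - move=> w /= h; have [Nw|Nw] := pselect (N w); [by right|left => i si].
    by have := congr1 (@^~ i) (Yout _ Nw) => /= <-; exact: h.
  - exact: (measurable_cylinder hY).
  - move=> w /= h; have [Nw|Nw] := pselect (N w); [by right|left => i si].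
    by have := congr1 (@^~ i) (Yout _ Nw) => /= ->; exact: h.
by apply: negligibleS negN => w /= h; apply: contrapT => /Yout.
Qed.

Theorem theorem2 (d : measure_display) (Ω : measurableType d) (R : realType)
    (Q : probability Ω R) (tau : int * nat -> Ω -> R) :
  poisson_clocks Q tau ->
  exists U : Ω -> R,
    measurable_fun setT U /\
    (forall B : set R, measurable B ->
       Q (U @^-1` B) =
       (\int[lebesgue_measure]_(x in B) (uniform_pdf (-1 : R) 1 x)%:E)%E) /\
    {ae Q, forall w : Ω,
       forall (eta0 eta1 : R -> int -> bool) (X : R -> int),
         tasep_from (fun i => tau i w) eta0_init eta0 ->
         tasep_from (fun i => tau i w) eta1_init eta1 ->
         (forall (t : R) (x : int), 0 <= t ->
            (eta0 t x != eta1 t x) <-> x = X t) ->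
         (fun t : R => (X t)%:~R / t) @ +oo --> U w}.
Proof.
move=> /clocks_indep ht; have [Y [hY Y0 Yd YE]] := clocks_regular ht.
have Yap : {ae Q, forall w, apart (Y ^~ w)} by apply: filterS2 YE (apart_ae ht) => w ->.
exists (speed Y); split; first exact: speed_measurable hY Y0 Yd.
split; first by move=> B; apply: uniform_law; [exact: speed_measurable hY Y0 Yd|exact: speed_gt].
(* The exceptional set depends on the clocks only; the processes and the particle are introduced
   after it. *)
apply: filterS3 YE (spreading_ae hY Y0 Yd) (speed_cvg hY Y0 Yd Yap) => w E sp cv eta0 eta1 X te0 te1 hX.
have yE : tau ^~ w = Y ^~ w by [].
apply: cv => t x t0; move: te0 te1.
by rewrite yE => te0 te1; exact: (second_class (Y0 ^~ w) (Yd w) sp x te0 te1 hX t0).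
Qed.
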